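(* Let $\phi$ be a function that is positive on the unit circle and analytic in a neighborhood of the unit circle. Let $\phi=\phi_+\phi_-$ be a Wiener–Hopf factorization and $\psi=\phi_+/\phi_-$. Let $n\ge1$, let $\pi_n(z)$ be the monic orthogonal polynomial of degree $n$ on the unit circle with respect to the measure $\phi(z)\frac{dz}{2\pi iz}$, and let $\pi_n^*(z)=z^n\overline{\pi}_n(1/z)$. Then, with $A,B,Q,R,U,V,P_n$ as defined in the context, $$\pi_n^*(z)=e^{-\sum_{k=1}^\infty(\log\phi)_kz^k}\Bigl\{1-\Bigl\langle\frac1{1-P_nABP_n}P_nQ,\,P_nR\Bigr\rangle_{\ell^2(\mathbb{N}_0)}\Bigr\},\qquad |z|<1,$$ and $$\pi_n(z)=z^ne^{-\sum_{k=1}^\infty(\log\phi)_{-k}z^{-k}}\Bigl\{1-\Bigl\langle\frac1{1-P_nABP_n}P_nU,\,P_nV\Bigr\rangle_{\ell^2(\mathbb{N}_0)}\Bigr\},\qquad |z|>1.$$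
   Context: $\mathbb{N}_0=\{0,1,2,\dots\}$. For a function $g$ on the unit circle, $g_k=\int_{|z|=1}z^{-k}g(z)\frac{dz}{2\pi iz}$ is its $k$-th Fourier coefficient; $(\log\phi)_k$ uses the real logarithm of $\phi$ on the circle. A Wiener–Hopf factorization $\phi=\phi_+\phi_-$ means $\phi_+$ extends to a non-vanishing analytic function in the interior of the unit circle and $\phi_-$ extends to a non-vanishing analytic function in the exterior of the unit circle (including $\infty$). $\overline{\pi}_n$ is the polynomial whose coefficients are the complex conjugates of those of $\pi_n$. $\langle a,b\rangle_{\ell^2(\mathbb{N}_0)}=\sum_{j\ge0}a(j)b(j)$ is the real (bilinear) inner product, and $P_n$ is the projection on $\{n,n+1,n+2,\dots\}$. The operators $A,B:\ell^2(\mathbb{N}_0)\to\ell^2(\mathbb{N}_0)$ have kernels $$A(j,m)=(\psi^{-1})_{j+m+1},\qquad B(m,k)=\psi_{-m-k-1}.$$ For $|z|<1$, $$Q(j)=(\psi^{-1})_{j+1},\qquad R(k)=\int_{|b|=1}b^{k+1}\frac{z}{b-z}\psi(b)\frac{db}{2\pi ib}.$$ For $|z|>1$, $$U(j)=\int_{|a|=1}a^{-j-1}\frac{a}{z-a}\frac1{\psi(a)}\frac{da}{2\pi ia},\qquad V(k)=\psi_{-k-1}.$$ *)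

(* Defs.v *)
(* Stdlib reals with Coquelicot: complex numbers, Riemann integrals, series. *)
From Stdlib Require Import Reals ZArith Lia.
From Coquelicot Require Import Coquelicot.
Local Open Scope C_scope.

(** * Complex functions *)

Definition Cexp (z : C) : C :=
  RtoC (exp (Re z)) * (cos (Im z), sin (Im z)).

Definition zpow (z : C) (k : Z) : C :=
  match k with
  | Z0 => 1
  | Zpos m => z ^ Pos.to_nat m
  | Zneg m => / z ^ Pos.to_nat m
  end.

(* [Csum u] is meaningful only when [u] is summable ([ex_series u]). *)
Definition Csum (u : nat -> C) : C :=
  (Series (fun k => Re (u k)), Series (fun k => Im (u k))).

Definition analytic_at (f : C -> C) (z0 : C) : Prop :=
  exists a : nat -> C,
    locally z0 (fun z : C =>
      is_pseries (K := C_AbsRing) (V := C_NormedModule) a (z - z0) (f z)).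

Definition analytic_near_circle (f : C -> C) : Prop :=
  exists U : C -> Prop,
    open U /\ (forall z, Cmod z = 1%R -> U z) /\
    (forall z, U z -> analytic_at f z).

Definition positive_on_circle (f : C -> C) : Prop :=
  forall z, Cmod z = 1%R -> exists r : R, (0 < r)%R /\ f z = RtoC r.

(* The integral of [g(z) dz / (2 pi i z)] over |z| = 1: with [z = e^{it}] one
   has [dz / (2 pi i z) = dt / (2 pi)]. *)
Definition circle_int (g : C -> C) : C :=
  RtoC (/ (2 * PI)) *
  RInt (V := C_R_CompleteNormedModule)
    (fun t : R => g (cos t, sin t)) 0 (2 * PI).

Definition fourier (g : C -> C) (k : Z) : C :=
  circle_int (fun z => zpow z (- k) * g z).

Definition log_circle (phi : C -> C) : C -> C :=
  fun z => RtoC (ln (Re (phi z))).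

(** * Wiener-Hopf factorization *)

(* Only the values of [f] on the circle matter.  Continuity of the extension
   [F] up to the circle is what ties it to these boundary values. *)
Definition extends_to_disk (f : C -> C) : Prop :=
  exists F : C -> C,
    (forall z, Cmod z = 1%R -> F z = f z) /\
    (forall z, (Cmod z < 1)%R -> analytic_at F z /\ F z <> 0) /\
    (forall z, (Cmod z <= 1)%R ->
       filterlim F (within (fun w => (Cmod w <= 1)%R) (locally z))
         (locally (F z))).

(* The exterior of the circle, including the point at infinity, is the unit
   disk in the coordinate [w = 1/z]. *)
Definition extends_to_exterior (f : C -> C) : Prop :=
  extends_to_disk (fun w => f (/ w)).

Definition wiener_hopf (phi phip phim : C -> C) : Prop :=
  (forall z, Cmod z = 1%R -> phi z = phip z * phim z) /\
  extends_to_disk phip /\ extends_to_exterior phim.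

(** * Orthogonal polynomials on the unit circle *)

(* Coefficient sequences: only [p 0], ..., [p n] are used. *)
Definition cpoly (p : nat -> C) (n : nat) (z : C) : C :=
  sum_n (fun k => p k * z ^ k) n.

Definition monic_OP (phi : C -> C) (n : nat) (p : nat -> C) : Prop :=
  p n = 1 /\
  forall (q : nat -> C) (m : nat), (m < n)%nat ->
    circle_int (fun z => cpoly p n z * Cconj (cpoly q m z) * phi z) = 0.

(* The polynomial [z^n * conj(p)(1/z)], written so that it is also correct at
   [z = 0]; see [reversed_polyE]. *)
Definition reversed_poly (p : nat -> C) (n : nat) (z : C) : C :=
  sum_n (fun k => Cconj (p k) * z ^ (n - k)) n.

Lemma reversed_polyE (p : nat -> C) (n : nat) (z : C) :
  z <> 0 ->
  reversed_poly p n z = z ^ n * cpoly (fun k => Cconj (p k)) n (/ z).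
Proof.
intros hz; unfold reversed_poly, cpoly.
assert (hp : forall k, z ^ k <> 0).
{ induction k as [|k IH]; simpl.
  - intros h; exact (R1_neq_R0 (f_equal fst h)).
  - now apply Cmult_neq_0. }
assert (hv : forall k, z ^ k * (/ z) ^ k = 1).
{ induction k as [|k IH]; simpl; [ring|].
  replace (z * z ^ k * (/ z * (/ z) ^ k))
    with ((z * / z) * (z ^ k * (/ z) ^ k)) by ring.
  rewrite IH, Cinv_r by assumption; ring. }
assert (ha : forall i j, z ^ (i + j) = z ^ i * z ^ j).
{ intros i j; induction i as [|i IH]; simpl; [ring|rewrite IH; ring]. }
rewrite <- (sum_n_mult_l (K := C_Ring) (z ^ n)).
apply sum_n_ext_loc; intros k hk.
change (Cconj (p k) * z ^ (n - k) = z ^ n * (Cconj (p k) * (/ z) ^ k)).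
replace (z ^ n) with (z ^ (n - k) * z ^ k) by
  (rewrite <- ha; f_equal; lia).
transitivity (Cconj (p k) * z ^ (n - k) * (z ^ k * (/ z) ^ k));
  [rewrite hv|]; ring.
Qed.

(** * Operators on l^2(N_0) *)

Definition ell2 (f : nat -> C) : Prop :=
  ex_series (fun j => (Cmod (f j) ^ 2)%R).

Definition ell2_norm (f : nat -> C) : R :=
  sqrt (Series (fun j => (Cmod (f j) ^ 2)%R)).

(* Bilinear: no complex conjugation. *)
Definition ell2_pairing (f g : nat -> C) : C :=
  Csum (fun j => f j * g j).

(* Operators are functions on all sequences; only their restriction to [ell2]
   is meaningful. *)
Definition bounded_op (T : (nat -> C) -> nat -> C) : Prop :=
  (forall (c : C) (f g : nat -> C), ell2 f -> ell2 g ->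
     forall j, T (fun i => c * f i + g i) j = c * T f j + T g j) /\
  (exists M : R, forall f, ell2 f ->
     ell2 (T f) /\ (ell2_norm (T f) <= M * ell2_norm f)%R).

Definition is_inverse_op (T S : (nat -> C) -> nat -> C) : Prop :=
  bounded_op S /\
  (forall f, ell2 f -> forall j, T (S f) j = f j) /\
  (forall f, ell2 f -> forall j, S (T f) j = f j).

Definition kernel_op (K : nat -> nat -> C) (f : nat -> C) : nat -> C :=
  fun j => Csum (fun m => K j m * f m).

Definition ell2_kernel (K : nat -> nat -> C) : Prop :=
  (forall f, ell2 f -> forall j, ex_series (fun m => K j m * f m)) /\
  bounded_op (kernel_op K).

(* The projection on {n, n+1, ...}. *)
Definition proj (n : nat) (f : nat -> C) : nat -> C :=
  fun j => if (n <=? j)%nat then f j else 0.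

Definition kerA (psi : C -> C) (j m : nat) : C :=
  fourier (fun z => / psi z) (Z.of_nat (j + m + 1)).

Definition kerB (psi : C -> C) (m k : nat) : C :=
  fourier psi (- Z.of_nat m - Z.of_nat k - 1).

(* The operator 1 - P_n A B P_n. *)
Definition one_minus_PABP (psi : C -> C) (n : nat) (f : nat -> C) : nat -> C :=
  fun j =>
    f j - proj n (kernel_op (kerA psi) (kernel_op (kerB psi) (proj n f))) j.

Definition seqQ (psi : C -> C) (j : nat) : C :=
  fourier (fun z => / psi z) (Z.of_nat (j + 1)).

Definition seqR (psi : C -> C) (z : C) (k : nat) : C :=
  circle_int (fun b => b ^ (k + 1) * (z / (b - z)) * psi b).

Definition seqU (psi : C -> C) (z : C) (j : nat) : C :=
  circle_int
    (fun a => zpow a (- Z.of_nat j - 1) * (a / (z - a)) * (/ psi a)).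

Definition seqV (psi : C -> C) (k : nat) : C :=
  fourier psi (- Z.of_nat k - 1).

(* The k-th term, counted from 0, is (log phi)_{k+1} z^{k+1}. *)
Definition log_terms_pos (phi : C -> C) (z : C) (k : nat) : C :=
  fourier (log_circle phi) (Z.of_nat (S k)) * z ^ S k.

Definition log_terms_neg (phi : C -> C) (z : C) (k : nat) : C :=
  fourier (log_circle phi) (- Z.of_nat (S k)) * zpow z (- Z.of_nat (S k)).

(* Main.v *)
(* Let D = exp (sum_{k >= 1} (log phi)_k z^k).  Then phi = G D conj(D) on the
   circle, and by uniqueness of the Wiener-Hopf factorization psi is a constant
   kappa times D / conj(D).

   Orthogonality says that pi_n^* phi has no frequency in 1..n.  With
   X = pi_n^* D, split X conj(D) = Y_+ + Y_- into frequencies > n and <= 0, and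
   put h = Y_+ / (kappa D).  Then h psi = X - Y_- / conj(D), so the frequencies
   <= 0 of h psi are those of 1 - Y_- / conj(D); multiplying by 1 / psi yields
   (1 - P_n A B P_n) h = - P_n Q, and pairing h with R is Cauchy's formula for
   X(z) - X(0).  The second identity is the complex conjugate of the first at
   1 / conj(z): |psi| is constant, so B is a multiple of conj(A), and both
   kernels are symmetric.

   For the inverse, normalize |psi| = 1: a square-summable u of frequencies
   <= 0 satisfies |u|^2 = |A u|^2 + |v|^2, where v is the part of u / psi of
   frequencies <= 0, and u is recovered from v by multiplying by D, projecting,
   and dividing by conj(D).  Hence A is a strict contraction, and the Neumann
   series converges. *)
Require Import Defs.
From Stdlib Require Import Reals ZArith Lia Lra Psatz.
From Stdlib Require Import Classical ClassicalEpsilon FunctionalExtensionality.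
From Coquelicot Require Import Coquelicot.
Local Open Scope C_scope.

(** The factors [phip] and [phim] are only continuous up to the circle, so they are exchanged at
    once for the Szego function, which is analytic across it. From then on every symbol lies in
    [wien], the continuous functions with exponentially decaying Fourier coefficients. This class is
    closed under products and under selection of frequencies, so series and integrals are
    interchanged by geometric majorants. General sequences of [ell2] enter only through the inverse
    operator, and one application of a Hankel kernel makes them decay.

    Complex integration is confined to one fact: the mean of a holomorphic function over a circle
    centered at 0 does not depend on the radius. It yields the vanishing of negative frequencies in
    the disk, the decay of the coefficients, and Cauchy's formula.

    Conjugating the first identity turns [A B] into [B A], so the second one also needs a
    transposition: the symmetry of both kernels moves [B A] from conj(h) onto the solution with
    right-hand side [P_n U]. *)

Lemma Cmod_sub_sym (x y : C) : Cmod (x - y) = Cmod (y - x).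
Proof. replace (y - x) with (- (x - y)) by ring. now rewrite Cmod_opp. Qed.

Lemma Cmod_sub_le (x y z : C) : (Cmod (x - z) <= Cmod (x - y) + Cmod (y - z))%R.
Proof. replace (x - z) with ((x - y) + (y - z)) by ring. apply Cmod_triangle. Qed.

Lemma Csub_neq_0 (x y : C) : x <> y -> x - y <> 0.
Proof.
intros H E; apply H; replace x with ((x - y) + y) by ring; rewrite E; ring.
Qed.

Lemma RtoC_neq_0 (x : R) : x <> 0%R -> RtoC x <> 0.
Proof. intros H E; apply H, RtoC_inj, E. Qed.

Lemma Cconj_0 : Cconj 0 = 0.
Proof. apply injective_projections; simpl; ring. Qed.

Lemma Cconj_RtoC (x : R) : Cconj (RtoC x) = RtoC x.
Proof. apply injective_projections; simpl; ring. Qed.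

Lemma Cconj_neq_0 (z : C) : z <> 0 -> Cconj z <> 0.
Proof. intros H E; apply H; now rewrite <- (Cconj_conj z), E, Cconj_0. Qed.

Lemma C1_neq_0 : (1 : C) <> 0.
Proof. intros h; exact (R1_neq_R0 (f_equal fst h)). Qed.

Lemma Cinv_neq_0 (z : C) : z <> 0 -> / z <> 0.
Proof. intros H E; apply C1_neq_0; rewrite <- (Cinv_r z H), E; ring. Qed.

Lemma Cmod_inv_conj_lt (z : C) : (1 < Cmod z)%R -> z <> 0 /\ (Cmod (/ Cconj z) < 1)%R.
Proof.
intros Hz; assert (H0 : z <> 0) by (intros ->; rewrite Cmod_0 in Hz; lra).
split; [exact H0|]; rewrite Cmod_inv, Cmod_conj by now apply Cconj_neq_0.
rewrite <- Rinv_1; apply Rinv_lt_contravar; lra.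
Qed.

Lemma Re_Cminus (x y : C) : Re (x - y) = (Re x - Re y)%R.
Proof. reflexivity. Qed.

Lemma Im_Cminus (x y : C) : Im (x - y) = (Im x - Im y)%R.
Proof. reflexivity. Qed.

Lemma Cmod_le_Re_Im (x : C) : (Cmod x <= Rabs (Re x) + Rabs (Im x))%R.
Proof.
destruct x as [a b]; simpl.
replace ((a, b) : C) with (RtoC a + Ci * RtoC b).
2:{ unfold Ci, RtoC; apply injective_projections; simpl; ring. }
eapply Rle_trans; [apply Cmod_triangle|].
rewrite Cmod_mult, Cmod_Ci, !Cmod_R; lra.
Qed.

Lemma im_le_Cmod (x : C) : (Rabs (Im x) <= Cmod x)%R.
Proof. eapply Rle_trans; [apply Rmax_r|apply Rmax_Cmod]. Qed.

(** * Limits of complex-valued functions along a filter *)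

Section Limits.
Context {T : Type} {F : (T -> Prop) -> Prop} {FF : Filter F}.

(** The topology of [C] is that of the product [R * R], whose balls are squares; the halved radius
    pays for the passage from squares to the modulus. *)
Lemma filterlim_Cmod (f : T -> C) (l : C) :
  filterlim f F (locally l) <->
  forall eps : R, (0 < eps)%R -> F (fun x => (Cmod (f x - l) < eps)%R).
Proof.
split.
- intros H eps Heps.
  assert (He : (0 < eps / 2)%R) by lra.
  generalize (proj1 (filterlim_locally f l) H (mkposreal _ He)).
  apply filter_imp; intros x [H1 H2].
  eapply Rle_lt_trans; [apply Cmod_le_Re_Im|].
  change (Rabs (Re (f x) - Re l) < eps / 2)%R in H1.
  change (Rabs (Im (f x) - Im l) < eps / 2)%R in H2.
  rewrite Re_Cminus, Im_Cminus; lra.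
- intros H; apply filterlim_locally; intros eps.
  generalize (H eps (cond_pos eps)); apply filter_imp; intros x Hx.
  now apply C_NormedModule_mixin_compat1.
Qed.

Lemma filterlim_Re (f : T -> C) (l : C) :
  filterlim f F (locally l) -> filterlim (fun x => Re (f x)) F (locally (Re l)).
Proof.
intros H; apply filterlim_locally; intros eps.
generalize (proj1 (filterlim_Cmod f l) H eps (cond_pos eps)).
apply filter_imp; intros x Hx.
eapply Rle_lt_trans; [|exact Hx].
change (Rabs (Re (f x) - Re l) <= Cmod (f x - l))%R.
rewrite <- Re_Cminus; apply re_le_Cmod.
Qed.

Lemma filterlim_Im (f : T -> C) (l : C) :
  filterlim f F (locally l) -> filterlim (fun x => Im (f x)) F (locally (Im l)).
Proof.
intros H; apply filterlim_locally; intros eps.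
generalize (proj1 (filterlim_Cmod f l) H eps (cond_pos eps)).
apply filter_imp; intros x Hx.
eapply Rle_lt_trans; [|exact Hx].
change (Rabs (Im (f x) - Im l) <= Cmod (f x - l))%R.
rewrite <- Im_Cminus; apply im_le_Cmod.
Qed.

Lemma filterlim_Cpair (f g : T -> R) (a b : R) :
  filterlim f F (locally a) -> filterlim g F (locally b) ->
  filterlim (fun x => (f x, g x) : C) F (locally ((a, b) : C)).
Proof.
intros Hf Hg; apply filterlim_locally; intros eps.
generalize (filter_and _ _ (proj1 (filterlim_locally f a) Hf eps)
  (proj1 (filterlim_locally g b) Hg eps)).
apply filter_imp; intros x [H1 H2]; now split.
Qed.

Lemma filterlim_Rplus (f g : T -> R) (a b : R) :
  filterlim f F (locally a) -> filterlim g F (locally b) ->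
  filterlim (fun x => f x + g x)%R F (locally (a + b)%R).
Proof.
intros Hf Hg; apply (filterlim_comp_2 f g Rplus Hf Hg).
apply (filterlim_plus (V := R_NormedModule) a b).
Qed.

Lemma filterlim_Rmult (f g : T -> R) (a b : R) :
  filterlim f F (locally a) -> filterlim g F (locally b) ->
  filterlim (fun x => f x * g x)%R F (locally (a * b)%R).
Proof.
intros Hf Hg; apply (filterlim_comp_2 f g Rmult Hf Hg).
apply (filterlim_mult (K := R_AbsRing) a b).
Qed.

Lemma filterlim_Rcomp (f : T -> R) (h : R -> R) (a : R) :
  continuity_pt h a -> filterlim f F (locally a) ->
  filterlim (fun x => h (f x)) F (locally (h a)).
Proof.
intros Hh Hf; eapply filterlim_comp; [exact Hf|].
now apply continuity_pt_filterlim.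
Qed.

Lemma filterlim_Ropp (f : T -> R) (a : R) :
  filterlim f F (locally a) -> filterlim (fun x => - f x)%R F (locally (- a)%R).
Proof.
apply (filterlim_Rcomp f Ropp). apply continuity_pt_opp, continuity_pt_id.
Qed.

Lemma filterlim_Cplus (f g : T -> C) (a b : C) :
  filterlim f F (locally a) -> filterlim g F (locally b) ->
  filterlim (fun x => f x + g x) F (locally (a + b)).
Proof.
intros Hf Hg; apply filterlim_Cpair; apply filterlim_Rplus;
  now (apply filterlim_Re || apply filterlim_Im).
Qed.

Lemma filterlim_Copp (f : T -> C) (a : C) :
  filterlim f F (locally a) -> filterlim (fun x => - f x) F (locally (- a)).
Proof.
intros Hf; apply filterlim_Cpair; apply filterlim_Ropp;
  now (apply filterlim_Re || apply filterlim_Im).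
Qed.

Lemma filterlim_Cminus (f g : T -> C) (a b : C) :
  filterlim f F (locally a) -> filterlim g F (locally b) ->
  filterlim (fun x => f x - g x) F (locally (a - b)).
Proof. intros Hf Hg; apply filterlim_Cplus; [|apply filterlim_Copp]; auto. Qed.

Lemma filterlim_Cconj (f : T -> C) (a : C) :
  filterlim f F (locally a) -> filterlim (fun x => Cconj (f x)) F (locally (Cconj a)).
Proof.
intros Hf; apply filterlim_Cpair; [|apply filterlim_Ropp];
  now (apply filterlim_Re || apply filterlim_Im).
Qed.

Lemma filterlim_Cmult (f g : T -> C) (a b : C) :
  filterlim f F (locally a) -> filterlim g F (locally b) ->
  filterlim (fun x => f x * g x) F (locally (a * b)).
Proof.
intros Hf Hg.
pose proof (filterlim_Re _ _ Hf); pose proof (filterlim_Im _ _ Hf).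
pose proof (filterlim_Re _ _ Hg); pose proof (filterlim_Im _ _ Hg).
apply filterlim_Cpair; apply filterlim_Rplus; try apply filterlim_Ropp;
  apply filterlim_Rmult; assumption.
Qed.

Lemma filterlim_Cinv (f : T -> C) (a : C) :
  a <> 0 -> filterlim f F (locally a) ->
  filterlim (fun x => / f x) F (locally (/ a)).
Proof.
intros Ha Hf.
pose proof (filterlim_Re _ _ Hf) as H1; pose proof (filterlim_Im _ _ Hf) as H2.
assert (Hn : (Re a ^ 2 + Im a ^ 2 <> 0)%R).
{ rewrite <- Cmod2_alt. apply pow_nonzero.
  apply Rgt_not_eq. now apply Cmod_gt_0. }
assert (H3 : filterlim (fun x => / (Re (f x) ^ 2 + Im (f x) ^ 2))%R F
   (locally (/ (Re a ^ 2 + Im a ^ 2))%R)).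
{ apply (filterlim_Rcomp _ Rinv).
  - apply continuity_pt_inv; [apply continuity_pt_id|exact Hn].
  - apply filterlim_Rplus.
    + apply (filterlim_Rcomp _ (fun x => x ^ 2)%R); [|exact H1].
      apply derivable_continuous_pt, derivable_pt_pow.
    + apply (filterlim_Rcomp _ (fun x => x ^ 2)%R); [|exact H2].
      apply derivable_continuous_pt, derivable_pt_pow. }
apply filterlim_Cpair; apply filterlim_Rmult; auto.
now apply filterlim_Ropp.
Qed.

Lemma filterlim_Cconst (a : C) : filterlim (fun _ : T => a) F (locally a).
Proof. apply filterlim_const. Qed.

Lemma filterlim_Cpow (f : T -> C) (a : C) (k : nat) :
  filterlim f F (locally a) -> filterlim (fun x => f x ^ k) F (locally (a ^ k)).
Proof.
intros Hf; induction k as [|k IH]; simpl; [apply filterlim_Cconst|].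
now apply filterlim_Cmult.
Qed.

Lemma filterlim_zpow (f : T -> C) (a : C) (k : Z) :
  a <> 0 -> filterlim f F (locally a) ->
  filterlim (fun x => zpow (f x) k) F (locally (zpow a k)).
Proof.
intros Ha Hf; destruct k as [|k|k]; simpl.
- apply filterlim_Cconst.
- now apply filterlim_Cpow.
- apply filterlim_Cinv; [now apply Cpow_nz|now apply filterlim_Cpow].
Qed.

Lemma filterlim_RtoC (f : T -> R) (a : R) :
  filterlim f F (locally a) -> filterlim (fun x => RtoC (f x)) F (locally (RtoC a)).
Proof. intros Hf; apply filterlim_Cpair; [exact Hf|apply filterlim_const]. Qed.

Lemma filterlim_Cexp (f : T -> C) (a : C) :
  filterlim f F (locally a) -> filterlim (fun x => Cexp (f x)) F (locally (Cexp a)).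
Proof.
intros Hf.
pose proof (filterlim_Re _ _ Hf); pose proof (filterlim_Im _ _ Hf).
apply filterlim_Cmult.
- apply filterlim_RtoC, (filterlim_Rcomp _ exp); [|assumption].
  apply derivable_continuous_pt, derivable_pt_exp.
- apply filterlim_Cpair.
  + apply (filterlim_Rcomp _ cos); [apply continuity_cos|assumption].
  + apply (filterlim_Rcomp _ sin); [apply continuity_sin|assumption].
Qed.

End Limits.

Lemma filterlim_eq_target {T U : Type} {F : (T -> Prop) -> Prop} {G : U -> (U -> Prop) -> Prop}
  (f : T -> U) (a b : U) : a = b -> filterlim f F (G a) -> filterlim f F (G b).
Proof. now intros ->. Qed.

Lemma locally_Cmod (z : C) (P : C -> Prop) :
  locally z P <-> exists eps : R, (0 < eps)%R /\ forall w, (Cmod (w - z) < eps)%R -> P w.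
Proof.
split.
- intros H; destruct H as [e He]; exists e; split; [apply cond_pos|].
  intros w Hw; apply He; now apply C_NormedModule_mixin_compat1.
- intros [e [He H]].
  assert (Hf : filterlim (fun w : C => w) (locally z) (locally z)) by apply filterlim_id.
  generalize (proj1 (filterlim_Cmod _ _) Hf e He); apply filter_imp; exact H.
Qed.

Lemma filterlim_Cmod_comp {T : Type} {F : (T -> Prop) -> Prop} {FF : Filter F} (f : T -> C) (l : C) :
  filterlim f F (locally l) -> filterlim (fun x => Cmod (f x)) F (locally (Cmod l)).
Proof.
intros H; apply filterlim_locally; intros eps.
generalize (proj1 (filterlim_Cmod f l) H eps (cond_pos eps)); apply filter_imp; intros x Hx.
change (Rabs (Cmod (f x) - Cmod l) < eps)%R.
assert (H1 := Cmod_triangle (f x - l) l); assert (H2 := Cmod_triangle (l - f x) (f x)).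
replace (f x - l + l) with (f x) in H1 by ring.
replace (l - f x + f x) with l in H2 by ring.
rewrite (Cmod_sub_sym l) in H2; apply Rabs_def1; lra.
Qed.

(** * Integer powers and the circle *)

Lemma zpow_of_nat (z : C) (k : nat) : zpow z (Z.of_nat k) = z ^ k.
Proof.
destruct k as [|k]; [reflexivity|].
unfold zpow, Z.of_nat; now rewrite SuccNat2Pos.id_succ.
Qed.

Lemma zpow_opp (z : C) (k : Z) : z <> 0 -> zpow z (- k) = / zpow z k.
Proof.
intros Hz; destruct k as [|k|k]; simpl.
- field; exact C1_neq_0.
- reflexivity.
- field; now apply Cpow_nz.
Qed.

Lemma zpow_neq_0 (z : C) (k : Z) : z <> 0 -> zpow z k <> 0.
Proof.
intros Hz; destruct k as [|k|k]; simpl.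
- exact C1_neq_0.
- now apply Cpow_nz.
- now apply Cinv_neq_0, Cpow_nz.
Qed.

Lemma zpow_succ (z : C) (k : Z) : z <> 0 -> zpow z (k + 1) = zpow z k * z.
Proof.
intros Hz; destruct (Z_le_gt_dec 0 k) as [Hk|Hk].
- destruct (Z_of_nat_complete k Hk) as [m ->].
  replace (Z.of_nat m + 1)%Z with (Z.of_nat (S m)) by lia.
  rewrite !zpow_of_nat, Cpow_S; ring.
- assert (Hm : (0 <= - k - 1)%Z) by lia.
  destruct (Z_of_nat_complete _ Hm) as [m Em].
  replace k with (- Z.of_nat (S m))%Z by lia.
  replace (- Z.of_nat (S m) + 1)%Z with (- Z.of_nat m)%Z by lia.
  rewrite !zpow_opp, !zpow_of_nat, Cpow_S by exact Hz.
  field; split; [now apply Cpow_nz|exact Hz].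
Qed.

Lemma zpow_add (z : C) (k l : Z) : z <> 0 -> zpow z (k + l) = zpow z k * zpow z l.
Proof.
intros Hz; induction l as [|l IH|l IH] using Z.peano_ind.
- rewrite Z.add_0_r; simpl; ring.
- rewrite <- Z.add_1_r, Z.add_assoc, !zpow_succ, IH by exact Hz; ring.
- rewrite <- Z.sub_1_r.
  rewrite <- (Z.sub_add 1 l), Z.add_assoc, !zpow_succ in IH by exact Hz.
  transitivity (zpow z (k + (l - 1)) * z / z); [field; exact Hz|].
  rewrite IH; field; exact Hz.
Qed.

Lemma Cmod_zpow_circle (z : C) (k : Z) : Cmod z = 1%R -> Cmod (zpow z k) = 1%R.
Proof.
intros Hz.
assert (Hn : z <> 0) by (intros ->; rewrite Cmod_0 in Hz; lra).
destruct k as [|k|k]; simpl.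
- apply Cmod_1.
- rewrite Cmod_pow, Hz; apply pow1.
- rewrite Cmod_inv, Cmod_pow, Hz, pow1 by now apply Cpow_nz. field.
Qed.

Lemma circle_neq_0 (z : C) : Cmod z = 1%R -> z <> 0.
Proof. intros Hz ->; rewrite Cmod_0 in Hz; lra. Qed.

Lemma circle_conj (z : C) : Cmod z = 1%R -> Cconj z = / z.
Proof.
intros Hz; assert (Hn := circle_neq_0 z Hz).
apply (f_equal (fun r => RtoC (r ^ 2))) in Hz.
rewrite Cmod2_conj in Hz.
replace (RtoC (1 ^ 2)) with (1 : C) in Hz by (f_equal; ring).
rewrite <- (Cmult_1_l (/ z)), <- Hz; now field.
Qed.

Lemma zpow_conj (z : C) (k : Z) : Cmod z = 1%R -> Cconj (zpow z k) = zpow z (- k).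
Proof.
intros Hz; assert (Hn := circle_neq_0 z Hz).
rewrite zpow_opp by exact Hn.
apply circle_conj, Cmod_zpow_circle, Hz.
Qed.

Lemma zpow_inv (z : C) (k : Z) : z <> 0 -> zpow (/ z) k = zpow z (- k).
Proof.
intros Hn; destruct k as [|k|k]; simpl.
- reflexivity.
- now apply Cpow_inv.
- rewrite Cpow_inv by exact Hn. field. now apply Cpow_nz.
Qed.

Lemma zpow_mult (x y : C) (k : Z) : x <> 0 -> y <> 0 -> zpow (x * y) k = zpow x k * zpow y k.
Proof.
intros Hx Hy; destruct k as [|k|k]; simpl.
- ring.
- apply Cpow_mult_l.
- rewrite Cpow_mult_l; field; split; now apply Cpow_nz.
Qed.

Definition eit (t : R) : C := (cos t, sin t).

Lemma Cmod_eit (t : R) : Cmod (eit t) = 1%R.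
Proof.
unfold Cmod, eit; simpl.
replace (cos t * (cos t * 1) + sin t * (sin t * 1))%R with 1%R.
- apply sqrt_1.
- generalize (sin2_cos2 t); unfold Rsqr; lra.
Qed.

Lemma circle_eit (z : C) : Cmod z = 1%R -> exists t, (0 <= t <= 2 * PI)%R /\ z = eit t.
Proof.
intros Hz; destruct z as [x y].
assert (H2 : (x * x + y * y = 1)%R).
{ generalize (Cmod2_alt (x, y)); rewrite Hz; simpl; lra. }
assert (Hx : (-1 <= x <= 1)%R) by (split; nra).
pose proof (acos_bound x) as Hb.
assert (Hc := cos_acos x Hx).
assert (Hs : (0 <= sin (acos x))%R) by (apply sin_ge_0; lra).
assert (Hs2 := sin2_cos2 (acos x)); unfold Rsqr in Hs2; rewrite Hc in Hs2.
destruct (Rle_dec 0 y) as [Hy|Hy].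
- exists (acos x); split; [lra|].
  unfold eit; apply injective_projections; simpl; [now symmetry|].
  nra.
- exists (2 * PI - acos x)%R; split; [lra|].
  unfold eit; apply injective_projections; simpl.
  + rewrite cos_minus, cos_2PI, sin_2PI; lra.
  + rewrite sin_minus, cos_2PI, sin_2PI. nra.
Qed.

Lemma polar (z : C) : exists b, Cmod b = 1%R /\ z = RtoC (Cmod z) * b.
Proof.
destruct (Req_dec (Cmod z) 0) as [H|H].
- exists 1; split; [apply Cmod_1|].
  rewrite (Cmod_eq_0 z H), Cmod_0; ring.
- assert (Hn : RtoC (Cmod z) <> 0) by now apply RtoC_neq_0.
  exists (z / RtoC (Cmod z)); split.
  + rewrite Cmod_div, Cmod_R, Rabs_pos_eq by (assumption || apply Cmod_ge_0).
    now field.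
  + now field.
Qed.

(** * Absolutely convergent complex series *)

(** Keeping the majorant explicit is what lets [filterlim_Csum] and [circle_int_Csum] estimate tails
    uniformly in a parameter. *)
Definition dominated (u : nat -> C) (M : nat -> R) : Prop :=
  ex_series M /\ forall k, (Cmod (u k) <= M k)%R.

Lemma sum_n_S (u : nat -> C) (N : nat) : sum_n u (S N) = sum_n u N + u (S N).
Proof. apply (sum_Sn (G := C_AbelianGroup)). Qed.

Lemma sum_n_0 (u : nat -> C) : sum_n u 0 = u 0%nat.
Proof. apply (sum_O (G := C_AbelianGroup)). Qed.

Lemma sum_n_RS (u : nat -> R) (N : nat) : sum_n u (S N) = (sum_n u N + u (S N))%R.
Proof. apply (sum_Sn (G := R_AbelianGroup)). Qed.

Lemma sum_n_Re (u : nat -> C) (N : nat) : Re (sum_n u N) = sum_n (fun k => Re (u k)) N.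
Proof.
induction N as [|N IH]; [now rewrite sum_n_0, sum_O|].
rewrite sum_n_S, sum_n_RS, <- IH; reflexivity.
Qed.

Lemma sum_n_Im (u : nat -> C) (N : nat) : Im (sum_n u N) = sum_n (fun k => Im (u k)) N.
Proof.
induction N as [|N IH]; [now rewrite sum_n_0, sum_O|].
rewrite sum_n_S, sum_n_RS, <- IH; reflexivity.
Qed.

Lemma dominated_Re (u : nat -> C) (M : nat -> R) :
  dominated u M -> ex_series (fun k => Re (u k)).
Proof.
intros [HM Hu]; apply (ex_series_le (V := R_CompleteNormedModule) _ M); [|exact HM].
intros k; eapply Rle_trans; [apply re_le_Cmod|apply Hu].
Qed.

Lemma dominated_Im (u : nat -> C) (M : nat -> R) :
  dominated u M -> ex_series (fun k => Im (u k)).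
Proof.
intros [HM Hu]; apply (ex_series_le (V := R_CompleteNormedModule) _ M); [|exact HM].
intros k; eapply Rle_trans; [apply im_le_Cmod|apply Hu].
Qed.

Lemma dominated_ex_series (u : nat -> C) (M : nat -> R) : dominated u M -> ex_series u.
Proof.
intros [HM Hu]; apply (ex_series_le (V := C_CompleteNormedModule) u M); [|exact HM].
exact Hu.
Qed.

Lemma dominated_ge_0 (u : nat -> C) (M : nat -> R) (k : nat) : dominated u M -> (0 <= M k)%R.
Proof. intros [_ Hu]; eapply Rle_trans; [apply Cmod_ge_0|apply (Hu k)]. Qed.

Lemma Csum_ext (u v : nat -> C) : (forall k, u k = v k) -> Csum u = Csum v.
Proof.
intros H; unfold Csum; apply injective_projections; simpl;
  apply Series_ext; intros k; now rewrite H.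
Qed.

Lemma is_series_Re (u : nat -> C) (l : C) : is_series u l -> is_series (fun k => Re (u k)) (Re l).
Proof.
intros H; unfold is_series.
apply (filterlim_ext (fun N => Re (sum_n u N))); [apply sum_n_Re|].
now apply (filterlim_Re (F := eventually)).
Qed.

Lemma is_series_Im (u : nat -> C) (l : C) : is_series u l -> is_series (fun k => Im (u k)) (Im l).
Proof.
intros H; unfold is_series.
apply (filterlim_ext (fun N => Im (sum_n u N))); [apply sum_n_Im|].
now apply (filterlim_Im (F := eventually)).
Qed.

Lemma is_series_Cmod (u : nat -> C) (l : C) :
  is_series u l <-> forall eps : R, (0 < eps)%R ->
    exists N0, forall N, (N0 <= N)%nat -> (Cmod (sum_n u N - l) < eps)%R.
Proof. exact (filterlim_Cmod (F := eventually) (sum_n u) l). Qed.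

Lemma is_series_Csum (u : nat -> C) (l : C) : is_series u l -> Csum u = l.
Proof.
intros H; unfold Csum; apply injective_projections; simpl.
- exact (is_series_unique _ _ (is_series_Re u l H)).
- exact (is_series_unique _ _ (is_series_Im u l H)).
Qed.

Lemma Csum_correct (u : nat -> C) : ex_series u -> is_series u (Csum u).
Proof. intros [l Hl]; now rewrite (is_series_Csum u l Hl). Qed.

Lemma Csum_plus (u v : nat -> C) (M N : nat -> R) : dominated u M -> dominated v N ->
  Csum (fun k => u k + v k) = Csum u + Csum v.
Proof.
intros Hu Hv; unfold Csum; apply injective_projections; simpl;
  rewrite <- Series_plus; auto;
  eauto using dominated_Re, dominated_Im.
Qed.

Lemma Series_lin (f g : nat -> R) (c d : R) : ex_series f -> ex_series g ->
  Series (fun k => c * f k + d * g k)%R = (c * Series f + d * Series g)%R.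
Proof.
intros Hf Hg; rewrite <- !Series_scal_l.
now apply Series_plus; apply (ex_series_scal (V := R_NormedModule)).
Qed.

Lemma Csum_scal (c : C) (u : nat -> C) (M : nat -> R) : dominated u M ->
  Csum (fun k => c * u k) = c * Csum u.
Proof.
intros Hu; pose proof (dominated_Re _ _ Hu) as H1; pose proof (dominated_Im _ _ Hu) as H2.
unfold Csum; apply injective_projections; simpl.
- rewrite (Series_ext _ (fun k => fst c * Re (u k) + (- snd c) * Im (u k))%R)
    by (intros; unfold Re, Im; ring).
  rewrite Series_lin by assumption; ring.
- rewrite (Series_ext _ (fun k => fst c * Im (u k) + snd c * Re (u k))%R)
    by (intros; unfold Re, Im; ring).
  now rewrite Series_lin by assumption.
Qed.

Lemma Csum_opp (u : nat -> C) : Csum (fun k => - u k) = - Csum u.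
Proof. unfold Csum; apply injective_projections; simpl; apply Series_opp. Qed.

Lemma Csum_conj (u : nat -> C) : Csum (fun k => Cconj (u k)) = Cconj (Csum u).
Proof. unfold Csum; apply injective_projections; simpl; [reflexivity|apply Series_opp]. Qed.

Lemma Csum_0 : Csum (fun _ => 0) = 0.
Proof.
unfold Csum; apply injective_projections; simpl;
  rewrite (Series_ext _ (fun _ => 0 * 0)%R) by (intros; ring); rewrite Series_scal_l; ring.
Qed.

Lemma dominated_scal (c : C) (u : nat -> C) (M : nat -> R) :
  dominated u M -> dominated (fun k => c * u k) (fun k => Cmod c * M k)%R.
Proof.
intros [H1 H2]; split; [now apply (ex_series_scal (V := R_NormedModule))|].
intros k; rewrite Cmod_mult; apply Rmult_le_compat_l; [apply Cmod_ge_0|apply H2].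
Qed.

Lemma dominated_plus (u v : nat -> C) (M N : nat -> R) :
  dominated u M -> dominated v N -> dominated (fun k => u k + v k) (fun k => M k + N k)%R.
Proof.
intros [H1 H2] [H3 H4]; split; [now apply (ex_series_plus (V := R_NormedModule))|].
intros k; eapply Rle_trans; [apply Cmod_triangle|]; apply Rplus_le_compat; auto.
Qed.

Lemma dominated_opp (u : nat -> C) (M : nat -> R) :
  dominated u M -> dominated (fun k => - u k) M.
Proof. intros [H1 H2]; split; auto; intros k; now rewrite Cmod_opp. Qed.

Lemma is_series_sum_n_minus (u : nat -> C) (l : C) (N : nat) :
  is_series u l -> is_series (fun k => u (S N + k)%nat) (l - sum_n u N).
Proof.
intros H. apply (is_series_incr_n u (S N)); [lia|].
simpl pred.
match goal with |- is_series _ ?x => replace x with l; [exact H|] end.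
change (l = (l - sum_n u N) + sum_n u N). ring.
Qed.

Lemma Series_sum_n (M : nat -> R) (N : nat) : ex_series M ->
  Series (fun k => M (S N + k)%nat) = (Series M - sum_n M N)%R.
Proof.
intros H; rewrite (Series_incr_n M (S N)) by (lia || exact H).
simpl pred; rewrite <- sum_n_Reals; ring.
Qed.

Lemma Csum_bound (u : nat -> C) (M : nat -> R) : dominated u M -> (Cmod (Csum u) <= Series M)%R.
Proof.
intros H.
assert (Hs := Csum_correct _ (dominated_ex_series _ _ H)).
assert (Hb : forall N, (Cmod (sum_n u N) <= Series M)%R).
{ intros N. apply Rle_trans with (sum_n M N).
  - induction N as [|N IH]; [rewrite sum_n_0, sum_O; apply H|].
    rewrite sum_n_S, sum_n_RS; eapply Rle_trans; [apply Cmod_triangle|].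
    apply Rplus_le_compat; [exact IH|apply H].
  - assert (E := Series_sum_n M N (proj1 H)).
    assert (0 <= Series (fun k => M (S N + k)%nat))%R; [|lra].
    replace 0%R with (Series (fun _ : nat => 0 * 0)%R) by (rewrite Series_scal_l; ring).
    apply Series_le; [|now apply (ex_series_incr_n M (S N)), H].
    intros k; split; [lra|]. rewrite Rmult_0_l; apply (dominated_ge_0 _ _ _ H). }
apply Rnot_lt_le; intros Hlt.
set (e := (Cmod (Csum u) - Series M)%R).
assert (He : (0 < e)%R) by (unfold e; lra).
destruct (proj1 (is_series_Cmod _ _) Hs e He) as [N HN].
specialize (HN N (le_n N)); specialize (Hb N).
assert (Cmod (Csum u) <= Cmod (Csum u - sum_n u N) + Cmod (sum_n u N))%R.
{ replace (Csum u) with ((Csum u - sum_n u N) + sum_n u N) at 1 by ring. apply Cmod_triangle. }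
rewrite Cmod_sub_sym in HN; unfold e in HN; lra.
Qed.

Lemma dominated_tail (u : nat -> C) (M : nat -> R) (N : nat) : dominated u M ->
  dominated (fun k => u (S N + k)%nat) (fun k => M (S N + k)%nat).
Proof.
intros H; split; [now apply (ex_series_incr_n M (S N)), H|intros k; apply H].
Qed.

Lemma Csum_tail (u : nat -> C) (M : nat -> R) (N : nat) : dominated u M ->
  (Cmod (Csum u - sum_n u N) <= Series M - sum_n M N)%R.
Proof.
intros H.
rewrite <- (is_series_Csum _ _ (is_series_sum_n_minus u (Csum u) N
  (Csum_correct _ (dominated_ex_series _ _ H)))).
rewrite <- Series_sum_n by apply H.
now apply Csum_bound, dominated_tail.
Qed.

Lemma Series_tail_lim (M : nat -> R) (eps : R) : ex_series M -> (0 < eps)%R ->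
  exists N0, forall N, (N0 <= N)%nat -> (Series M - sum_n M N < eps)%R.
Proof.
intros H He.
assert (Hs := Series_correct M H).
destruct (proj1 (filterlim_locally _ _) Hs (mkposreal eps He)) as [N0 HN].
exists N0; intros N HNN; specialize (HN N HNN).
change (Rabs (sum_n M N - Series M) < eps)%R in HN.
rewrite Rabs_minus_sym in HN; apply Rabs_def2 in HN; lra.
Qed.

(** Dominated convergence: past a fixed [N] both tails are bounded by the tail of [M], and the
    finitely many terms up to [N] converge one by one; hence the three thirds of [eps]. *)
Lemma filterlim_Csum {T : Type} {F : (T -> Prop) -> Prop} {FF : Filter F}
  (u : nat -> T -> C) (l : nat -> C) (M : nat -> R) :
  (forall k, filterlim (u k) F (locally (l k))) ->
  dominated l M -> F (fun x => forall k, (Cmod (u k x) <= M k)%R) ->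
  filterlim (fun x => Csum (fun k => u k x)) F (locally (Csum l)).
Proof.
intros Hu Hl HM; apply filterlim_Cmod; intros eps He.
assert (He3 : (0 < eps / 3)%R) by lra.
destruct (Series_tail_lim M _ (proj1 Hl) He3) as [N HN].
specialize (HN N (le_n N)).
assert (Hf : filterlim (fun x => sum_n (fun k => u k x) N) F (locally (sum_n l N))).
{ clear HN; induction N as [|N IH].
  - rewrite sum_n_0. apply (filterlim_ext (u 0%nat)); [|apply Hu].
    intros x; now rewrite sum_n_0.
  - rewrite sum_n_S.
    apply (filterlim_ext (fun x => sum_n (fun k => u k x) N + u (S N) x)).
    + intros x; now rewrite sum_n_S.
    + now apply filterlim_Cplus. }
generalize (filter_and _ _ HM (proj1 (filterlim_Cmod _ _) Hf _ He3)).
apply filter_imp; intros x [H1 H2].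
assert (Hd : dominated (fun k => u k x) M) by (split; [apply Hl|exact H1]).
assert (T1 := Csum_tail _ _ N Hd); assert (T2 := Csum_tail _ _ N Hl).
rewrite Cmod_sub_sym in T2.
replace (Csum (fun k => u k x) - Csum l) with
  ((Csum (fun k => u k x) - sum_n (fun k => u k x) N)
   + ((sum_n (fun k => u k x) N - sum_n l N) + (sum_n l N - Csum l))) by ring.
eapply Rle_lt_trans; [apply Cmod_triangle|].
eapply Rle_lt_trans; [apply Rplus_le_compat_l, Cmod_triangle|].
lra.
Qed.

Lemma ex_series_geom_scal (c r : R) : (0 <= r < 1)%R -> ex_series (fun k => c * r ^ k)%R.
Proof.
intros Hr; apply (ex_series_scal (V := R_NormedModule) c (fun k => r ^ k)%R).
apply ex_series_geom; rewrite Rabs_pos_eq; lra.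
Qed.

(** * Integrals over the circle *)

(** Continuity relative to the circle, so that functions known only through their boundary values,
    such as [psi], qualify. *)
Definition ccirc (u : C -> C) : Prop :=
  forall z, Cmod z = 1%R ->
    filterlim u (within (fun w => Cmod w = 1%R) (locally z)) (locally (u z)).

Section CircleContinuity.
Variables u v : C -> C.
Hypotheses (Hu : ccirc u) (Hv : ccirc v).

Lemma ccirc_plus : ccirc (fun z => u z + v z).
Proof. intros z Hz; apply filterlim_Cplus; auto. Qed.
Lemma ccirc_minus : ccirc (fun z => u z - v z).
Proof. intros z Hz; apply filterlim_Cminus; auto. Qed.
Lemma ccirc_mult : ccirc (fun z => u z * v z).
Proof. intros z Hz; apply filterlim_Cmult; auto. Qed.
Lemma ccirc_conj : ccirc (fun z => Cconj (u z)).
Proof. intros z Hz; apply filterlim_Cconj; auto. Qed.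
End CircleContinuity.

Lemma ccirc_const (c : C) : ccirc (fun _ => c).
Proof. intros z Hz; apply filterlim_const. Qed.

Lemma ccirc_id : ccirc (fun z => z).
Proof. intros z Hz; apply filterlim_filter_le_1 with (2 := filterlim_id _ _); apply filter_le_within. Qed.

Lemma ccirc_zpow (k : Z) : ccirc (fun z => zpow z k).
Proof. intros z Hz; apply filterlim_zpow; [now apply circle_neq_0|now apply ccirc_id]. Qed.

Lemma ccirc_pow (k : nat) : ccirc (fun z => z ^ k).
Proof. intros z Hz; apply filterlim_Cpow; now apply ccirc_id. Qed.

Lemma ccirc_ext (u v : C -> C) : (forall z, Cmod z = 1%R -> u z = v z) -> ccirc u -> ccirc v.
Proof.
intros H Hu z Hz; rewrite <- H by exact Hz.
apply (filterlim_within_ext (F := locally z) _ u v); auto.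
Qed.

Lemma ccirc_Csum (u : nat -> C -> C) (M : nat -> R) :
  (forall k, ccirc (u k)) -> (forall z, Cmod z = 1%R -> dominated (fun k => u k z) M) ->
  ccirc (fun z => Csum (fun k => u k z)).
Proof.
intros Hu HM z Hz; apply (filterlim_Csum u (fun k => u k z) M).
- intros k; now apply Hu.
- now apply HM.
- unfold within; apply filter_forall; intros w Hw; apply (HM w Hw).
Qed.

Lemma ccirc_reflect (u : C -> C) : ccirc u -> ccirc (fun z => u (/ z)).
Proof.
intros Hu z Hz.
assert (Hn := circle_neq_0 z Hz).
assert (H1 : Cmod (/ z) = 1%R) by (rewrite Cmod_inv, Hz by assumption; field).
apply (filterlim_comp _ _ _ (fun w => / w) u _ _ _) with (2 := Hu (/ z) H1).
intros P HP; unfold within in *.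
assert (HL : filterlim (fun w : C => / w) (within (fun w => Cmod w = 1%R) (locally z)) (locally (/ z))).
{ apply filterlim_Cinv; [exact Hn|now apply ccirc_id]. }
specialize (HL _ HP); unfold filtermap, within in HL |- *.
revert HL; apply filter_imp; intros w Hw Hw1; apply Hw; auto.
rewrite Cmod_inv, Hw1 by (now apply circle_neq_0); field.
Qed.

Lemma continuous_eit (t : R) : continuous eit t.
Proof.
apply filterlim_Cpair.
- apply (filterlim_Rcomp _ cos); [apply continuity_cos|apply filterlim_id].
- apply (filterlim_Rcomp _ sin); [apply continuity_sin|apply filterlim_id].
Qed.

Lemma ccirc_continuous (u : C -> C) (t : R) : ccirc u ->
  continuous (fun t : R => u (eit t)) t.
Proof.
intros Hu P HP.
assert (H := Hu (eit t) (Cmod_eit t) P HP).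
apply continuous_eit in H; unfold filtermap in *.
revert H; apply filter_imp; intros s Hs; apply Hs, Cmod_eit.
Qed.

Lemma ccirc_RInt_Re (u : C -> C) (a b : R) : ccirc u -> ex_RInt (fun t => Re (u (eit t))) a b.
Proof.
intros Hu; apply (ex_RInt_continuous (V := R_CompleteNormedModule)); intros t _.
now apply (filterlim_Re (fun t => u (eit t))), ccirc_continuous.
Qed.

Lemma ccirc_RInt_Im (u : C -> C) (a b : R) : ccirc u -> ex_RInt (fun t => Im (u (eit t))) a b.
Proof.
intros Hu; apply (ex_RInt_continuous (V := R_CompleteNormedModule)); intros t _.
now apply (filterlim_Im (fun t => u (eit t))), ccirc_continuous.
Qed.

Lemma ccirc_is_RInt (u : C -> C) : ccirc u ->
  is_RInt (V := C_R_NormedModule) (fun t => u (eit t)) 0 (2 * PI)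
    (RInt (fun t => Re (u (eit t))) 0 (2 * PI), RInt (fun t => Im (u (eit t))) 0 (2 * PI)).
Proof.
intros Hu; apply (is_RInt_fct_extend_pair (U := R_NormedModule) (V := R_NormedModule)).
- now apply (RInt_correct (V := R_CompleteNormedModule)), ccirc_RInt_Re.
- now apply (RInt_correct (V := R_CompleteNormedModule)), ccirc_RInt_Im.
Qed.

Lemma circle_int_eit (u : C -> C) :
  circle_int u = RtoC (/ (2 * PI)) *
    RInt (V := C_R_CompleteNormedModule) (fun t => u (eit t)) 0 (2 * PI).
Proof. reflexivity. Qed.

Lemma circle_int_pair (u : C -> C) : ccirc u ->
  circle_int u = ((/ (2 * PI) * RInt (fun t => Re (u (eit t))) 0 (2 * PI))%R,
                  (/ (2 * PI) * RInt (fun t => Im (u (eit t))) 0 (2 * PI))%R).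
Proof.
intros Hu; rewrite circle_int_eit.
rewrite (is_RInt_unique (V := C_R_CompleteNormedModule) _ _ _ _ (ccirc_is_RInt u Hu)).
apply injective_projections; simpl; ring.
Qed.

Lemma circle_int_ext (u v : C -> C) : (forall z, Cmod z = 1%R -> u z = v z) ->
  circle_int u = circle_int v.
Proof.
intros H; rewrite !circle_int_eit; f_equal.
apply (RInt_ext (V := C_R_CompleteNormedModule)); intros t _; apply H, Cmod_eit.
Qed.

Lemma circle_int_plus (u v : C -> C) : ccirc u -> ccirc v ->
  circle_int (fun z => u z + v z) = circle_int u + circle_int v.
Proof.
intros Hu Hv.
rewrite !circle_int_pair by (assumption || now apply ccirc_plus).
apply injective_projections; simpl.
- rewrite <- Rmult_plus_distr_l; f_equal.
  now apply (RInt_plus (V := R_CompleteNormedModule)); apply ccirc_RInt_Re.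
- rewrite <- Rmult_plus_distr_l; f_equal.
  now apply (RInt_plus (V := R_CompleteNormedModule)); apply ccirc_RInt_Im.
Qed.

Lemma RInt_eq (f g : R -> R) (a b : R) : (forall t, f t = g t) -> RInt f a b = RInt g a b.
Proof. intros H; apply RInt_ext; intros t _; apply H. Qed.

Lemma RInt_lin (f g : R -> R) (a b c d : R) : ex_RInt f a b -> ex_RInt g a b ->
  RInt (fun t => c * f t + d * g t)%R a b = (c * RInt f a b + d * RInt g a b)%R.
Proof.
intros Hf Hg.
etransitivity.
- apply (RInt_plus (V := R_CompleteNormedModule) (fun t => c * f t)%R (fun t => d * g t)%R);
    now apply (ex_RInt_scal (V := R_NormedModule)).
- apply f_equal2; now apply (RInt_scal (V := R_CompleteNormedModule)).
Qed.

Lemma circle_int_scal (c : C) (u : C -> C) : ccirc u ->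
  circle_int (fun z => c * u z) = c * circle_int u.
Proof.
intros Hu.
assert (H1 := ccirc_RInt_Re u 0 (2 * PI) Hu); assert (H2 := ccirc_RInt_Im u 0 (2 * PI) Hu).
rewrite !circle_int_pair by (assumption || (apply ccirc_mult; [apply ccirc_const|assumption])).
apply injective_projections; simpl.
- rewrite (RInt_eq _ (fun t => Re c * Re (u (eit t)) + (- Im c) * Im (u (eit t)))%R)
    by (intros t; unfold Re, Im; ring).
  rewrite (RInt_lin _ _ _ _ _ _ H1 H2); unfold Re, Im; ring.
- rewrite (RInt_eq _ (fun t => Re c * Im (u (eit t)) + Im c * Re (u (eit t)))%R)
    by (intros t; unfold Re, Im; ring).
  rewrite (RInt_lin _ _ _ _ _ _ H2 H1); unfold Re, Im; ring.
Qed.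

Lemma circle_int_minus (u v : C -> C) : ccirc u -> ccirc v ->
  circle_int (fun z => u z - v z) = circle_int u - circle_int v.
Proof.
intros Hu Hv.
rewrite (circle_int_ext _ (fun z => u z + (- (1)) * v z)) by (intros; ring).
rewrite circle_int_plus, circle_int_scal; try assumption; [ring|].
apply ccirc_mult; [apply ccirc_const|assumption].
Qed.

Lemma circle_int_conj (u : C -> C) : ccirc u ->
  circle_int (fun z => Cconj (u z)) = Cconj (circle_int u).
Proof.
intros Hu.
rewrite !circle_int_pair by (assumption || now apply ccirc_conj).
apply injective_projections; simpl; [reflexivity|].
rewrite (RInt_eq _ (fun t => opp (Im (u (eit t))))) by reflexivity.
rewrite (RInt_opp (V := R_CompleteNormedModule)) by now apply ccirc_RInt_Im.
unfold opp; simpl; ring.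
Qed.

(** On the circle [/ z] is the substitution [t -> 2 pi - t], written [-1 * t + 2 * PI] to match the
    linear change of variables. *)
Lemma circle_int_reflect (u : C -> C) : ccirc u ->
  circle_int (fun z => u (/ z)) = circle_int u.
Proof.
intros Hu.
assert (He : forall t, eit (-1 * t + 2 * PI) = / eit t).
{ intros t; rewrite <- circle_conj by apply Cmod_eit.
  unfold eit; replace (-1 * t + 2 * PI)%R with (2 * PI - t)%R by ring.
  rewrite cos_minus, sin_minus, cos_2PI, sin_2PI.
  apply injective_projections; simpl; ring. }
assert (H : forall f : R -> R, ex_RInt f 0 (2 * PI) ->
  RInt (fun t => f (-1 * t + 2 * PI)%R) 0 (2 * PI) = RInt f 0 (2 * PI)).
{ intros f Hf.
  assert (E1 : (-1 * 0 + 2 * PI = 2 * PI)%R) by ring.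
  assert (E2 : (-1 * (2 * PI) + 2 * PI = 0)%R) by ring.
  assert (Hs : ex_RInt f (-1 * 0 + 2 * PI) (-1 * (2 * PI) + 2 * PI)).
  { rewrite E1, E2; now apply ex_RInt_swap. }
  assert (E := RInt_comp_lin (V := R_CompleteNormedModule) f (-1) (2 * PI) 0 (2 * PI) Hs).
  rewrite E1, E2 in E.
  assert (E3 : RInt f (2 * PI) 0 = (- RInt f 0 (2 * PI))%R).
  { symmetry; apply (opp_RInt_swap (V := R_CompleteNormedModule)), Hf. }
  rewrite E3 in E.
  assert (Hc : ex_RInt (fun t => f (-1 * t + 2 * PI)%R) 0 (2 * PI)).
  { assert (Hc := ex_RInt_comp_lin (V := R_NormedModule) f (-1) (2 * PI) 0 (2 * PI) Hs).
    apply (ex_RInt_scal (V := R_NormedModule) _ _ _ (-1)%R) in Hc.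
    eapply ex_RInt_ext; [|exact Hc].
    intros x _; unfold scal; simpl; unfold mult; simpl; ring. }
  assert (E4 := RInt_scal (V := R_CompleteNormedModule)
    (fun t => f (-1 * t + 2 * PI)%R) 0 (2 * PI) (-1)%R Hc).
  assert (E5 : (-1 * RInt (fun t => f (-1 * t + 2 * PI)%R) 0 (2 * PI)
    = - RInt f 0 (2 * PI))%R).
  { etransitivity; [symmetry; exact E4|exact E]. }
  lra. }
rewrite !circle_int_pair by (assumption || now apply ccirc_reflect).
apply injective_projections; simpl; f_equal.
- rewrite <- (H _ (ccirc_RInt_Re u _ _ Hu)).
  apply RInt_eq; intros t; now rewrite He.
- rewrite <- (H _ (ccirc_RInt_Im u _ _ Hu)).
  apply RInt_eq; intros t; now rewrite He.
Qed.

Lemma circle_int_bound (u : C -> C) (M : R) : ccirc u ->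
  (forall z, Cmod z = 1%R -> (Cmod (u z) <= M)%R) -> (Cmod (circle_int u) <= M)%R.
Proof.
intros Hu HM.
assert (HP := PI_RGT_0).
assert (H : (norm (RInt (V := C_R_CompleteNormedModule) (fun t => u (eit t)) 0 (2 * PI))
          <= (2 * PI - 0) * M)%R).
{ apply (norm_RInt_le_const (V := C_R_NormedModule) (fun t => u (eit t)) 0 (2 * PI)).
  - lra.
  - intros t _. specialize (HM _ (Cmod_eit t)).
    eapply Rle_trans; [apply Req_le; symmetry; apply Cmod_norm|exact HM].
  - apply (RInt_correct (V := C_R_CompleteNormedModule)).
    eexists; apply (ccirc_is_RInt u Hu). }
rewrite circle_int_eit, Cmod_mult, Cmod_R.
rewrite Rabs_pos_eq by (apply Rlt_le, Rinv_0_lt_compat; lra).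
set (I := RInt (V := C_R_CompleteNormedModule) (fun t => u (eit t)) 0 (2 * PI)) in *.
assert (H' : (Cmod I <= (2 * PI - 0) * M)%R).
{ eapply Rle_trans; [apply Req_le; apply Cmod_norm|exact H]. }
apply Rmult_le_reg_l with (2 * PI)%R; [lra|].
rewrite <- Rmult_assoc, Rinv_r by lra; lra.
Qed.

Lemma circle_int_Csum (u : nat -> C -> C) (M : nat -> R) :
  (forall k, ccirc (u k)) -> (forall z, Cmod z = 1%R -> dominated (fun k => u k z) M) ->
  dominated (fun k => circle_int (u k)) M /\
  circle_int (fun z => Csum (fun k => u k z)) = Csum (fun k => circle_int (u k)).
Proof.
intros Hu HM.
assert (Hd : dominated (fun k => circle_int (u k)) M).
{ split; [apply (HM 1), Cmod_1|].
  intros k; apply circle_int_bound; [apply Hu|intros z Hz; now apply HM]. }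
split; [exact Hd|symmetry].
assert (HS := ccirc_Csum u M Hu HM).
assert (Hc : forall N, ccirc (fun z => sum_n (fun k => u k z) N) /\
   circle_int (fun z => sum_n (fun k => u k z) N) = sum_n (fun k => circle_int (u k)) N).
{ induction N as [|N [IH1 IH2]].
  - split.
    + apply (ccirc_ext (u 0%nat)); [|apply Hu]. intros z _; now rewrite sum_n_0.
    + rewrite sum_n_0; apply circle_int_ext; intros z _; now rewrite sum_n_0.
  - split.
    + apply (ccirc_ext (fun z => sum_n (fun k => u k z) N + u (S N) z)).
      * intros z _; now rewrite sum_n_S.
      * now apply ccirc_plus.
    + rewrite sum_n_S, <- IH2, <- circle_int_plus by auto.
      apply circle_int_ext; intros z _; now rewrite sum_n_S. }
apply is_series_Csum, is_series_Cmod; intros eps He.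
destruct (Series_tail_lim M eps (proj1 Hd) He) as [N0 HN].
exists N0; intros N HNN; rewrite Cmod_sub_sym.
destruct (Hc N) as [Hc1 Hc2]; rewrite <- Hc2, <- circle_int_minus by assumption.
eapply Rle_lt_trans; [|apply (HN N HNN)].
apply circle_int_bound; [now apply ccirc_minus|].
intros z Hz; apply (Csum_tail (fun k => u k z) M N); now apply HM.
Qed.

Lemma circle_int_const (c : C) : circle_int (fun _ => c) = c.
Proof.
assert (HP := PI_RGT_0).
rewrite circle_int_pair by apply ccirc_const.
rewrite !(RInt_const (V := R_CompleteNormedModule)).
unfold scal; simpl; unfold mult; simpl.
apply injective_projections; simpl; unfold Re, Im; field; lra.
Qed.

(** * Complex differentiation *)

(* Caratheodory's formulation of the derivative: the product, chain and
   quotient rules become algebraic identities. *)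
Definition cderiv (f : C -> C) (z d : C) : Prop :=
  exists phi : C -> C, filterlim phi (locally z) (locally d) /\
    locally z (fun w => f w - f z = phi w * (w - z)).

(** The derivative is required to be continuous at the points of [U], which makes differentiation
    under the integral in [circle_mean_derive] legitimate without Goursat's theorem. *)
Definition holo_on (U : C -> Prop) (f : C -> C) : Prop :=
  exists d : C -> C, forall z, U z ->
    cderiv f z (d z) /\ filterlim d (locally z) (locally (d z)).

Lemma filterlim_C_id (z : C) : filterlim (fun w : C => w) (locally z) (locally z).
Proof. apply filterlim_id. Qed.

Lemma cderiv_continuous (f : C -> C) (z d : C) : cderiv f z d ->
  filterlim f (locally z) (locally (f z)).
Proof.
intros [phi [H1 H2]].
apply (filterlim_ext_loc (fun w => f z + phi w * (w - z))).
- revert H2; apply filter_imp; intros w Hw; rewrite <- Hw; ring.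
- apply (filterlim_eq_target _ (f z + d * (z - z))); [ring|].
  apply filterlim_Cplus; [apply filterlim_Cconst|].
  apply filterlim_Cmult; [exact H1|].
  apply filterlim_Cminus; [apply filterlim_C_id|apply filterlim_Cconst].
Qed.

Lemma cderiv_ext_loc (f g : C -> C) (z d : C) :
  locally z (fun w => f w = g w) -> cderiv f z d -> cderiv g z d.
Proof.
intros H [phi [H1 H2]]; exists phi; split; [exact H1|].
assert (Hz := locally_singleton _ _ H).
generalize (filter_and _ _ H H2); apply filter_imp; intros w [Ha Hb].
now rewrite <- Ha, <- Hz.
Qed.

Lemma cderiv_const (c z : C) : cderiv (fun _ => c) z 0.
Proof.
exists (fun _ => 0); split; [apply filterlim_Cconst|].
apply filter_forall; intros w; ring.
Qed.

Lemma cderiv_id (z : C) : cderiv (fun w => w) z 1.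
Proof.
exists (fun _ => 1); split; [apply filterlim_Cconst|].
apply filter_forall; intros w; ring.
Qed.

Lemma cderiv_plus (f g : C -> C) (z d e : C) : cderiv f z d -> cderiv g z e ->
  cderiv (fun w => f w + g w) z (d + e).
Proof.
intros [p [H1 H2]] [q [H3 H4]]; exists (fun w => p w + q w); split.
- now apply filterlim_Cplus.
- generalize (filter_and _ _ H2 H4); apply filter_imp; intros w [Ha Hb].
  transitivity ((f w - f z) + (g w - g z)); [ring|rewrite Ha, Hb; ring].
Qed.

Lemma cderiv_mult (f g : C -> C) (z d e : C) : cderiv f z d -> cderiv g z e ->
  cderiv (fun w => f w * g w) z (d * g z + f z * e).
Proof.
intros Hf Hg; assert (Hc := cderiv_continuous _ _ _ Hg).
destruct Hf as [p [H1 H2]]; destruct Hg as [q [H3 H4]].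
exists (fun w => p w * g w + f z * q w); split.
- apply filterlim_Cplus; apply filterlim_Cmult; auto; apply filterlim_Cconst.
- generalize (filter_and _ _ H2 H4); apply filter_imp; intros w [Ha Hb].
  transitivity ((f w - f z) * g w + f z * (g w - g z)); [ring|rewrite Ha, Hb; ring].
Qed.

Lemma cderiv_comp (f g : C -> C) (z d e : C) : cderiv f (g z) d -> cderiv g z e ->
  cderiv (fun w => f (g w)) z (d * e).
Proof.
intros Hf Hg; assert (Hc := cderiv_continuous _ _ _ Hg).
destruct Hf as [p [H1 H2]]; destruct Hg as [q [H3 H4]].
exists (fun w => p (g w) * q w); split.
- apply filterlim_Cmult; [|exact H3]. exact (filterlim_comp _ _ _ g p _ _ _ Hc H1).
- specialize (Hc _ H2); unfold filtermap in Hc.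
  generalize (filter_and _ _ Hc H4); apply filter_imp; intros w [Ha Hb].
  rewrite Ha, Hb; ring.
Qed.

Lemma cderiv_inv (f : C -> C) (z d : C) : f z <> 0 -> cderiv f z d ->
  cderiv (fun w => / f w) z (- d / (f z * f z)).
Proof.
intros Hz Hf; assert (Hc := cderiv_continuous _ _ _ Hf).
destruct Hf as [p [H1 H2]].
exists (fun w => - p w / (f w * f z)); split.
- apply filterlim_Cmult; [now apply filterlim_Copp|].
  apply filterlim_Cinv; [now apply Cmult_neq_0|].
  apply filterlim_Cmult; [exact Hc|apply filterlim_Cconst].
- assert (Hn : locally z (fun w => f w <> 0)).
  { assert (H0 : (0 < Cmod (f z))%R) by now apply Cmod_gt_0.
    generalize (proj1 (filterlim_Cmod _ _) Hc _ H0); apply filter_imp.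
    intros w Hw E; rewrite E in Hw; unfold Cminus in Hw; rewrite Cplus_0_l, Cmod_opp in Hw; lra. }
  generalize (filter_and _ _ H2 Hn); apply filter_imp; intros w [Ha Hb].
  transitivity (- (f w - f z) / (f w * f z)); [field; now split|].
  rewrite Ha; field; now split.
Qed.

(** Both slope functions equal the difference quotient at the nearby point [z + r/2], where each is
    closer to its limit than half of [|d - e|]. *)
Lemma cderiv_unique (f : C -> C) (z d e : C) : cderiv f z d -> cderiv f z e -> d = e.
Proof.
intros [p [H1 H2]] [q [H3 H4]].
destruct (classic (d = e)) as [|Hne]; [assumption|exfalso].
assert (Hne' := Csub_neq_0 _ _ Hne).
assert (He : (0 < Cmod (d - e) / 2)%R) by (generalize (proj1 (Cmod_gt_0 _) Hne'); lra).
generalize (filter_and _ _ (filter_and _ _ H2 H4) (filter_and _ _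
  (proj1 (filterlim_Cmod _ _) H1 _ He) (proj1 (filterlim_Cmod _ _) H3 _ He))).
intros H; apply locally_Cmod in H; destruct H as [r [Hr H]].
destruct (H (z + RtoC (r / 2))) as [[E1 E2] [L1 L2]].
{ replace (z + RtoC (r / 2) - z) with (RtoC (r / 2)) by ring.
  rewrite Cmod_R, Rabs_pos_eq; lra. }
set (w := z + RtoC (r / 2)) in *.
assert (Hw : w - z <> 0).
{ unfold w; replace (z + RtoC (r / 2) - z) with (RtoC (r / 2)) by ring.
  intros E; apply RtoC_inj in E; lra. }
assert (E : p w = q w).
{ transitivity (p w * (w - z) / (w - z)); [field; exact Hw|].
  rewrite <- E1, E2; field; exact Hw. }
rewrite E in L1.
assert (L := Cmod_sub_le d (q w) e); rewrite (Cmod_sub_sym d (q w)) in L; lra.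
Qed.

Lemma holo_on_mult (U : C -> Prop) (f g : C -> C) : holo_on U f -> holo_on U g ->
  holo_on U (fun w => f w * g w).
Proof.
intros [d Hd] [e He]; exists (fun w => d w * g w + f w * e w); intros z Hz.
destruct (Hd z Hz) as [H1 H2]; destruct (He z Hz) as [H3 H4]; split.
- now apply cderiv_mult.
- apply filterlim_Cplus; apply filterlim_Cmult; eauto using cderiv_continuous.
Qed.

Lemma holo_on_plus (U : C -> Prop) (f g : C -> C) : holo_on U f -> holo_on U g ->
  holo_on U (fun w => f w + g w).
Proof.
intros [d Hd] [e He]; exists (fun w => d w + e w); intros z Hz.
destruct (Hd z Hz) as [H1 H2]; destruct (He z Hz) as [H3 H4]; split.
- now apply cderiv_plus.
- now apply filterlim_Cplus.
Qed.

Lemma holo_on_const (U : C -> Prop) (c : C) : holo_on U (fun _ => c).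
Proof.
exists (fun _ => 0); intros z _; split; [apply cderiv_const|apply filterlim_Cconst].
Qed.

Lemma holo_on_id (U : C -> Prop) : holo_on U (fun w => w).
Proof.
exists (fun _ => 1); intros z _; split; [apply cderiv_id|apply filterlim_Cconst].
Qed.

Lemma holo_on_comp (U V : C -> Prop) (f g : C -> C) : holo_on V f -> holo_on U g ->
  (forall z, U z -> V (g z)) -> holo_on U (fun w => f (g w)).
Proof.
intros [d Hd] [e He] HUV; exists (fun w => d (g w) * e w); intros z Hz.
destruct (Hd _ (HUV z Hz)) as [H1 H2]; destruct (He z Hz) as [H3 H4]; split.
- now apply cderiv_comp.
- apply filterlim_Cmult; [|exact H4].
  exact (filterlim_comp _ _ _ g d _ _ _ (cderiv_continuous _ _ _ H3) H2).
Qed.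

Lemma holo_on_inv (U : C -> Prop) (f : C -> C) : holo_on U f ->
  (forall z, U z -> f z <> 0) -> holo_on U (fun w => / f w).
Proof.
intros [d Hd] Hn; exists (fun w => - d w / (f w * f w)); intros z Hz.
destruct (Hd z Hz) as [H1 H2]; specialize (Hn z Hz); split.
- now apply cderiv_inv.
- assert (Hc := cderiv_continuous _ _ _ H1).
  apply filterlim_Cmult; [now apply filterlim_Copp|].
  apply filterlim_Cinv; [now apply Cmult_neq_0|now apply filterlim_Cmult].
Qed.

Lemma holo_on_subset (U V : C -> Prop) (f : C -> C) : holo_on V f ->
  (forall z, U z -> V z) -> holo_on U f.
Proof. intros [d Hd] H; exists d; intros z Hz; apply Hd, H, Hz. Qed.

Lemma holo_on_pow (U : C -> Prop) (k : nat) : holo_on U (fun w => w ^ k).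
Proof.
induction k as [|k IH]; [exact (holo_on_const U 1)|].
exact (holo_on_mult U (fun w => w) _ (holo_on_id U) IH).
Qed.

Lemma holo_on_zpow (U : C -> Prop) (k : Z) : (forall z, U z -> z <> 0) ->
  holo_on U (fun w => zpow w k).
Proof.
intros H; destruct k as [|k|k]; [exact (holo_on_const U 1)|apply holo_on_pow|].
apply holo_on_inv; [apply holo_on_pow|]; intros z Hz; now apply Cpow_nz, H.
Qed.

Lemma holo_on_continuous (U : C -> Prop) (f : C -> C) (z : C) : holo_on U f -> U z ->
  filterlim f (locally z) (locally (f z)).
Proof. intros [d Hd] Hz; exact (cderiv_continuous _ _ _ (proj1 (Hd z Hz))). Qed.

(* The derivative is [a + i b]; the Cauchy-Riemann equations are the values
   [- b] and [a] of the [y]-derivatives. *)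
Lemma cderiv_CR (f : C -> C) (u v : R -> R -> R) (ux vx : R -> R -> R) (x y a b : R) :
  (forall x y, f (x, y) = (u x y, v x y)) ->
  locally (x, y) (fun p : R * R => is_derive (fun s => u s (snd p)) (fst p) (ux (fst p) (snd p))) ->
  locally (x, y) (fun p : R * R => is_derive (fun s => v s (snd p)) (fst p) (vx (fst p) (snd p))) ->
  is_derive (fun t => u x t) y (- b)%R -> is_derive (fun t => v x t) y a ->
  continuous (fun p : R * R => ux (fst p) (snd p)) (x, y) ->
  continuous (fun p : R * R => vx (fst p) (snd p)) (x, y) ->
  ux x y = a -> vx x y = b ->
  cderiv f (x, y) (a, b).
Proof.
intros Hf Hux Hvx Huy Hvy Cu Cv Ea Eb.
(* One partial derivative continuous at the point and the other merely existing there already give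
   total real differentiability. *)
assert (D1 := is_derive_filterdiff u x y ux _ Hux Huy Cu).
assert (D2 := is_derive_filterdiff v x y vx _ Hvx Hvy Cv).
rewrite Ea in D1; rewrite Eb in D2.
set (z := (x, y) : C).
set (phi := fun w : C => if excluded_middle_informative (w = z) then ((a, b) : C)
   else (f w - f z) / (w - z)).
assert (Hsub : forall w, w <> z -> w - z <> 0) by (intros w; apply Csub_neq_0).
exists phi; split.
2:{ apply filter_forall; intros w; unfold phi.
    destruct (excluded_middle_informative _) as [E|Hne].
    - rewrite E; ring.
    - change (f w - f z = (f w - f z) * / (w - z) * (w - z)).
      rewrite <- Cmult_assoc, Cinv_l by now apply Hsub. ring. }
apply filterlim_Cmod; intros eps He.
assert (He4 : (0 < eps / 8)%R) by lra.
destruct D1 as [_ D1]; specialize (D1 (x, y) (fun P HP => HP) (mkposreal _ He4)).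
destruct D2 as [_ D2]; specialize (D2 (x, y) (fun P HP => HP) (mkposreal _ He4)).
generalize (filter_and _ _ D1 D2).
apply (filter_imp (F := locally (z : C_UniformSpace))); intros w [L1 L2].
unfold phi; destruct (excluded_middle_informative _) as [E|Hne].
{ replace ((a, b) - (a, b)) with (RtoC 0) by ring; rewrite Cmod_0; exact He. }
assert (Hw := Hsub w Hne); assert (Hw0 := proj1 (Cmod_gt_0 _) Hw).
replace ((f w - f z) / (w - z) - (a, b)) with ((f w - f z - (a, b) * (w - z)) / (w - z))
  by (field; exact Hw).
rewrite Cmod_div by exact Hw.
apply Rmult_lt_reg_r with (Cmod (w - z)); [exact Hw0|].
unfold Rdiv at 1; rewrite Rmult_assoc, Rinv_l, Rmult_1_r by lra.
assert (Hn : (norm (minus w z : prod_NormedModule R_AbsRing R_NormedModule R_NormedModule) <= Cmod (w - z))%R).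
{ apply Req_le; symmetry; apply Cmod_norm. }
destruct w as [w1 w2]; unfold z in *; rewrite !Hf in *; simpl in L1, L2.
match type of L1 with (norm ?A <= _ * norm ?B)%R =>
  change (norm A) with (Rabs A) in L1; change (norm B <= Cmod ((w1, w2) - (x, y)))%R in Hn end.
match type of L2 with (norm ?A <= _ * _)%R => change (norm A) with (Rabs A) in L2 end.
set (h := Cmod ((w1, w2) - (x, y))) in *.
eapply Rle_lt_trans; [apply Cmod_le_Re_Im|].
match type of L1 with (_ <= _ * ?B)%R => set (nb := B) in * end.
match type of L1 with (Rabs ?A <= _)%R =>
  replace (Re ((u w1 w2, v w1 w2) - (u x y, v x y) - (a, b) * ((w1, w2) - (x, y)))) with A end.
2:{ unfold minus, plus, opp, scal; simpl; unfold mult; simpl; ring. }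
match type of L2 with (Rabs ?A <= _)%R =>
  replace (Im ((u w1 w2, v w1 w2) - (u x y, v x y) - (a, b) * ((w1, w2) - (x, y)))) with A end.
2:{ unfold minus, plus, opp, scal; simpl; unfold mult; simpl; ring. }
assert (eps / 8 * nb <= eps / 8 * h)%R by (apply Rmult_le_compat_l; lra).
assert (0 < eps * h)%R by now apply Rmult_lt_0_compat.
lra.
Qed.

(** * The exponential and the principal logarithm *)

Lemma holo_on_Cexp (U : C -> Prop) : holo_on U Cexp.
Proof.
exists Cexp; intros [x y] _; split.
2:{ apply filterlim_Cexp, filterlim_C_id. }
replace (Cexp (x, y)) with ((exp x * cos y, exp x * sin y)%R : C).
2:{ unfold Cexp; apply injective_projections; simpl; ring. }
apply (cderiv_CR Cexp (fun x y => exp x * cos y)%R (fun x y => exp x * sin y)%R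
  (fun x y => exp x * cos y)%R (fun x y => exp x * sin y)%R); try reflexivity.
- intros a b; unfold Cexp; apply injective_projections; simpl; ring.
- apply filter_forall; intros p; auto_derive; [trivial|ring].
- apply filter_forall; intros p; auto_derive; [trivial|ring].
- auto_derive; [trivial|ring].
- auto_derive; [trivial|ring].
- apply (filterlim_Rmult (F := locally (x, y)) (fun p => exp (fst p)) (fun p => cos (snd p))).
  + apply (filterlim_Rcomp _ exp); [apply derivable_continuous_pt, derivable_pt_exp|apply continuous_fst].
  + apply (filterlim_Rcomp _ cos); [apply continuity_cos|apply continuous_snd].
- apply (filterlim_Rmult (F := locally (x, y)) (fun p => exp (fst p)) (fun p => sin (snd p))).
  + apply (filterlim_Rcomp _ exp); [apply derivable_continuous_pt, derivable_pt_exp|apply continuous_fst].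
  + apply (filterlim_Rcomp _ sin); [apply continuity_sin|apply continuous_snd].
Qed.

Lemma Cexp_plus (x y : C) : Cexp (x + y) = Cexp x * Cexp y.
Proof.
destruct x as [a b], y as [c d]; unfold Cexp; simpl.
rewrite exp_plus, cos_plus, sin_plus; apply injective_projections; simpl; ring.
Qed.

Lemma Cexp_0 : Cexp 0 = 1.
Proof.
unfold Cexp; simpl; rewrite exp_0, cos_0, sin_0; apply injective_projections; simpl; ring.
Qed.

Lemma Cexp_neq_0 (x : C) : Cexp x <> 0.
Proof.
intros H; apply C1_neq_0; rewrite <- Cexp_0.
replace (RtoC 0) with (x + - x) by ring; rewrite Cexp_plus, H; ring.
Qed.

Lemma Cexp_opp (x : C) : Cexp (- x) = / Cexp x.
Proof.
assert (H : Cexp x * Cexp (- x) = 1).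
{ rewrite <- Cexp_plus, <- Cexp_0; f_equal; ring. }
transitivity (Cexp x * Cexp (- x) / Cexp x); [|rewrite H]; field; apply Cexp_neq_0.
Qed.

Lemma Cexp_conj (x : C) : Cexp (Cconj x) = Cconj (Cexp x).
Proof.
destruct x as [a b]; unfold Cexp, Cconj; simpl.
rewrite cos_neg, sin_neg; apply injective_projections; simpl; ring.
Qed.

Lemma Cexp_RtoC (x : R) : Cexp (RtoC x) = RtoC (exp x).
Proof.
unfold Cexp; simpl; rewrite cos_0, sin_0; apply injective_projections; simpl; ring.
Qed.

(* The principal branch, on the right half-plane only. *)
Definition Clog (z : C) : C := ((ln (Re z ^ 2 + Im z ^ 2) / 2)%R, atan (Im z / Re z)).

Lemma holo_on_Clog : holo_on (fun z => (0 < Re z)%R) Clog.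
Proof.
exists (fun z => / z); intros [x y] Hx; simpl in Hx.
assert (Hpos : forall a b : R, (0 < a)%R -> (0 < a * a + b * b)%R).
{ intros a b Ha; assert (0 < a * a)%R by now apply Rmult_lt_0_compat.
  assert (0 <= b * b)%R by apply Rle_0_sqr; lra. }
assert (Hn := Hpos x y Hx).
split.
2:{ apply filterlim_Cinv; [|apply filterlim_C_id].
    intros E; apply (f_equal fst) in E; simpl in E; lra. }
replace (/ ((x, y) : C)) with ((x / (x * x + y * y), - y / (x * x + y * y))%R : C).
2:{ unfold Cinv; apply injective_projections; simpl; rewrite !Rmult_1_r; reflexivity. }
assert (Hloc : locally (x, y) (fun p : R * R => (0 < fst p)%R)).
{ apply (continuous_fst (U := R_UniformSpace) (V := R_UniformSpace) x y (fun r => (0 < r)%R)).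
  now apply open_gt. }
assert (Hc : filterlim (fun p : R * R => / (fst p * fst p + snd p * snd p))%R (locally (x, y))
   (locally (/ (x * x + y * y))%R)).
{ apply (filterlim_Rcomp _ Rinv).
  - apply continuity_pt_inv; [apply continuity_pt_id|apply Rgt_not_eq, Hn].
  - apply filterlim_Rplus; apply filterlim_Rmult; (apply continuous_fst || apply continuous_snd). }
apply (cderiv_CR Clog (fun x y => ln (x ^ 2 + y ^ 2) / 2)%R (fun x y => atan (y / x))%R
  (fun x y => x / (x * x + y * y))%R (fun x y => - y / (x * x + y * y))%R); try reflexivity.
- revert Hloc; apply filter_imp; intros [a b] Ha; simpl in *; specialize (Hpos a b Ha).
  auto_derive; [repeat split; nra|field; repeat split; (lra || (apply Rgt_not_eq; nra))].
- revert Hloc; apply filter_imp; intros [a b] Ha; simpl in *; specialize (Hpos a b Ha).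
  auto_derive; [repeat split; lra|field; repeat split; (lra || (apply Rgt_not_eq; nra))].
- auto_derive; [repeat split; nra|field; repeat split; (lra || (apply Rgt_not_eq; nra))].
- auto_derive; [repeat split; lra|field; repeat split; (lra || (apply Rgt_not_eq; nra))].
- apply (filterlim_Rmult (F := locally (x, y)) (fun p => fst p)); [apply continuous_fst|exact Hc].
- apply (filterlim_Rmult (F := locally (x, y)) (fun p => - snd p)%R); [|exact Hc].
  apply filterlim_Ropp, continuous_snd.
Qed.

Lemma Clog_pos (x : R) : (0 < x)%R -> Clog (RtoC x) = RtoC (ln x).
Proof.
intros Hx; unfold Clog; simpl.
replace (x * (x * 1) + 0 * (0 * 1))%R with (x * x)%R by ring.
rewrite ln_mult by assumption.
replace (0 / x)%R with 0%R by (field; lra); rewrite atan_0.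
apply injective_projections; simpl; field.
Qed.

(** * Power series *)

(** Put [s = sqrt r]. Each of the [k + 1] terms of [1 + s + ... + s^k] is at least [s^k], so
    [(k + 1) s^k] stays below [1 / (1 - s)]; the remaining factor [s^k] of [r^k] is summable. *)
Lemma ex_series_linear_geom (r : R) : (0 < r < 1)%R ->
  ex_series (fun k => (INR k + 1) * r ^ k)%R.
Proof.
intros Hr.
set (s := sqrt r).
assert (Hs2 : (s * s = r)%R) by (apply sqrt_sqrt; lra).
assert (Hs0 : (0 < s)%R) by (apply sqrt_lt_R0; lra).
assert (Hs1 : (s < 1)%R) by nra.
assert (Hb : forall k, ((INR k + 1) * s ^ k * (1 - s) <= 1)%R).
{ assert (Hb : forall k, ((INR k + 1) * s ^ k * (1 - s) <= 1 - s ^ S k)%R).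
  { induction k as [|k IH]; [simpl; lra|].
    assert (Hp : (0 < s ^ k)%R) by now apply pow_lt.
    assert (Hp1 : (s ^ k <= 1)%R) by (apply Rle_trans with (1 ^ k)%R; [apply pow_incr; lra|rewrite pow1; lra]).
    rewrite S_INR; rewrite <- tech_pow_Rmult in IH |- *; rewrite <- tech_pow_Rmult.
    assert (H1 : (s * ((INR k + 1) * s ^ k * (1 - s)) <= s * (1 - s * s ^ k))%R)
      by (apply Rmult_le_compat_l; lra).
    assert (H2 : (0 <= (1 - s) * (1 - s * s ^ k))%R) by (apply Rmult_le_pos; nra).
    rewrite <- (tech_pow_Rmult s k); nra. }
  intros k; specialize (Hb k); assert (0 < s ^ S k)%R by now apply pow_lt. lra. }
apply (ex_series_le (V := R_CompleteNormedModule) _ (fun k => / (1 - s) * s ^ k)%R).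
2:{ apply ex_series_geom_scal; lra. }
intros k; specialize (Hb k).
assert (Hp : (0 < s ^ k)%R) by now apply pow_lt.
assert (H0 : (0 <= INR k)%R) by apply pos_INR.
change (Rabs ((INR k + 1) * r ^ k) <= / (1 - s) * s ^ k)%R.
rewrite <- Hs2, Rpow_mult_distr, Rabs_pos_eq by nra.
rewrite <- Rmult_assoc; apply Rmult_le_compat_r; [lra|].
apply Rmult_le_reg_r with (1 - s)%R; [lra|]. rewrite Rinv_l by lra; exact Hb.
Qed.

Lemma Csum_incr_1 (u : nat -> C) (M : nat -> R) : dominated u M ->
  Csum u = u 0%nat + Csum (fun k => u (S k)).
Proof.
intros H.
assert (E := is_series_sum_n_minus _ _ 0 (Csum_correct _ (dominated_ex_series _ _ H))).
rewrite sum_n_0 in E; apply is_series_Csum in E; simpl in E.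
rewrite E; ring.
Qed.

(** The sum of the [w^i z^(k-i)]: a division-free form of [(w^(k+1) - z^(k+1)) / (w - z)] that also
    makes sense at [w = z]. *)
Fixpoint pow_quot (k : nat) (w z : C) : C :=
  match k with
  | O => 1
  | S k => w * pow_quot k w z + z ^ S k
  end.

Lemma pow_quotE (k : nat) (w z : C) : w ^ S k - z ^ S k = pow_quot k w z * (w - z).
Proof.
induction k as [|k IH]; [simpl; ring|].
change (pow_quot (S k) w z) with (w * pow_quot k w z + z ^ S k).
rewrite (Cpow_S w (S k)), (Cpow_S z (S k)).
transitivity (w * (w ^ S k - z ^ S k) + z ^ S k * (w - z)); [ring|rewrite IH; ring].
Qed.

Lemma pow_quot_diag (k : nat) (z : C) : pow_quot k z z = RtoC (INR k + 1) * z ^ k.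
Proof.
induction k as [|k IH]; [simpl; rewrite Rplus_0_l; ring|].
change (pow_quot (S k) z z) with (z * pow_quot k z z + z ^ S k).
rewrite IH, S_INR, !RtoC_plus, Cpow_S; ring.
Qed.

Lemma pow_quot_bound (k : nat) (w z : C) (x : R) : (Cmod w <= x)%R -> (Cmod z <= x)%R ->
  (Cmod (pow_quot k w z) <= (INR k + 1) * x ^ k)%R.
Proof.
intros Hw Hz; assert (Hx : (0 <= x)%R) by (generalize (Cmod_ge_0 w); lra).
induction k as [|k IH]; [simpl; rewrite Cmod_1; lra|].
change (pow_quot (S k) w z) with (w * pow_quot k w z + z ^ S k).
eapply Rle_trans; [apply Cmod_triangle|].
rewrite S_INR, Cmod_mult, Cmod_pow.
assert (H1 : (Cmod z ^ S k <= x ^ S k)%R) by (apply pow_incr; split; [apply Cmod_ge_0|exact Hz]).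
assert (H2 : (Cmod w * Cmod (pow_quot k w z) <= x * ((INR k + 1) * x ^ k))%R).
{ apply Rmult_le_compat; auto using Cmod_ge_0. }
simpl in *; lra.
Qed.

Section PowerSeries.
Variables (a : nat -> C) (K rho : R).
Hypotheses (Hrho : (0 < rho)%R) (Ha : forall k, (Cmod (a k) <= K * rho ^ k)%R).

Definition pseries_val (z : C) : C := Csum (fun k => a k * z ^ k).

Lemma pseries_K : (0 <= K)%R.
Proof. generalize (Ha 0) (Cmod_ge_0 (a 0)); simpl; lra. Qed.

Lemma pseries_dominated (z : C) : (rho * Cmod z < 1)%R ->
  dominated (fun k => a k * z ^ k) (fun k => K * (rho * Cmod z) ^ k)%R.
Proof.
intros Hz; split.
- apply ex_series_geom_scal; split; [|exact Hz].
  apply Rmult_le_pos; [lra|apply Cmod_ge_0].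
- intros k; rewrite Cmod_mult, Cmod_pow, Rpow_mult_distr, <- Rmult_assoc.
  apply Rmult_le_compat_r; [apply pow_le, Cmod_ge_0|apply Ha].
Qed.

(** Used twice: with [g k] a [pow_quot] it gives the limit of the slope function, with [g k] a
    monomial the continuity of the derivative. In both cases a linear-geometric series dominates
    near [z]. *)
Lemma pseries_filterlim_shift (g : nat -> C -> C) (z : C) : (rho * Cmod z < 1)%R ->
  (forall k, filterlim (g k) (locally z) (locally (g k z))) ->
  (forall k w x, (Cmod w <= x)%R -> (Cmod z <= x)%R -> (Cmod (g k w) <= (INR k + 1) * x ^ k)%R) ->
  filterlim (fun w => Csum (fun k => a (S k) * g k w)) (locally z)
    (locally (Csum (fun k => a (S k) * g k z))).
Proof.
intros Hz Hg Hb.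
(* The midpoint of [rho |z|] and 1, so that the radius [x = q / rho] lies strictly between [|z|] and
   the radius of convergence [1 / rho]. *)
set (q := ((1 + rho * Cmod z) / 2)%R).
assert (Hc0 := Cmod_ge_0 z).
assert (Hrz : (0 <= rho * Cmod z)%R) by (apply Rmult_le_pos; lra).
set (x := (q / rho)%R).
assert (Hxr : (rho * x = q)%R) by (unfold x; field; lra).
assert (Hzx : (Cmod z < x)%R).
{ apply Rmult_lt_reg_l with rho; [exact Hrho|]. rewrite Hxr; unfold q; lra. }
assert (HK := pseries_K).
assert (Hbd : forall w, (Cmod w <= x)%R -> forall k,
  (Cmod (a (S k) * g k w) <= K * rho * ((INR k + 1) * q ^ k))%R).
{ intros w Hw k; rewrite Cmod_mult, <- Hxr, Rpow_mult_distr.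
  replace (K * rho * ((INR k + 1) * (rho ^ k * x ^ k)))%R
    with (K * rho ^ S k * ((INR k + 1) * x ^ k))%R by (simpl; ring).
  apply Rmult_le_compat; try apply Cmod_ge_0; [apply Ha|]. apply Hb; lra. }
apply (filterlim_Csum _ _ (fun k => K * rho * ((INR k + 1) * q ^ k))%R).
- intros k; apply filterlim_Cmult; [apply filterlim_Cconst|apply Hg].
- split.
  + apply (ex_series_scal (V := R_NormedModule)).
    apply ex_series_linear_geom; unfold q; lra.
  + intros k; apply Hbd; lra.
- apply locally_Cmod; exists (x - Cmod z)%R; split; [lra|].
  intros w Hw; apply Hbd.
  replace w with ((w - z) + z) by ring.
  eapply Rle_trans; [apply Cmod_triangle|lra].
Qed.

Lemma holo_on_pseries : holo_on (fun z => (rho * Cmod z < 1)%R) pseries_val.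
Proof.
exists (fun z => Csum (fun k => a (S k) * (RtoC (INR k + 1) * z ^ k))).
intros z Hz; split.
- exists (fun w => Csum (fun k => a (S k) * pow_quot k w z)); split.
  + apply (filterlim_eq_target _ (Csum (fun k => a (S k) * pow_quot k z z))).
    { apply Csum_ext; intros k; now rewrite pow_quot_diag. }
    apply (pseries_filterlim_shift (fun k w => pow_quot k w z) z Hz).
    * intros k; induction k as [|k IH]; [exact (filterlim_Cconst (T := C) (F := locally z) 1)|].
      apply filterlim_Cplus; [|apply filterlim_Cconst].
      apply filterlim_Cmult; [apply filterlim_C_id|exact IH].
    * intros k w x Hw Hzx; now apply pow_quot_bound.
  + assert (Hloc : locally z (fun w => (rho * Cmod w < 1)%R)).
    { assert (Hcm := filterlim_Cmod_comp _ _ (filterlim_C_id z)).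
      assert (Hlt : (Cmod z < / rho)%R).
      { apply Rmult_lt_reg_l with rho; [exact Hrho|]. rewrite Rinv_r by lra; exact Hz. }
      generalize (Hcm _ (open_lt (/ rho) _ Hlt)); unfold filtermap; apply filter_imp.
      intros w Hw. apply Rmult_lt_reg_l with (/ rho)%R; [now apply Rinv_0_lt_compat|].
      rewrite <- Rmult_assoc, Rinv_l; lra. }
    revert Hloc; apply filter_imp; intros w Hw.
    assert (Dw := pseries_dominated w Hw); assert (Dz := pseries_dominated z Hz).
    unfold pseries_val.
    assert (D : dominated (fun k => a k * w ^ k + - (a k * z ^ k)) _)
      by exact (dominated_plus _ _ _ _ Dw (dominated_opp _ _ Dz)).
    transitivity (Csum (fun k => a k * w ^ k + - (a k * z ^ k))).
    { rewrite (Csum_plus _ _ _ _ Dw (dominated_opp _ _ Dz)), Csum_opp; reflexivity. }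
    rewrite (Csum_incr_1 _ _ D).
    transitivity (Csum (fun k => (w - z) * (a (S k) * pow_quot k w z))).
    { rewrite (Csum_ext (fun k => (w - z) * (a (S k) * pow_quot k w z))
        (fun k => a (S k) * w ^ S k + - (a (S k) * z ^ S k))).
      - simpl; ring.
      - intros k. transitivity (a (S k) * (pow_quot k w z * (w - z))); [ring|].
        rewrite <- pow_quotE; ring. }
    (* The series of quotients is shown to be dominated by dividing the difference of two dominated
       series by [w - z], so [w = z] is treated apart. *)
    destruct (classic (w = z)) as [->|Hne].
    { replace (z - z) with (RtoC 0) by ring.
      rewrite (Csum_ext _ (fun _ => 0)) by (intros; ring).
      rewrite Csum_0; ring. }
    assert (D' := dominated_tail _ _ 0 D); simpl in D'.
    assert (Hn := Csub_neq_0 w z Hne).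
    assert (D'' : exists N, dominated (fun k => a (S k) * pow_quot k w z) N).
    { assert (D3 := dominated_scal (/ (w - z)) _ _ D').
      destruct D3 as [D31 D32]; eexists; split; [exact D31|].
      intros k; eapply Rle_trans; [|apply (D32 k)]; apply Req_le; f_equal.
      transitivity (/ (w - z) * (a (S k) * (w ^ S k - z ^ S k))); [|simpl; ring].
      rewrite pow_quotE; field; exact Hn. }
    destruct D'' as [N D'']; rewrite (Csum_scal (w - z) _ _ D''); ring.
- apply (pseries_filterlim_shift (fun k w => RtoC (INR k + 1) * w ^ k) z Hz).
  + intros k; apply filterlim_Cmult; [apply filterlim_Cconst|].
    apply filterlim_Cpow, filterlim_C_id.
  + intros k w x Hw Hzx; rewrite Cmod_mult, Cmod_R, Cmod_pow.
    assert (0 <= INR k)%R by apply pos_INR.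
    rewrite Rabs_pos_eq by lra; apply Rmult_le_compat_l; [lra|].
    apply pow_incr; split; [apply Cmod_ge_0|exact Hw].
Qed.

End PowerSeries.

Lemma pow_n_Cpow (z : C) (k : nat) : pow_n (K := C_Ring) z k = z ^ k.
Proof. induction k as [|k IH]; [reflexivity|]. simpl; now rewrite IH. Qed.

Lemma is_pseries_Csum (a : nat -> C) (z y : C) :
  is_pseries (K := C_AbsRing) (V := C_NormedModule) a z y ->
  is_series (fun k => a k * z ^ k) y.
Proof.
intros H; eapply is_series_ext; [|exact H].
intros k; unfold scal; simpl.
change (pow_n (K := C_Ring) z k * a k = a k * z ^ k); rewrite pow_n_Cpow; ring.
Qed.

Lemma is_series_terms_bounded (u : nat -> C) (l : C) : is_series u l ->
  exists M, forall k, (Cmod (u k) <= M)%R.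
Proof.
intros H.
destruct (filterlim_bounded (K := C_AbsRing) (V := C_NormedModule) (sum_n u)) as [M HM].
{ now exists l. }
exists (2 * M)%R.
assert (HM' : forall k, (Cmod (sum_n u k) <= M)%R) by exact HM.
assert (H0 := HM' 0%nat); assert (Hp := Cmod_ge_0 (sum_n u 0)).
intros [|k].
- rewrite sum_n_0 in H0, Hp; lra.
- assert (E : u (S k) = sum_n u (S k) - sum_n u k) by (rewrite sum_n_S; ring).
  rewrite E; eapply Rle_trans; [apply Cmod_triangle|].
  rewrite Cmod_opp; generalize (HM' (S k)) (HM' k); lra.
Qed.

(** Abel's lemma: the terms at a single point at distance [e/2] are bounded, which yields the
    geometric bound on the coefficients that [holo_on_pseries] asks for. *)
Lemma analytic_at_cderiv (f : C -> C) (z0 : C) : analytic_at f z0 ->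
  exists d : C -> C, locally z0 (fun w => cderiv f w (d w)) /\
    filterlim d (locally z0) (locally (d z0)).
Proof.
intros [a Ha]; apply locally_Cmod in Ha; destruct Ha as [e [He Ha]].
set (dl := (e / 2)%R).
assert (Hdl : (0 < dl)%R) by (unfold dl; lra).
assert (Hs : forall w, (Cmod (w - z0) < e)%R -> is_series (fun k => a k * (w - z0) ^ k) (f w))
  by (intros w Hw; now apply is_pseries_Csum, Ha).
destruct (is_series_terms_bounded (fun k => a k * RtoC dl ^ k) (f (z0 + RtoC dl))) as [M HM].
{ apply (is_series_ext (fun k => a k * (z0 + RtoC dl - z0) ^ k)).
  - intros k; do 2 f_equal; ring.
  - apply Hs; replace (z0 + RtoC dl - z0) with (RtoC dl) by ring.
    rewrite Cmod_R, Rabs_pos_eq by lra; unfold dl; lra. }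
assert (Hrho : (0 < / dl)%R) by now apply Rinv_0_lt_compat.
assert (Hak : forall k, (Cmod (a k) <= M * (/ dl) ^ k)%R).
{ intros k; specialize (HM k); rewrite Cmod_mult, Cmod_pow, Cmod_R, Rabs_pos_eq in HM by lra.
  assert (Hp : (0 < dl ^ k)%R) by now apply pow_lt.
  rewrite pow_inv; apply Rmult_le_reg_r with (dl ^ k)%R; [exact Hp|].
  rewrite Rmult_assoc, Rinv_l by lra; lra. }
destruct (holo_on_pseries a M (/ dl) Hrho Hak) as [d Hd].
assert (Hin : forall w, (Cmod (w - z0) < dl)%R -> (/ dl * Cmod (w - z0) < 1)%R).
{ intros w Hw; apply Rmult_lt_reg_l with dl; [exact Hdl|].
  rewrite <- Rmult_assoc, Rinv_r by lra; lra. }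
assert (Hz0 : (Cmod (z0 - z0) < dl)%R).
{ replace (z0 - z0) with (RtoC 0) by ring; rewrite Cmod_0; exact Hdl. }
assert (Hshift : forall w, cderiv (fun w => w - z0) w 1).
{ intros w; exists (fun _ => 1); split; [apply filterlim_Cconst|].
  apply filter_forall; intros x; change (x - z0 - (w - z0) = 1 * (x - w)); ring. }
exists (fun w => d (w - z0)); split.
- apply locally_Cmod; exists dl; split; [exact Hdl|]; intros w Hw.
  assert (Hc := cderiv_comp _ (fun w => w - z0) w _ _ (proj1 (Hd _ (Hin w Hw))) (Hshift w)).
  rewrite Cmult_1_r in Hc; revert Hc; apply cderiv_ext_loc.
  apply locally_Cmod; exists (dl - Cmod (w - z0))%R; split; [lra|]; intros x Hx.
  assert (Hx' : (Cmod (x - z0) < dl)%R) by (generalize (Cmod_sub_le x w z0); lra).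
  apply is_series_Csum, Hs; unfold dl in Hx'; lra.
- apply (filterlim_comp _ _ _ (fun w => w - z0) d (locally z0) (locally (z0 - z0)));
    [|apply Hd, Hin, Hz0].
  apply (cderiv_continuous _ _ _ (Hshift z0)).
Qed.

(** Each local expansion brings its own derivative function; uniqueness of the derivative glues them
    into the single [D] chosen by [epsilon]. *)
Lemma analytic_holo_on (U : C -> Prop) (f : C -> C) :
  (forall z, U z -> analytic_at f z) -> holo_on U f.
Proof.
intros H.
set (D := fun w => epsilon (inhabits (RtoC 0)) (fun d => cderiv f w d)).
assert (HD : forall w d, cderiv f w d -> D w = d).
{ intros w d Hd; apply (cderiv_unique f w); [|exact Hd].
  apply epsilon_spec; now exists d. }
exists D; intros z Hz.
destruct (analytic_at_cderiv f z (H z Hz)) as [d [H1 H2]].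
assert (H3 := locally_singleton _ _ H1).
rewrite (HD z _ H3); split; [exact H3|].
apply (filterlim_ext_loc d); [|exact H2].
revert H1; apply filter_imp; intros w Hw; symmetry; now apply HD.
Qed.

(** * Circular means of holomorphic functions *)

(** Chain rule along a real curve by Caratheodory's device on both sides: the slope of the composite
    is [phi (g x)] times the slope [q x] of the curve. *)
Lemma cderiv_curve_Re (f : C -> C) (g : R -> C) (s : R) (d e : C) :
  cderiv f (g s) d ->
  is_derive (fun x => Re (g x)) s (Re e) -> is_derive (fun x => Im (g x)) s (Im e) ->
  is_derive (fun x => Re (f (g x))) s (Re (d * e)).
Proof.
intros [phi [H1 H2]] Hr Hi.
assert (Cg : filterlim g (locally s) (locally (g s))).
{ apply (filterlim_ext (fun x => (Re (g x), Im (g x)) : C)); [intros x; now destruct (g x)|].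
  replace (g s) with ((Re (g s), Im (g s)) : C) by now destruct (g s).
  apply filterlim_Cpair.
  - apply (ex_derive_continuous (fun x => Re (g x))); eexists; exact Hr.
  - apply (ex_derive_continuous (fun x => Im (g x))); eexists; exact Hi. }
assert (Cphi := filterlim_comp _ _ _ g phi _ _ _ Cg H1).
assert (Leq := Cg _ H2); unfold filtermap in Leq.
apply is_derive_Reals in Hr; apply is_derive_Reals in Hi.
set (q := fun x => if Req_EM_T x s then e else (g x - g s) / RtoC (x - s)).
assert (Hq : filterlim q (locally s) (locally e)).
{ apply filterlim_Cmod; intros eps He.
  assert (He2 : (0 < eps / 2)%R) by lra.
  destruct (Hr _ He2) as [d1 Hd1]; destruct (Hi _ He2) as [d2 Hd2].
  exists (mkposreal _ (Rmin_pos _ _ (cond_pos d1) (cond_pos d2))).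
  cut (forall x : R, (Rabs (x - s) < Rmin d1 d2)%R -> (Cmod (q x - e) < eps)%R).
  { intros Hq x; exact (Hq x). }
  intros x Hx.
  assert (Hx1 := Rlt_le_trans _ _ _ Hx (Rmin_l _ _)).
  assert (Hx2 := Rlt_le_trans _ _ _ Hx (Rmin_r _ _)).
  unfold q; destruct (Req_EM_T x s) as [Hxs|Hxs].
  { replace (e - e) with (RtoC 0) by ring; now rewrite Cmod_0. }
  assert (Hh : (x - s <> 0)%R) by lra.
  specialize (Hd1 _ Hh Hx1); specialize (Hd2 _ Hh Hx2).
  replace (s + (x - s))%R with x in Hd1, Hd2 by ring.
  assert (E : (g x - g s) / RtoC (x - s) =
    ((Re (g x) - Re (g s)) / (x - s), (Im (g x) - Im (g s)) / (x - s))%R).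
  { destruct (g x), (g s); apply injective_projections; simpl; field; exact Hh. }
  rewrite E; eapply Rle_lt_trans; [apply Cmod_le_Re_Im|].
  rewrite Re_Cminus, Im_Cminus; simpl in *; lra. }
assert (HF : filterlim (fun x => phi (g x) * q x) (locally s) (locally (d * e)))
  by now apply filterlim_Cmult.
apply is_derive_Reals; intros eps He.
assert (HRe := proj1 (filterlim_Cmod _ _) HF eps He).
destruct (filter_and _ _ HRe Leq) as [dl Hdl].
exists dl; intros h Hh Hhd.
assert (Hb : ball s dl (s + h)%R).
{ change (Rabs (s + h - s) < dl)%R; now replace (s + h - s)%R with h by ring. }
destruct (Hdl _ Hb) as [L1 L2].
eapply Rle_lt_trans; [|exact L1].
replace ((Re (f (g (s + h)%R)) - Re (f (g s))) / h - Re (d * e))%R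
  with (Re (phi (g (s + h)%R) * q (s + h)%R - d * e)); [apply re_le_Cmod|].
rewrite Re_Cminus; f_equal.
unfold q; destruct (Req_EM_T (s + h) s) as [Hx|_]; [lra|].
replace (s + h - s)%R with h by ring.
assert (Hhc : RtoC h <> 0) by now apply RtoC_neq_0.
replace (phi (g (s + h)%R) * ((g (s + h)%R - g s) / RtoC h))
  with ((f (g (s + h)%R) - f (g s)) / RtoC h).
- destruct (f (g (s + h)%R)), (f (g s)); simpl; field; exact Hh.
- rewrite L2; field; exact Hhc.
Qed.

(** Retraction of the line onto [[s0, s1]]. It extends functions of the radius past the end points,
    where only one-sided continuity is known, so that two-sided continuity lemmas and the mean value
    theorem apply. *)
Definition clamp (s0 s1 s : R) : R := Rmax s0 (Rmin s s1).

Lemma clamp_bounds (s0 s1 s : R) : (s0 <= s1)%R -> (s0 <= clamp s0 s1 s <= s1)%R.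
Proof.
intros H; unfold clamp; split; [apply Rmax_l|].
apply Rmax_lub; [exact H|apply Rmin_r].
Qed.

Lemma clamp_id (s0 s1 s : R) : (s0 <= s <= s1)%R -> clamp s0 s1 s = s.
Proof.
intros H; unfold clamp; rewrite Rmin_left by lra; now apply Rmax_right.
Qed.

Lemma clamp_lipschitz (s0 s1 s t : R) : (Rabs (clamp s0 s1 s - clamp s0 s1 t) <= Rabs (s - t))%R.
Proof.
unfold clamp, Rmax, Rmin; repeat destruct Rle_dec;
  unfold Rabs; repeat destruct Rcase_abs; lra.
Qed.

Definition annulus (s0 s1 : R) (w : C) : Prop := (s0 < Cmod w < s1)%R.
Definition cannulus (s0 s1 : R) (w : C) : Prop := (s0 <= Cmod w <= s1)%R.
Definition cont_on (D : C -> Prop) (f : C -> C) : Prop :=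
  forall w, D w -> filterlim f (within D (locally w)) (locally (f w)).

Lemma Cmod_scal_eit (s t : R) : (0 <= s)%R -> Cmod (RtoC s * eit t) = s.
Proof.
intros Hs; rewrite Cmod_mult, Cmod_eit, Cmod_R, Rabs_pos_eq by exact Hs; ring.
Qed.

Lemma filterlim_scal_eit (s t : R) :
  filterlim (fun p : R * R => RtoC (fst p) * eit (snd p)) (locally (s, t))
    (locally (RtoC s * eit t)).
Proof.
apply (filterlim_Cmult (F := locally (s, t)) (fun p => RtoC (fst p)) (fun p => eit (snd p))).
- apply (filterlim_RtoC (F := locally (s, t)) (fun p => fst p)), continuous_fst.
- apply (filterlim_comp _ _ _ (fun p : R * R => snd p) eit _ (locally t));
    [apply continuous_snd|apply continuous_eit].
Qed.

Section CircleMean.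
Variables (H : C -> C) (s0 s1 : R).
Hypotheses (Hs0 : (0 <= s0)%R) (Hs : (s0 < s1)%R)
  (Hh : holo_on (annulus s0 s1) H) (Hc : cont_on (cannulus s0 s1) H).

Let G (s t : R) : R := Re (H (RtoC (clamp s0 s1 s) * eit t)).

Lemma circle_mean_continuous_2d (s t : R) : continuity_2d_pt G s t.
Proof.
apply continuity_2d_pt_filterlim.
apply (filterlim_Re (F := locally (s, t)) (fun p => H (RtoC (clamp s0 s1 (fst p)) * eit (snd p)))).
assert (Hb := clamp_bounds s0 s1 s (Rlt_le _ _ Hs)).
assert (Hin : forall p : R * R, cannulus s0 s1 (RtoC (clamp s0 s1 (fst p)) * eit (snd p))).
{ intros p; assert (Hb' := clamp_bounds s0 s1 (fst p) (Rlt_le _ _ Hs)).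
  unfold cannulus; rewrite Cmod_scal_eit; lra. }
assert (Hcl : filterlim (clamp s0 s1) (locally s) (locally (clamp s0 s1 s))).
{ apply filterlim_locally; intros eps; exists eps; intros x Hx.
  change (Rabs (clamp s0 s1 x - clamp s0 s1 s) < eps)%R.
  eapply Rle_lt_trans; [apply clamp_lipschitz|exact Hx]. }
assert (HL : filterlim (fun p : R * R => RtoC (clamp s0 s1 (fst p)) * eit (snd p)) (locally (s, t))
   (locally (RtoC (clamp s0 s1 s) * eit t))).
{ apply (filterlim_Cmult (F := locally (s, t)) (fun p => RtoC (clamp s0 s1 (fst p))) (fun p => eit (snd p))).
  - apply (filterlim_RtoC (F := locally (s, t)) (fun p => clamp s0 s1 (fst p))).
    apply (filterlim_comp _ _ _ (fun p : R * R => fst p) (clamp s0 s1) _ (locally s));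
      [apply continuous_fst|exact Hcl].
  - apply (filterlim_comp _ _ _ (fun p : R * R => snd p) eit _ (locally t));
      [apply continuous_snd|apply continuous_eit]. }
intros P HP.
assert (HP' := Hc _ (Hin (s, t)) P HP); unfold filtermap, within in HP'; simpl in HP'.
specialize (HL _ HP'); unfold filtermap in HL |- *.
revert HL; apply filter_imp; intros p Hp; apply Hp, Hin.
Qed.

Lemma circle_mean_continuous_t (s t : R) : continuous (G s) t.
Proof.
apply continuity_pt_filterlim; intros eps He.
destruct (circle_mean_continuous_2d s t (mkposreal eps He)) as [d Hd].
exists d; split; [apply cond_pos|]; intros x [_ Hx].
apply Hd; [|exact Hx]. rewrite Rminus_diag, Rabs_R0; apply cond_pos.
Qed.

Lemma circle_mean_ex_RInt (s a b : R) : ex_RInt (G s) a b.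
Proof.
apply (ex_RInt_continuous (V := R_CompleteNormedModule)); intros t _.
apply circle_mean_continuous_t.
Qed.

Let I (s : R) : R := RInt (G s) 0 (2 * PI).

Lemma circle_mean_continuous (s : R) : continuity_pt I s.
Proof.
assert (HP := PI_RGT_0).
intros eps He.
(* The [+ 1] makes the bound on the integral over length [2 * PI] strictly smaller than [eps]. *)
assert (He' : (0 < eps / (2 * PI + 1))%R) by (apply Rdiv_lt_0_compat; lra).
destruct (uniform_continuity_2d G (s - 1) (s + 1) 0 (2 * PI)
  (fun x y _ _ => circle_mean_continuous_2d x y) (mkposreal _ He')) as [d Hd].
exists (Rmin d 1); split; [apply Rmin_pos; [apply cond_pos|lra]|].
intros x [_ Hx]; simpl in Hx; unfold R_dist in *.
change (Rabs (x - s) < Rmin d 1)%R in Hx.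
assert (Hx1 := Rlt_le_trans _ _ _ Hx (Rmin_l _ _)).
assert (Hx2 := Rlt_le_trans _ _ _ Hx (Rmin_r _ _)).
apply Rabs_def2 in Hx2.
change (Rabs (I x - I s) < eps)%R.
assert (E : (I x - I s)%R = RInt (fun t => 1 * G x t + (-1) * G s t)%R 0 (2 * PI)).
{ rewrite RInt_lin by apply circle_mean_ex_RInt; unfold I; ring. }
rewrite E.
assert (Hle : (Rabs (RInt (fun t => 1 * G x t + (-1) * G s t)%R 0 (2 * PI)) <= (2 * PI - 0) * (eps / (2 * PI + 1)))%R).
{ apply (norm_RInt_le_const (V := R_NormedModule) (fun t => 1 * G x t + (-1) * G s t)%R 0 (2 * PI)).
  - lra.
  - intros t Ht; change (Rabs (1 * G x t + (-1) * G s t) <= eps / (2 * PI + 1))%R.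
    replace (1 * G x t + -1 * G s t)%R with (G x t - G s t)%R by ring.
    apply Rlt_le, (Hd s t x t); try lra.
    rewrite Rminus_diag, Rabs_R0; apply cond_pos.
  - apply (RInt_correct (V := R_CompleteNormedModule)).
    apply (ex_RInt_plus (V := R_NormedModule) (fun t => 1 * G x t)%R (fun t => (-1) * G s t)%R);
      apply (ex_RInt_scal (V := R_NormedModule)); apply circle_mean_ex_RInt. }
eapply Rle_lt_trans; [exact Hle|].
apply Rmult_lt_reg_r with (2 * PI + 1)%R; [lra|].
replace ((2 * PI - 0) * (eps / (2 * PI + 1)) * (2 * PI + 1))%R with (2 * PI * eps)%R by (field; lra).
nra.
Qed.

(* [s d/ds] and [- i d/dt] agree on [H (s e^{it})], and the latter integrates to 0. *)
Lemma circle_mean_derive (s : R) : (s0 < s < s1)%R -> is_derive I s 0%R.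
Proof.
intros Hss; destruct Hh as [d Hd].
assert (Hin : forall x t, (s0 < x < s1)%R -> annulus s0 s1 (RtoC x * eit t)).
{ intros x t Hx; unfold annulus; rewrite Cmod_scal_eit; lra. }
assert (Hnear : locally s (fun x => (s0 < x < s1)%R)).
{ apply (locally_interval _ s s0 s1); simpl; try lra. intros; now split. }
set (K := fun x t : R => Re (H (RtoC x * eit t))).
assert (HKG : forall x t, (s0 < x < s1)%R -> K x t = G x t).
{ intros x t Hx; unfold K, G; rewrite clamp_id by lra; reflexivity. }
assert (Dx : forall x t, (s0 < x < s1)%R ->
   is_derive (fun x => K x t) x (Re (d (RtoC x * eit t) * eit t))).
{ intros x t Hx.
  apply (cderiv_curve_Re H (fun x => RtoC x * eit t)); [apply Hd, Hin, Hx| |].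
  - simpl; auto_derive; [trivial|ring].
  - simpl; auto_derive; [trivial|ring]. }
assert (Dt : forall t, is_derive (fun t => Re (- Ci * H (RtoC s * eit t))) t
   (s * Re (d (RtoC s * eit t) * eit t)%C)%R).
{ intros t.
  assert (Hm : cderiv (fun w => - Ci * H w) (RtoC s * eit t) (- Ci * d (RtoC s * eit t))).
  { replace (- Ci * d (RtoC s * eit t)) with
      (0 * H (RtoC s * eit t) + - Ci * d (RtoC s * eit t)) by ring.
    apply (cderiv_mult (fun _ => - Ci)); [apply cderiv_const|apply Hd, Hin, Hss]. }
  replace (s * Re (d (RtoC s * eit t) * eit t)%C)%R
    with (Re (- Ci * d (RtoC s * eit t) * (RtoC s * (Ci * eit t)))).
  2:{ replace (- Ci * d (RtoC s * eit t) * (RtoC s * (Ci * eit t)))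
        with (RtoC s * (d (RtoC s * eit t) * eit t) * (- (Ci * Ci))) by ring.
      replace (- (Ci * Ci)) with (RtoC 1) by (unfold Ci; apply injective_projections; simpl; ring).
      rewrite Cmult_1_r; simpl; ring. }
  apply (cderiv_curve_Re (fun w => - Ci * H w) (fun t => RtoC s * eit t)); [exact Hm| |].
  - simpl; auto_derive; [trivial|ring].
  - simpl; auto_derive; [trivial|ring]. }
assert (Cd : forall x t, (s0 < x < s1)%R ->
  filterlim (fun p : R * R => Re (d (RtoC (fst p) * eit (snd p)) * eit (snd p))) (locally (x, t))
    (locally (Re (d (RtoC x * eit t) * eit t)))).
{ intros x t Hx.
  apply (filterlim_Re (F := locally (x, t)) (fun p => d (RtoC (fst p) * eit (snd p)) * eit (snd p))).
  apply (filterlim_Cmult (F := locally (x, t)) (fun p => d (RtoC (fst p) * eit (snd p))) (fun p => eit (snd p))).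
  - apply (filterlim_comp _ _ _ (fun p : R * R => RtoC (fst p) * eit (snd p)) d _ _ _ (filterlim_scal_eit x t)).
    apply Hd, Hin, Hx.
  - apply (filterlim_comp _ _ _ (fun p : R * R => snd p) eit _ (locally t));
      [apply continuous_snd|apply continuous_eit]. }
assert (DI : is_derive (fun x => RInt (fun t => K x t) 0 (2 * PI)) s
   (RInt (fun t => Derive (fun x => K x t) s) 0 (2 * PI))).
{ apply is_derive_RInt_param.
  - revert Hnear; apply filter_imp; intros x Hx t _; eexists; now apply Dx.
  - intros t _.
    apply (continuity_2d_pt_ext_loc (fun x t => Re (d (RtoC x * eit t) * eit t))).
    + destruct Hnear as [r Hr]; exists r; intros x u Hx Hu.
      symmetry; apply is_derive_unique, Dx, Hr, Hx.
    + apply continuity_2d_pt_filterlim; now apply Cd.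
  - revert Hnear; apply filter_imp; intros x Hx.
    eapply ex_RInt_ext; [|apply (circle_mean_ex_RInt x 0 (2 * PI))].
    intros t _; simpl; symmetry; now apply HKG. }
assert (E0 : RInt (fun t => Derive (fun x => K x t) s) 0 (2 * PI) = 0%R).
{ rewrite (RInt_eq _ (fun t => Re (d (RtoC s * eit t) * eit t)))
    by (intros t; apply is_derive_unique, Dx, Hss).
  assert (Hr : is_RInt (fun t => s * Re (d (RtoC s * eit t) * eit t)%C)%R 0 (2 * PI)
     (minus (Re (- Ci * H (RtoC s * eit (2 * PI)))) (Re (- Ci * H (RtoC s * eit 0))))).
  { apply (is_RInt_derive (V := R_CompleteNormedModule) (fun t => Re (- Ci * H (RtoC s * eit t)))).
    - intros t _; apply Dt.
    - intros t _; apply filterlim_Rmult; [apply filterlim_const|].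
      assert (HC := Cd s t Hss).
      apply (filterlim_comp _ _ _ (fun t : R => (s, t))
        (fun p : R * R => Re (d (RtoC (fst p) * eit (snd p)) * eit (snd p))) (locally t) (locally (s, t)));
        [|exact HC].
      intros P [r HP]; exists r; intros u Hu; apply HP; split; [apply ball_center|exact Hu]. }
  assert (E2 : eit (2 * PI) = eit 0) by (unfold eit; now rewrite cos_2PI, sin_2PI, cos_0, sin_0).
  rewrite E2, minus_eq_zero in Hr.
  apply (is_RInt_scal (V := R_NormedModule) _ _ _ (/ s)) in Hr.
  transitivity (scal (/ s)%R (zero : R_NormedModule));
    [|unfold scal, zero; simpl; unfold mult; simpl; ring].
  apply is_RInt_unique.
  eapply is_RInt_ext; [|exact Hr].
  intros t _; unfold scal; simpl; unfold mult; simpl; field; lra. }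
rewrite E0 in DI.
eapply is_derive_ext_loc; [|exact DI].
revert Hnear; apply filter_imp; intros x Hx; unfold I.
apply RInt_eq; intros t; now apply HKG.
Qed.

Lemma RInt_circle_Re_const :
  RInt (fun t => Re (H (RtoC s0 * eit t))) 0 (2 * PI) =
  RInt (fun t => Re (H (RtoC s1 * eit t))) 0 (2 * PI).
Proof.
destruct (MVT_gen I s0 s1 (fun _ => 0%R)) as [c [_ E]].
- rewrite Rmin_left, Rmax_right by lra; intros x Hx; now apply circle_mean_derive.
- intros x _; apply circle_mean_continuous.
- unfold I, G in E; rewrite !clamp_id in E by lra; lra.
Qed.

Lemma ccirc_scaled (s : R) : (s0 <= s <= s1)%R -> ccirc (fun b => H (RtoC s * b)).
Proof.
intros Hss b Hb P HP.
assert (Hin : forall b, Cmod b = 1%R -> cannulus s0 s1 (RtoC s * b)).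
{ intros x Hx; unfold cannulus; rewrite Cmod_mult, Cmod_R, Hx, Rabs_pos_eq; lra. }
assert (HP' := Hc _ (Hin b Hb) P HP); unfold filtermap, within in *.
assert (HL : filterlim (fun w : C => RtoC s * w) (locally b) (locally (RtoC s * b))).
{ apply filterlim_Cmult; [apply filterlim_Cconst|apply filterlim_C_id]. }
specialize (HL _ HP'); unfold filtermap in HL.
revert HL; apply filter_imp; intros w Hw Hw1; apply Hw, Hin, Hw1.
Qed.

End CircleMean.

(** The case [s0 = 0] is included: the inner circle then degenerates to the center, which is how
    [disk_mean] reaches the value at 0. The imaginary part is handled as the real part of
    [- Ci * H]. *)
Lemma circle_mean_const (H : C -> C) (s0 s1 : R) : (0 <= s0)%R -> (s0 < s1)%R ->
  holo_on (annulus s0 s1) H -> cont_on (cannulus s0 s1) H ->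
  circle_int (fun b => H (RtoC s0 * b)) = circle_int (fun b => H (RtoC s1 * b)).
Proof.
intros Hs0 Hs Hh Hc.
assert (Hsc : forall s, (s0 <= s <= s1)%R -> ccirc (fun b => H (RtoC s * b)))
  by (intros s Hss; now apply (ccirc_scaled H s0 s1)).
rewrite !circle_int_pair by (apply Hsc; lra).
apply injective_projections; simpl; f_equal.
- now apply RInt_circle_Re_const.
- assert (E : forall x : C, Im x = Re (- Ci * x)) by (intros x; destruct x; simpl; ring).
  rewrite (RInt_eq (fun t => Im (H (RtoC s0 * eit t)))
    (fun t => Re (- Ci * H (RtoC s0 * eit t)))) by (intros; apply E).
  rewrite (RInt_eq (fun t => Im (H (RtoC s1 * eit t)))
    (fun t => Re (- Ci * H (RtoC s1 * eit t)))) by (intros; apply E).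
  apply (RInt_circle_Re_const (fun w => - Ci * H w)); auto.
  + apply holo_on_mult; [apply holo_on_const|exact Hh].
  + intros w Hw; apply filterlim_Cmult; [apply filterlim_Cconst|now apply Hc].
Qed.

Lemma cont_on_of_holo_on (U D : C -> Prop) (f : C -> C) :
  holo_on U f -> (forall w, D w -> U w) -> cont_on D f.
Proof.
intros Hf HD w Hw; apply (filterlim_filter_le_1 (F := locally w)); [apply filter_le_within|].
apply (holo_on_continuous U); auto.
Qed.

Lemma cont_on_subset (D D' : C -> Prop) (f : C -> C) : cont_on D f ->
  (forall w, D' w -> D w) -> cont_on D' f.
Proof.
intros Hf H w Hw; apply (filterlim_filter_le_1 (F := within D (locally w))); [|now apply Hf, H].
intros P; unfold within; apply filter_imp; auto.
Qed.

Lemma cont_on_mult (D : C -> Prop) (f g : C -> C) : cont_on D f -> cont_on D g ->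
  cont_on D (fun w => f w * g w).
Proof. intros Hf Hg w Hw; apply filterlim_Cmult; auto. Qed.

Lemma cont_on_inv (D : C -> Prop) (f : C -> C) : cont_on D f -> (forall w, D w -> f w <> 0) ->
  cont_on D (fun w => / f w).
Proof. intros Hf Hn w Hw; apply filterlim_Cinv; auto. Qed.

Lemma cont_on_ccirc (D : C -> Prop) (f : C -> C) : cont_on D f ->
  (forall w, Cmod w = 1%R -> D w) -> ccirc f.
Proof. intros Hf HD; exact (cont_on_subset _ _ f Hf HD). Qed.

Definition udisk (w : C) : Prop := (Cmod w < 1)%R.
Definition cdisk (w : C) : Prop := (Cmod w <= 1)%R.

Lemma disk_mean (F : C -> C) (k : nat) : holo_on udisk F -> cont_on cdisk F ->
  circle_int (fun b => b ^ k * F b) = 0 ^ k * F 0.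
Proof.
intros Hh Hc.
rewrite (circle_int_ext _ (fun b => (RtoC 1 * b) ^ k * F (RtoC 1 * b)))
  by (intros; now rewrite Cmult_1_l).
rewrite <- (circle_mean_const (fun w => w ^ k * F w) 0 1); try lra.
- rewrite (circle_int_ext _ (fun _ => 0 ^ k * F 0)); [apply circle_int_const|].
  intros z _; now rewrite Cmult_0_l.
- apply holo_on_mult; [apply holo_on_pow|].
  apply (holo_on_subset _ _ _ Hh); intros z [_ Hz]; exact Hz.
- apply cont_on_mult.
  + apply (cont_on_of_holo_on (fun _ => True)); [apply holo_on_pow|auto].
  + apply (cont_on_subset _ _ _ Hc); intros z [_ Hz]; exact Hz.
Qed.

Lemma circle_int_zpow (k : Z) : (k <> 0)%Z -> circle_int (fun z => zpow z k) = 0.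
Proof.
assert (H : forall m, circle_int (fun z => z ^ S m) = 0).
{ intros m; rewrite (circle_int_ext _ (fun z => z ^ S m * 1)) by (intros; ring).
  rewrite (disk_mean (fun _ => 1)); [simpl; ring|apply holo_on_const|].
  intros w _; apply filterlim_Cconst. }
intros Hk; destruct (Z_le_gt_dec 0 k) as [Hk'|Hk'].
- rewrite <- (H (Z.to_nat (k - 1))); apply circle_int_ext; intros z _.
  rewrite <- zpow_of_nat; f_equal; lia.
- rewrite <- Cconj_0, <- (H (Z.to_nat (- k - 1))), <- circle_int_conj by apply ccirc_pow.
  apply circle_int_ext; intros z Hz.
  rewrite <- zpow_of_nat, zpow_conj by exact Hz; f_equal; lia.
Qed.

Lemma ccirc_bounded (u : C -> C) : ccirc u ->
  exists M, (0 < M)%R /\ forall z, Cmod z = 1%R -> (Cmod (u z) <= M)%R.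
Proof.
intros Hu; assert (HP := PI_RGT_0).
destruct (continuity_ab_maj (fun t => Cmod (u (eit t))) 0 (2 * PI)) as [t [Ht _]].
- lra.
- intros t _; apply continuity_pt_filterlim.
  now apply (filterlim_Cmod_comp (fun t => u (eit t))), ccirc_continuous.
- exists (Cmod (u (eit t)) + 1)%R; split; [generalize (Cmod_ge_0 (u (eit t))); lra|].
  intros z Hz; destruct (circle_eit z Hz) as [s [Hs ->]].
  specialize (Ht s Hs); lra.
Qed.

(** * Fourier coefficients *)

Lemma fourier_ext (u v : C -> C) (k : Z) : (forall z, Cmod z = 1%R -> u z = v z) ->
  fourier u k = fourier v k.
Proof. intros H; apply circle_int_ext; intros z Hz; now rewrite H. Qed.

Lemma fourier_plus (u v : C -> C) (k : Z) : ccirc u -> ccirc v ->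
  fourier (fun z => u z + v z) k = fourier u k + fourier v k.
Proof.
intros Hu Hv; unfold fourier.
rewrite (circle_int_ext _ (fun z => zpow z (- k) * u z + zpow z (- k) * v z)) by (intros; ring).
apply circle_int_plus; apply ccirc_mult; auto using ccirc_zpow.
Qed.

Lemma fourier_minus (u v : C -> C) (k : Z) : ccirc u -> ccirc v ->
  fourier (fun z => u z - v z) k = fourier u k - fourier v k.
Proof.
intros Hu Hv; unfold fourier.
rewrite (circle_int_ext _ (fun z => zpow z (- k) * u z - zpow z (- k) * v z)) by (intros; ring).
apply circle_int_minus; apply ccirc_mult; auto using ccirc_zpow.
Qed.

Lemma fourier_scal (c : C) (u : C -> C) (k : Z) : ccirc u ->
  fourier (fun z => c * u z) k = c * fourier u k.
Proof.
intros Hu; unfold fourier.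
rewrite (circle_int_ext _ (fun z => c * (zpow z (- k) * u z))) by (intros; ring).
apply circle_int_scal; apply ccirc_mult; auto using ccirc_zpow.
Qed.

Lemma fourier_zpow_mult (u : C -> C) (j k : Z) :
  fourier (fun z => zpow z j * u z) k = fourier u (k - j).
Proof.
apply circle_int_ext; intros z Hz; rewrite Cmult_assoc, <- zpow_add by now apply circle_neq_0.
replace (- (k - j))%Z with (- k + j)%Z by lia; reflexivity.
Qed.

Lemma fourier_0 (u : C -> C) : fourier u 0 = circle_int u.
Proof. apply circle_int_ext; intros z _; simpl; ring. Qed.

Lemma fourier_conj (u : C -> C) (k : Z) : ccirc u ->
  fourier (fun z => Cconj (u z)) k = Cconj (fourier u (- k)).
Proof.
intros Hu; unfold fourier.
rewrite <- circle_int_conj by (apply ccirc_mult; auto using ccirc_zpow).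
apply circle_int_ext; intros z Hz; rewrite Z.opp_involutive.
now rewrite Cmult_conj, zpow_conj.
Qed.

Lemma fourier_zpow (j k : Z) :
  fourier (fun z => zpow z j) k = if Z.eq_dec k j then 1 else 0.
Proof.
unfold fourier.
rewrite (circle_int_ext _ (fun z => zpow z (j - k))).
2:{ intros z Hz; rewrite <- zpow_add by now apply circle_neq_0. f_equal; lia. }
destruct (Z.eq_dec k j) as [->|H].
- rewrite Z.sub_diag, (circle_int_ext _ (fun _ => 1)) by reflexivity; apply circle_int_const.
- apply circle_int_zpow; lia.
Qed.

(** * Uniqueness of Fourier coefficients *)

Lemma RInt_ge_const (f : R -> R) (a b c : R) : (a <= b)%R -> ex_RInt f a b ->
  (forall t, (a < t < b)%R -> (c <= f t)%R) -> ((b - a) * c <= RInt f a b)%R.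
Proof.
intros Hab Hf Hc.
assert (E : RInt (fun _ => c) a b = ((b - a) * c)%R) by apply (RInt_const (V := R_CompleteNormedModule)).
rewrite <- E; apply RInt_le; auto.
apply (ex_RInt_const (V := R_NormedModule)).
Qed.

(* The powers of the trigonometric polynomial [q = (1 + cos (t - t0)) / (1 + c0)]
   concentrate at the point where [u] would be non-zero. *)
Lemma fourier_eq_0 (u : C -> C) : ccirc u -> (forall k, fourier u k = 0) ->
  forall z, Cmod z = 1%R -> u z = 0.
Proof.
intros Hu Hk b0 Hb0.
destruct (classic (u b0 = 0)) as [|Hnz]; [assumption|exfalso].
assert (HP := PI_RGT_0); assert (HP3 := PI2_1).
(* The factor [Cconj (u b0)] rotates the value at [b0] to the positive number [|u b0|^2], so that
   real parts can be compared. *)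
set (v := fun z => Cconj (u b0) * u z).
assert (Hv : ccirc v) by (apply ccirc_mult; [apply ccirc_const|assumption]).
set (eta := (Cmod (u b0) ^ 2 / 2)%R).
assert (Heta : (0 < eta)%R).
{ unfold eta; assert (0 < Cmod (u b0) ^ 2)%R; [|lra].
  apply pow_lt; now apply Cmod_gt_0. }
assert (Hvb : v b0 = RtoC (2 * eta)).
{ unfold v; rewrite Cmult_comm, <- Cmod2_conj; f_equal; unfold eta; field. }
assert (Hnear : exists d, (0 < d < 1)%R /\
  forall z, Cmod z = 1%R -> (Cmod (z - b0) < d)%R -> (eta <= Re (v z))%R).
{ destruct (proj1 (locally_Cmod _ _) (proj1 (filterlim_Cmod _ _) (Hv b0 Hb0) eta Heta))
    as [d [Hd H]].
  exists (Rmin d (1/2)); split.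
  - split; [apply Rmin_pos; lra|]. eapply Rle_lt_trans; [apply Rmin_r|lra].
  - intros z Hz Hzd.
    assert (H1 : (Cmod (v z - v b0) < eta)%R).
    { apply H; [|exact Hz]. eapply Rlt_le_trans; [exact Hzd|apply Rmin_l]. }
    assert (H2 := re_le_Cmod (v z - v b0)).
    rewrite Re_Cminus in H2.
    assert (E : Re (v b0) = (2 * eta)%R) by (rewrite Hvb; reflexivity).
    rewrite E in H2.
    assert (H3 : (Rabs (Re (v z) - 2 * eta) < eta)%R) by (eapply Rle_lt_trans; [exact H2|exact H1]).
    apply Rabs_def2 in H3; lra. }
destruct Hnear as [d [Hd Hnear]].
set (c := fun z => Re (z * Cconj b0)).
assert (Hc1 : forall z, Cmod z = 1%R -> (-1 <= c z <= 1)%R).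
{ intros z Hz; apply Rabs_le_between.
  eapply Rle_trans; [apply re_le_Cmod|]. rewrite Cmod_mult, Cmod_conj, Hz, Hb0; lra. }
(* On the circle [|z - b0|^2 = 2 - 2 c z], so [c z > c0] says exactly that the chord from [b0] to
   [z] is shorter than [d]. *)
set (c0 := (1 - d ^ 2 / 2)%R).
assert (Hc0 : (1 / 2 < c0 < 1)%R) by (unfold c0; nra).
assert (Hcn : forall z, Cmod z = 1%R -> (c0 < c z)%R -> (eta <= Re (v z))%R).
{ intros z Hz Hcz; apply Hnear; [exact Hz|].
  assert (E : (Cmod (z - b0) ^ 2 = 2 - 2 * c z)%R).
  { assert (E1 := Cmod2_alt z); assert (E2 := Cmod2_alt b0).
    rewrite Hz in E1; rewrite Hb0 in E2.
    rewrite Cmod2_alt; unfold c; destruct z, b0; simpl in *; lra. }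
  assert (0 <= Cmod (z - b0))%R by apply Cmod_ge_0.
  unfold c0 in Hcz; nra. }
(* Written with the frequencies -1, 0 and 1: multiplying by [q] then only shifts and combines
   Fourier coefficients, so all those of [v * q ^ N] remain zero. *)
set (q := fun z => RtoC (/ (1 + c0)) + RtoC (/ (1 + c0)) * Cconj b0 / 2 * zpow z 1
  + RtoC (/ (1 + c0)) * b0 / 2 * zpow z (-1)).
assert (Hq : forall z, Cmod z = 1%R -> q z = RtoC ((1 + c z) / (1 + c0))).
{ intros z Hz. unfold q.
  assert (E1 : zpow z 1 = z) by apply Cpow_1_r.
  assert (E2 : zpow z (-1) = Cconj z).
  { rewrite circle_conj by exact Hz; simpl; now rewrite Cmult_1_r. }
  rewrite E1, E2.
  unfold c, Rdiv; rewrite RtoC_mult, RtoC_plus, re_alt, Cmult_conj, Cconj_conj. field. 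
}
assert (Hqc : ccirc q).
{ unfold q; repeat apply ccirc_plus; try apply ccirc_const;
  apply ccirc_mult; try apply ccirc_const; apply ccirc_zpow. }
assert (Hq0 : forall N, ccirc (fun z => v z * q z ^ N) /\
   forall k, fourier (fun z => v z * q z ^ N) k = 0).
{ induction N as [|N [IH1 IH2]].
  - assert (E : forall z, v z = v z * q z ^ 0) by (intros; simpl; ring).
    split; [now apply (ccirc_ext v)|].
    intros k; rewrite (fourier_ext _ v) by (intros; now rewrite <- E).
    unfold v; rewrite fourier_scal, Hk by exact Hu; ring.
  - set (w := fun z => v z * q z ^ N) in *.
    set (w' := fun z => RtoC (/ (1 + c0)) * w z
      + ((RtoC (/ (1 + c0)) * Cconj b0 / 2) * (zpow z 1 * w z)
      + (RtoC (/ (1 + c0)) * b0 / 2) * (zpow z (-1) * w z))).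
    assert (E : forall z, w' z = v z * q z ^ S N).
    { intros z; unfold w', w, q; rewrite Cpow_S; ring. }
    assert (Hz1 : ccirc (fun z => zpow z 1 * w z)) by (apply ccirc_mult; auto using ccirc_zpow).
    assert (Hz2 : ccirc (fun z => zpow z (-1) * w z)) by (apply ccirc_mult; auto using ccirc_zpow).
    assert (Hs : forall c f, ccirc f -> ccirc (fun z => c * f z))
      by (intros; apply ccirc_mult; auto using ccirc_const).
    split.
    + apply (ccirc_ext w'); [intros; apply E|].
      apply ccirc_plus; [|apply ccirc_plus]; apply Hs; assumption.
    + intros k; rewrite (fourier_ext _ w') by (intros; now rewrite E).
      unfold w'; rewrite !fourier_plus, !fourier_scal, !fourier_zpow_mult, !IH2;
        auto using ccirc_plus; ring. }
destruct (ccirc_bounded v Hv) as [M [HM0 HM]].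
destruct (circle_eit b0 Hb0) as [t0 [Ht0 Eb0]].
(* Strictly between [c0] and 1, so that [q] is at least [q1 > 1] on a whole arc next to [t0]. *)
set (c1 := ((1 + c0) / 2)%R).
assert (Hcon : continuity_pt (fun t => c (eit t)) t0).
{ apply continuity_pt_filterlim, (filterlim_Re (fun t => eit t * Cconj b0)).
  apply filterlim_Cmult; [apply continuous_eit|apply filterlim_const]. }
assert (Hct0 : c (eit t0) = 1%R).
{ unfold c; rewrite <- Eb0, <- Cmod2_conj, Hb0; simpl; ring. }
assert (Hint : exists a b, (0 <= a)%R /\ (a < b)%R /\ (b <= 2 * PI)%R /\
   forall t, (a < t < b)%R -> (c1 <= c (eit t))%R).
{ destruct (Hcon (1 - c1)%R) as [e [He H]]; [unfold c1; lra|].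
  assert (Hd' : exists d', (0 < d' < 1)%R /\ (d' < e)%R).
  { exists (Rmin e 1 / 2)%R.
    assert (0 < Rmin e 1)%R by (apply Rmin_pos; lra).
    generalize (Rmin_l e 1) (Rmin_r e 1); lra. }
  destruct Hd' as [d' [Hd1 Hd2]].
  assert (Hn : forall t, (Rabs (t - t0) < e)%R -> (c1 <= c (eit t))%R).
  { intros t Ht. destruct (Req_dec t t0) as [->|Hne]; [rewrite Hct0; unfold c1; lra|].
    assert (H1 : (Rabs (c (eit t) - c (eit t0)) < 1 - c1)%R).
    { apply (H t); split; [|exact Ht]. split; [exact I|now apply not_eq_sym]. }
    rewrite Hct0 in H1; apply Rabs_def2 in H1; lra. }
  (* The arc is taken on one side of [t0] only, chosen so that it stays inside [[0, 2 pi]]. *)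
  destruct (Rle_dec t0 PI) as [Hpi|Hpi].
  - exists t0, (t0 + d')%R; repeat split; try lra.
    intros t Ht; apply Hn; rewrite Rabs_pos_eq; lra.
  - exists (t0 - d')%R, t0; repeat split; try lra.
    intros t Ht; apply Hn; rewrite Rabs_left; lra. }
destruct Hint as [a [b [Ha [Hab [Hb Hint]]]]].
set (q1 := ((1 + c1) / (1 + c0))%R).
assert (Hq1 : (1 < q1)%R).
{ unfold q1, c1; apply Rmult_lt_reg_r with (1 + c0)%R; [lra|].
  unfold Rdiv; rewrite Rmult_assoc, Rinv_l by lra; lra. }
set (g := fun (N : nat) (t : R) => Re (v (eit t) * q (eit t) ^ N)).
assert (Hg : forall N t, g N t = (Re (v (eit t)) * ((1 + c (eit t)) / (1 + c0)) ^ N)%R).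
{ intros N t; unfold g; rewrite Hq by apply Cmod_eit.
  rewrite <- RtoC_pow. unfold Re; simpl; ring. }
assert (Hdiv : forall x, (-1 <= x)%R -> (0 <= (1 + x) / (1 + c0))%R).
{ intros x Hx; apply Rmult_le_pos; [lra|]. apply Rlt_le, Rinv_0_lt_compat; lra. }
(* Where [q > 1] the integrand is nonnegative; elsewhere [0 <= q <= 1], so no power of [q] pushes it
   below [- M]. *)
assert (Hg1 : forall N t, (- M <= g N t)%R).
{ intros N t; rewrite Hg.
  destruct (Hc1 _ (Cmod_eit t)) as [C1 C2].
  assert (Hp := pow_le _ N (Hdiv _ C1)).
  destruct (Rlt_dec c0 (c (eit t))) as [Hlt|Hlt].
  - assert (eta <= Re (v (eit t)))%R by (apply Hcn; [apply Cmod_eit|exact Hlt]).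
    assert (0 <= Re (v (eit t)) * ((1 + c (eit t)) / (1 + c0)) ^ N)%R; [|lra].
    apply Rmult_le_pos; lra.
  - assert (Hp1 : (((1 + c (eit t)) / (1 + c0)) ^ N <= 1)%R).
    { apply Rle_trans with (1 ^ N)%R; [apply pow_incr|rewrite pow1; lra]; split; [now apply Hdiv|].
      apply Rmult_le_reg_r with (1 + c0)%R; [lra|].
      unfold Rdiv; rewrite Rmult_assoc, Rinv_l by lra; lra. }
    assert (Hr : (Rabs (Re (v (eit t))) <= M)%R).
    { eapply Rle_trans; [apply re_le_Cmod|apply HM, Cmod_eit]. }
    apply Rabs_le_between in Hr; nra. }
assert (Hg2 : forall N t, (a < t < b)%R -> (eta * q1 ^ N <= g N t)%R).
{ intros N t Ht; rewrite Hg; specialize (Hint t Ht).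
  apply Rmult_le_compat; [lra|apply pow_le; lra| |].
  - apply Hcn; [apply Cmod_eit|unfold c1 in Hint; lra].
  - apply pow_incr; split; [lra|]. unfold q1; apply Rmult_le_compat_r; [|lra].
    apply Rlt_le, Rinv_0_lt_compat; lra. }
assert (Hex : forall N x y, ex_RInt (g N) x y).
{ intros N x y; apply (ccirc_RInt_Re (fun z => v z * q z ^ N)), Hq0. }
assert (Hzero : forall N, RInt (g N) 0 (2 * PI) = 0%R).
{ intros N. destruct (Hq0 N) as [H1 H2]. specialize (H2 0%Z).
  rewrite fourier_0, circle_int_pair in H2 by exact H1.
  apply (f_equal fst) in H2; simpl in H2.
  apply Rmult_integral in H2; destruct H2 as [H2|H2]; [|exact H2].
  exfalso; revert H2; apply Rinv_neq_0_compat; lra. }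
(* The total is zero while the rest of the circle loses at most [2 pi M], which bounds the gain on
   the arc uniformly in [N]; but [q1 ^ N] is unbounded. *)
assert (Hfin : forall N, ((b - a) * (eta * q1 ^ N) <= 2 * PI * M)%R).
{ intros N; specialize (Hzero N).
  assert (E : (RInt (g N) 0 a + (RInt (g N) a b + RInt (g N) b (2 * PI)) = 0)%R).
  { transitivity (RInt (g N) 0 (2 * PI)); [|exact Hzero].
    assert (E1 : (RInt (g N) a b + RInt (g N) b (2 * PI))%R = RInt (g N) a (2 * PI))
      by (apply (RInt_Chasles (V := R_CompleteNormedModule)); apply Hex).
    rewrite E1; apply (RInt_Chasles (V := R_CompleteNormedModule)); apply Hex. }
  assert (B1 := RInt_ge_const (g N) 0 a (- M) Ha (Hex _ _ _) (fun t _ => Hg1 N t)).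
  assert (B2 := RInt_ge_const (g N) a b _ (Rlt_le _ _ Hab) (Hex _ _ _) (Hg2 N)).
  assert (B3 := RInt_ge_const (g N) b (2 * PI) (- M) Hb (Hex _ _ _) (fun t _ => Hg1 N t)).
  nra. }
destruct (Pow_x_infinity q1) with (b := (2 * PI * M / ((b - a) * eta) + 1)%R) as [N HN].
{ rewrite Rabs_pos_eq; lra. }
specialize (HN N (le_n N)); rewrite Rabs_pos_eq in HN by (apply pow_le; lra).
specialize (Hfin N).
assert (Hpos : (0 < (b - a) * eta)%R) by (apply Rmult_lt_0_compat; lra).
assert ((2 * PI * M / ((b - a) * eta) + 1) * ((b - a) * eta) <= q1 ^ N * ((b - a) * eta))%R
  by (apply Rmult_le_compat_r; lra).
assert (E : (2 * PI * M / ((b - a) * eta) * ((b - a) * eta) = 2 * PI * M)%R)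
  by (field; split; lra).
nra.
Qed.

Lemma fourier_inj (u v : C -> C) : ccirc u -> ccirc v ->
  (forall k, fourier u k = fourier v k) -> forall z, Cmod z = 1%R -> u z = v z.
Proof.
intros Hu Hv H z Hz.
assert (E : u z - v z = 0).
{ apply (fourier_eq_0 (fun z => u z - v z)); auto using ccirc_minus.
  intros k; rewrite fourier_minus, H by assumption; ring. }
replace (u z) with ((u z - v z) + v z) by ring. rewrite E; ring.
Qed.

(** * Absolutely convergent Fourier series *)

Definition geom_le (a : Z -> C) (K r : R) : Prop :=
  (0 < r < 1)%R /\ forall k, (Cmod (a k) <= K * r ^ Z.abs_nat k)%R.

Definition expdec (a : Z -> C) : Prop := exists K r, geom_le a K r.

(** Summation over all integers as one series over the naturals: [k] and [- k - 1] together meet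
    every integer once. *)
Definition zsum (a : Z -> C) : C :=
  Csum (fun k => a (Z.of_nat k) + a (- Z.of_nat k - 1)%Z).

Lemma geom_le_nonneg (a : Z -> C) (K r : R) : geom_le a K r -> (0 <= K)%R.
Proof.
intros [Hr H]; specialize (H 0%Z); simpl in H; rewrite Rmult_1_r in H.
eapply Rle_trans; [apply Cmod_ge_0|exact H].
Qed.

Lemma pow_le_pow_lt1 (r : R) (m n : nat) : (0 <= r <= 1)%R -> (m <= n)%nat -> (r ^ n <= r ^ m)%R.
Proof.
intros Hr Hmn; replace n with (m + (n - m))%nat by lia; rewrite pow_add.
rewrite <- (Rmult_1_r (r ^ m)) at 2.
apply Rmult_le_compat_l; [now apply pow_le|].
rewrite <- (pow1 (n - m)); now apply pow_incr.
Qed.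

Lemma geom_le_weaken (a : Z -> C) (K r K' r' : R) :
  geom_le a K r -> (K <= K')%R -> (r <= r' < 1)%R -> geom_le a K' r'.
Proof.
intros H HK Hr; assert (H0 := geom_le_nonneg _ _ _ H); destruct H as [Hr0 H].
split; [lra|]; intros k; eapply Rle_trans; [apply H|].
apply Rmult_le_compat; [exact H0|apply pow_le; lra|exact HK|].
apply pow_incr; lra.
Qed.

Lemma geom_le_pair_dominated (a : Z -> C) (K r : R) : geom_le a K r ->
  dominated (fun k => a (Z.of_nat k) + a (- Z.of_nat k - 1)%Z) (fun k => 2 * K * r ^ k)%R.
Proof.
intros H; assert (H0 := geom_le_nonneg _ _ _ H); destruct H as [Hr H].
split; [apply ex_series_geom_scal; lra|].
intros k; eapply Rle_trans; [apply Cmod_triangle|].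
assert (H1 := H (Z.of_nat k)); assert (H2 := H (- Z.of_nat k - 1)%Z).
rewrite Zabs2Nat.id in H1.
replace (Z.abs_nat (- Z.of_nat k - 1)) with (S k) in H2 by lia.
assert (H3 : (r ^ S k <= r ^ k)%R) by (apply pow_le_pow_lt1; lra || lia).
assert (K * r ^ S k <= K * r ^ k)%R by now apply Rmult_le_compat_l.
lra.
Qed.

Lemma zsum_ext (a b : Z -> C) : (forall k, a k = b k) -> zsum a = zsum b.
Proof. intros H; apply Csum_ext; intros k; now rewrite !H. Qed.

Lemma zsum_0 (a : Z -> C) : (forall k, a k = 0) -> zsum a = 0.
Proof.
intros H; unfold zsum; rewrite <- Csum_0; apply Csum_ext; intros k; rewrite !H; ring.
Qed.

Lemma Csum_single (u : nat -> C) (m : nat) : (forall k, k <> m -> u k = 0) -> Csum u = u m.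
Proof.
intros H; apply is_series_Csum, is_series_Cmod; intros eps He; exists m; intros N HN.
assert (E1 : forall M, (M < m)%nat -> sum_n u M = RtoC 0 :> C).
{ induction M as [|M IH]; intros HM; [rewrite sum_n_0; apply H; lia|].
  rewrite sum_n_S, IH, H by lia; ring. }
assert (E2 : sum_n u N = u m :> C).
{ induction N as [|N IH].
  - assert (m = 0%nat) by lia; subst; apply sum_n_0.
  - rewrite sum_n_S. destruct (Nat.eq_dec m (S N)) as [->|Hne].
    + rewrite E1 by lia; ring.
    + rewrite IH, (H (S N)) by lia; ring. }
rewrite E2; unfold Cminus; rewrite Cplus_opp_r, Cmod_0; exact He.
Qed.

Lemma zsum_single (a : Z -> C) (m : Z) : (forall k, k <> m -> a k = 0) -> zsum a = a m.
Proof.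
intros H; unfold zsum.
destruct (Z_le_gt_dec 0 m) as [Hm|Hm].
- rewrite (Csum_single _ (Z.to_nat m)).
  + rewrite Z2Nat.id by lia. rewrite (H (- m - 1)%Z) by lia; ring.
  + intros k Hk; rewrite !H by lia; ring.
- rewrite (Csum_single _ (Z.to_nat (- m - 1))).
  + rewrite Z2Nat.id by lia. rewrite (H (- m - 1)%Z) by lia.
    replace (- (- m - 1) - 1)%Z with m by lia; ring.
  + intros k Hk; rewrite !H by lia; ring.
Qed.

Lemma zsum_bound (a : Z -> C) (K r : R) : geom_le a K r -> (Cmod (zsum a) <= 2 * K / (1 - r))%R.
Proof.
intros H; assert (Hr := proj1 H).
eapply Rle_trans; [apply Csum_bound, (geom_le_pair_dominated _ _ _ H)|].
rewrite (Series_scal_l (2 * K) (fun k => r ^ k)%R), Series_geom by (rewrite Rabs_pos_eq; lra).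
apply Rle_refl.
Qed.

Definition synth (a : Z -> C) (z : C) : C := zsum (fun k => a k * zpow z k).

Lemma geom_le_synth (a : Z -> C) (K r : R) (z : C) : geom_le a K r -> Cmod z = 1%R ->
  geom_le (fun k => a k * zpow z k) K r.
Proof.
intros [Hr H] Hz; split; [exact Hr|]; intros k.
rewrite Cmod_mult, Cmod_zpow_circle, Rmult_1_r by exact Hz; apply H.
Qed.

Lemma ccirc_synth (a : Z -> C) : expdec a -> ccirc (synth a).
Proof.
intros [K [r H]].
apply (ccirc_Csum (fun k z => a (Z.of_nat k) * zpow z (Z.of_nat k)
  + a (- Z.of_nat k - 1)%Z * zpow z (- Z.of_nat k - 1)) (fun k => 2 * K * r ^ k)%R).
- intros k; apply ccirc_plus; apply ccirc_mult; auto using ccirc_const, ccirc_zpow.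
- intros z Hz; now apply (geom_le_pair_dominated _ _ _ (geom_le_synth _ _ _ _ H Hz)).
Qed.

Lemma circle_int_synth_mult (a : Z -> C) (v : C -> C) : expdec a -> ccirc v ->
  circle_int (fun z => synth a z * v z) = zsum (fun k => a k * fourier v (- k)).
Proof.
intros [K [r H]] Hv.
destruct (ccirc_bounded v Hv) as [M [HM0 HM]].
set (e := fun (k : nat) z => a (Z.of_nat k) * zpow z (Z.of_nat k)
  + a (- Z.of_nat k - 1)%Z * zpow z (- Z.of_nat k - 1)).
assert (Hd : forall z, Cmod z = 1%R -> dominated (fun k => e k z) (fun k => 2 * K * r ^ k)%R)
  by (intros z Hz; apply (geom_le_pair_dominated _ _ _ (geom_le_synth _ _ _ _ H Hz))).
rewrite (circle_int_ext _ (fun z => Csum (fun k => v z * e k z))).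
2:{ intros z Hz; rewrite (Csum_scal (v z) _ _ (Hd z Hz)); unfold synth, zsum; fold (e).
    rewrite Cmult_comm; reflexivity. }
destruct (circle_int_Csum (fun k z => v z * e k z) (fun k => M * (2 * K * r ^ k))%R) as [_ E].
- intros k; apply ccirc_mult; [exact Hv|].
  apply ccirc_plus; apply ccirc_mult; auto using ccirc_const, ccirc_zpow.
- intros z Hz. split.
  + apply (ex_series_scal (V := R_NormedModule)), (Hd 1), Cmod_1.
  + intros k; rewrite Cmod_mult; apply Rmult_le_compat; try apply Cmod_ge_0; auto.
    now apply Hd.
- rewrite E; apply Csum_ext; intros k; unfold e.
  rewrite (circle_int_ext _ (fun z => a (Z.of_nat k) * (zpow z (- - Z.of_nat k) * v z)
    + a (- Z.of_nat k - 1)%Z * (zpow z (- - (- Z.of_nat k - 1)) * v z))).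
  2:{ intros z _; rewrite !Z.opp_involutive; ring. }
  assert (Hz : forall i, ccirc (fun z => zpow z i * v z))
    by (intros i; exact (ccirc_mult _ _ (ccirc_zpow i) Hv)).
  rewrite circle_int_plus by (apply ccirc_mult; [apply ccirc_const|apply Hz]).
  rewrite !circle_int_scal by apply Hz; reflexivity.
Qed.

Lemma fourier_synth (a : Z -> C) (j : Z) : expdec a -> fourier (synth a) j = a j.
Proof.
intros Ha; unfold fourier.
rewrite (circle_int_ext _ (fun z => synth a z * zpow z (- j))) by (intros; ring).
rewrite circle_int_synth_mult by auto using ccirc_zpow.
rewrite (zsum_single _ j).
- rewrite fourier_zpow; destruct (Z.eq_dec (- j) (- j)); [ring|lia].
- intros k Hk; rewrite fourier_zpow; destruct (Z.eq_dec (- k) (- j)); [lia|ring].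
Qed.

(** The class in which the argument takes place: by [wien_of_holo] it contains the functions
    holomorphic on an annulus around the circle, and sums, products, conjugates and frequency
    truncations stay in it. *)
Definition wien (u : C -> C) : Prop := ccirc u /\ expdec (fourier u).

Lemma wien_ext (u v : C -> C) : (forall z, Cmod z = 1%R -> u z = v z) -> wien u -> wien v.
Proof.
intros H [Hu [K [r [Hr He]]]]; split; [now apply (ccirc_ext u)|].
exists K, r; split; [exact Hr|]; intros k; rewrite <- (fourier_ext u v k H); apply He.
Qed.

Lemma wien_synth (a : Z -> C) : expdec a -> wien (synth a).
Proof.
intros Ha; split; [now apply ccirc_synth|].
assert (Ha' := Ha); destruct Ha as [K [r [Hr H]]]; exists K, r; split; [exact Hr|].
intros k; rewrite fourier_synth by exact Ha'; apply H.
Qed.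

Lemma wien_inversion (u : C -> C) (z : C) : wien u -> Cmod z = 1%R -> u z = synth (fourier u) z.
Proof.
intros [Hu He]; revert z; apply fourier_inj; auto using ccirc_synth.
intros k; now rewrite fourier_synth.
Qed.

Lemma circle_int_mult (u v : C -> C) : wien u -> ccirc v ->
  circle_int (fun z => u z * v z) = zsum (fun k => fourier u k * fourier v (- k)).
Proof.
intros Hu Hv; rewrite <- circle_int_synth_mult by (apply Hu || exact Hv).
apply circle_int_ext; intros z Hz; now rewrite (wien_inversion u z Hu Hz).
Qed.

Lemma fourier_mult (u v : C -> C) (j : Z) : wien u -> ccirc v ->
  fourier (fun z => u z * v z) j = zsum (fun k => fourier u k * fourier v (j - k)).
Proof.
intros Hu Hv; unfold fourier at 1.
rewrite (circle_int_ext _ (fun z => u z * (zpow z (- j) * v z))) by (intros; ring).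
rewrite circle_int_mult by (assumption || (apply ccirc_mult; auto using ccirc_zpow)).
apply zsum_ext; intros k; rewrite fourier_zpow_mult; do 2 f_equal; lia.
Qed.

Lemma wien_plus (u v : C -> C) : wien u -> wien v -> wien (fun z => u z + v z).
Proof.
intros [Hu [K [r H]]] [Hv [K' [r' H']]]; split; [now apply ccirc_plus|].
set (s := Rmax r r'); assert (H1 := Rmax_l r r'); assert (H2 := Rmax_r r r').
assert (H0 := geom_le_nonneg _ _ _ H); assert (H0' := geom_le_nonneg _ _ _ H').
assert (Hs : (s < 1)%R) by (apply Rmax_lub_lt; [apply H|apply H']).
assert (Hr := proj1 H); assert (Hr' := proj1 H').
apply (geom_le_weaken _ _ _ K s) in H; [|lra|split; assumption].
apply (geom_le_weaken _ _ _ K' s) in H'; [|lra|split; assumption].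
exists (K + K')%R, s; split; [apply H|].
intros k; rewrite fourier_plus by assumption.
eapply Rle_trans; [apply Cmod_triangle|]; rewrite Rmult_plus_distr_r.
apply Rplus_le_compat; [apply H|apply H'].
Qed.

Lemma wien_scal (c : C) (u : C -> C) : wien u -> wien (fun z => c * u z).
Proof.
intros [Hu [K [r [Hr H]]]]; split; [apply ccirc_mult; auto using ccirc_const|].
exists (Cmod c * K)%R, r; split; [exact Hr|].
intros k; rewrite fourier_scal, Cmod_mult, Rmult_assoc by exact Hu.
apply Rmult_le_compat_l; [apply Cmod_ge_0|apply H].
Qed.

Lemma wien_zpow (k : Z) : wien (fun z => zpow z k).
Proof.
split; [apply ccirc_zpow|].
(* The constant is tuned so that the bound equals 1 at the only nonzero coefficient. *)
exists (2 ^ Z.abs_nat k)%R, (1/2)%R; split; [lra|].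
intros j; rewrite fourier_zpow; destruct (Z.eq_dec j k) as [->|_].
- rewrite Cmod_1, <- Rpow_mult_distr; replace (2 * (1 / 2))%R with 1%R by field.
  rewrite pow1; lra.
- rewrite Cmod_0; apply Rmult_le_pos; apply pow_le; lra.
Qed.

Lemma wien_conj (u : C -> C) : wien u -> wien (fun z => Cconj (u z)).
Proof.
intros [Hu [K [r [Hr H]]]]; split; [now apply ccirc_conj|].
exists K, r; split; [exact Hr|]; intros k.
rewrite fourier_conj, Cmod_conj by exact Hu.
replace (Z.abs_nat k) with (Z.abs_nat (- k)) by lia; apply H.
Qed.

(* With [s = sqrt r], [r ^ (|k| + |j - k|) <= s ^ |j| * s ^ |k|]. *)
Lemma wien_mult (u v : C -> C) : wien u -> wien v -> wien (fun z => u z * v z).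
Proof.
intros Hu Hv; split; [apply ccirc_mult; [apply Hu|apply Hv]|].
assert (Hu' := Hu); assert (Hv' := Hv).
destruct Hu as [Hu [K [r H]]]; destruct Hv as [Hv [K' [r' H']]].
assert (H0 := geom_le_nonneg _ _ _ H); assert (H0' := geom_le_nonneg _ _ _ H').
set (t := Rmax r r'); assert (H1 := Rmax_l r r'); assert (H2 := Rmax_r r r').
assert (Ht : (t < 1)%R) by (apply Rmax_lub_lt; [apply H|apply H']).
apply (geom_le_weaken _ _ _ K t) in H; [|lra|split; assumption].
apply (geom_le_weaken _ _ _ K' t) in H'; [|lra|split; assumption].
assert (Ht0 := proj1 H).
set (s := sqrt t).
assert (Hs2 : (s * s = t)%R) by (apply sqrt_sqrt; lra).
assert (Hs0 : (0 < s)%R) by (apply sqrt_lt_R0; lra).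
assert (Hs1 : (s < 1)%R) by nra.
exists (2 * (K * K') / (1 - s))%R, s; split; [lra|]; intros j.
rewrite fourier_mult by assumption.
apply Rle_trans with (2 * (K * K' * s ^ Z.abs_nat j) / (1 - s))%R; [|apply Req_le; field; lra].
apply zsum_bound; split; [lra|]; intros k.
rewrite Cmod_mult.
apply Rle_trans with (K * t ^ Z.abs_nat k * (K' * t ^ Z.abs_nat (j - k)))%R.
{ apply Rmult_le_compat; try apply Cmod_ge_0; [apply H|apply H']. }
replace (K * t ^ Z.abs_nat k * (K' * t ^ Z.abs_nat (j - k)))%R
  with (K * K' * (t ^ Z.abs_nat k * t ^ Z.abs_nat (j - k)))%R by ring.
rewrite (Rmult_assoc (K * K') (s ^ Z.abs_nat j)).
apply Rmult_le_compat_l; [now apply Rmult_le_pos|].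
rewrite <- Hs2, !Rpow_mult_distr, <- !pow_add.
apply pow_le_pow_lt1; [lra|lia].
Qed.

Lemma wien_sum_n (u : nat -> C -> C) (n : nat) : (forall k, wien (u k)) ->
  wien (fun z => sum_n (fun k => u k z) n).
Proof.
intros H; induction n as [|n IH].
- apply (wien_ext (u 0%nat)); [intros; now rewrite sum_n_0|apply H].
- apply (wien_ext (fun z => sum_n (fun k => u k z) n + u (S n) z)).
  + intros; now rewrite sum_n_S.
  + now apply wien_plus.
Qed.

(** * Frequency supports and truncations *)

Definition freq_ge (m : Z) (u : C -> C) : Prop := forall k, (k < m)%Z -> fourier u k = 0.
Definition freq_le (m : Z) (u : C -> C) : Prop := forall k, (m < k)%Z -> fourier u k = 0.

Lemma freq_ge_mult (u v : C -> C) (m l : Z) : wien u -> ccirc v ->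
  freq_ge m u -> freq_ge l v -> freq_ge (m + l) (fun z => u z * v z).
Proof.
intros Hu Hv H1 H2 k Hk; rewrite fourier_mult by assumption; apply zsum_0; intros i.
destruct (Z_lt_ge_dec i m); [rewrite H1 by lia|rewrite (H2 (k - i)%Z) by lia]; ring.
Qed.

Lemma freq_le_mult (u v : C -> C) (m l : Z) : wien u -> ccirc v ->
  freq_le m u -> freq_le l v -> freq_le (m + l) (fun z => u z * v z).
Proof.
intros Hu Hv H1 H2 k Hk; rewrite fourier_mult by assumption; apply zsum_0; intros i.
destruct (Z_lt_ge_dec m i); [rewrite H1 by lia|rewrite (H2 (k - i)%Z) by lia]; ring.
Qed.

Lemma freq_le_conj (u : C -> C) (m : Z) : ccirc u -> freq_ge m u -> freq_le (- m) (fun z => Cconj (u z)).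
Proof.
intros Hu H k Hk; rewrite fourier_conj, H by (exact Hu || lia).
apply Cconj_0.
Qed.

Lemma freq_le_ext (u v : C -> C) (m : Z) : (forall z, Cmod z = 1%R -> u z = v z) ->
  freq_le m u -> freq_le m v.
Proof. intros H Hu k Hk; rewrite <- (fourier_ext u v k H); now apply Hu. Qed.

Definition freq_part (P : Z -> bool) (u : C -> C) : C -> C :=
  synth (fun k => if P k then fourier u k else 0).

Lemma expdec_part (P : Z -> bool) (u : C -> C) : wien u ->
  expdec (fun k => if P k then fourier u k else 0).
Proof.
intros [_ [K [r H]]]; exists K, r; split; [apply H|]; intros k.
destruct (P k); [apply H|]. rewrite Cmod_0; apply Rmult_le_pos.
- now apply geom_le_nonneg in H.
- apply pow_le; destruct H as [H _]; lra.
Qed.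

Lemma wien_part (P : Z -> bool) (u : C -> C) : wien u -> wien (freq_part P u).
Proof. intros Hu; apply wien_synth, expdec_part, Hu. Qed.

Lemma fourier_part (P : Z -> bool) (u : C -> C) (k : Z) : wien u ->
  fourier (freq_part P u) k = if P k then fourier u k else 0.
Proof. intros Hu; unfold freq_part; now rewrite fourier_synth by now apply expdec_part. Qed.

(** * The Cauchy kernel *)

Lemma Csum_geom (q : C) : (Cmod q < 1)%R -> Csum (fun k => q ^ k) = / (1 - q).
Proof.
intros Hq.
assert (Hd : dominated (fun k => q ^ k) (fun k => Cmod q ^ k)%R).
{ split; [apply ex_series_geom; rewrite Rabs_pos_eq by apply Cmod_ge_0; exact Hq|].
  intros k; rewrite Cmod_pow; apply Rle_refl. }
assert (H := is_series_sum_n_minus _ _ 0 (Csum_correct _ (dominated_ex_series _ _ Hd))).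
rewrite sum_n_0 in H; apply is_series_Csum in H; simpl in H.
rewrite (Csum_scal q (fun k => q ^ k) _ Hd) in H.
set (S := Csum (fun k => q ^ k)) in *.
assert (Hn : 1 - q <> 0).
{ intros E. assert (E' : q = 1) by (rewrite <- (Cplus_0_r q), <- E; ring).
  rewrite E', Cmod_1 in Hq; lra. }
assert (E : (1 - q) * S = 1) by (transitivity (S - q * S); [ring|rewrite H; ring]).
transitivity (/ (1 - q) * ((1 - q) * S)); [field; exact Hn|rewrite E; ring].
Qed.

(** On the circle [z / (b - z)] is the sum over [m >= 1] of [z^m b^(-m)], with negative frequencies
    only. *)
Definition cauchy_coeff (z : C) (k : Z) : C := if (k <? 0)%Z then z ^ Z.abs_nat k else 0.

Lemma expdec_cauchy (z : C) : (Cmod z < 1)%R -> expdec (cauchy_coeff z).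
Proof.
intros Hz; exists 1%R, (Rmax (Cmod z) (1/2)).
assert (H1 := Rmax_l (Cmod z) (1/2)); assert (H2 := Rmax_r (Cmod z) (1/2)).
assert (H3 : (Rmax (Cmod z) (1/2) < 1)%R) by (apply Rmax_lub_lt; lra).
split; [lra|]; intros k; unfold cauchy_coeff; rewrite Rmult_1_l.
destruct (k <? 0)%Z.
- rewrite Cmod_pow; apply pow_incr; split; [apply Cmod_ge_0|exact H1].
- rewrite Cmod_0; apply pow_le; lra.
Qed.

Lemma synth_cauchy (z b : C) : (Cmod z < 1)%R -> Cmod b = 1%R ->
  synth (cauchy_coeff z) b = z / (b - z).
Proof.
intros Hz Hb; assert (Hb0 := circle_neq_0 b Hb).
assert (Hq : (Cmod (z / b) < 1)%R) by (rewrite Cmod_div, Hb by exact Hb0; unfold Rdiv; rewrite Rinv_1; lra).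
unfold synth, zsum.
rewrite (Csum_ext _ (fun k => (z / b) * (z / b) ^ k)).
- rewrite (Csum_scal (z / b) _ (fun k => Cmod (z / b) ^ k)%R).
  + rewrite Csum_geom by exact Hq.
    assert (Hn : b - z <> 0).
    { intros E. assert (E' : b = z) by (rewrite <- (Cplus_0_l z), <- E; ring).
      rewrite <- E', Hb in Hz; lra. }
    field; split; assumption.
  + split; [apply ex_series_geom; rewrite Rabs_pos_eq by apply Cmod_ge_0; exact Hq|].
    intros k; rewrite Cmod_pow; apply Rle_refl.
- intros k; unfold cauchy_coeff.
  replace (Z.of_nat k <? 0)%Z with false by (symmetry; apply Z.ltb_ge; lia).
  replace (- Z.of_nat k - 1 <? 0)%Z with true by (symmetry; apply Z.ltb_lt; lia).
  replace (Z.abs_nat (- Z.of_nat k - 1)) with (S k) by lia.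
  replace (- Z.of_nat k - 1)%Z with (- Z.of_nat (S k))%Z by lia.
  rewrite zpow_opp, !zpow_of_nat, !Cpow_S by exact Hb0.
  unfold Cdiv; rewrite Cpow_mult_l, Cpow_inv by exact Hb0.
  field; split; [now apply Cpow_nz|exact Hb0].
Qed.

(** * Functions holomorphic near the circle *)

Lemma eit_lipschitz (x t : R) : (Cmod (eit x - eit t) <= 2 * Rabs (x - t))%R.
Proof.
assert (Hs : (Rabs (sin x - sin t) <= Rabs (x - t))%R).
{ destruct (MVT_gen sin t x cos) as [c [_ E]].
  - intros y _; apply is_derive_sin.
  - intros y _; apply continuity_sin.
  - rewrite E, Rabs_mult; rewrite <- (Rmult_1_l (Rabs (x - t))) at 2.
    apply Rmult_le_compat_r; [apply Rabs_pos|]. apply Rabs_le, COS_bound. }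
assert (Hc : (Rabs (cos x - cos t) <= Rabs (x - t))%R).
{ destruct (MVT_gen cos t x (fun y => - sin y)%R) as [c [_ E]].
  - intros y _; apply is_derive_cos.
  - intros y _; apply continuity_cos.
  - rewrite E, Rabs_mult, Rabs_Ropp; rewrite <- (Rmult_1_l (Rabs (x - t))) at 2.
    apply Rmult_le_compat_r; [apply Rabs_pos|]. apply Rabs_le, SIN_bound. }
eapply Rle_trans; [apply Cmod_le_Re_Im|].
rewrite Re_Cminus, Im_Cminus; simpl; lra.
Qed.

(** Compactness of the interval of angles: each angle [x] has some [t] with [|x - t| < delta t], and
    [delta t] is bounded below by one common [d]. *)
Lemma annulus_of_locally (N : C -> Prop) : (forall z, Cmod z = 1%R -> locally z N) ->
  exists e, (0 < e < 1)%R /\ forall z, annulus (1 - e) (1 + e) z -> N z.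
Proof.
intros H.
(* Of the budget [4 * d], the radial distance uses one part and the angular distance two, because of
   [eit_lipschitz]. *)
assert (Hd : forall t, exists d : posreal, forall w, (Cmod (w - eit t) < 4 * d)%R -> N w).
{ intros t; destruct (proj1 (locally_Cmod _ _) (H _ (Cmod_eit t))) as [e [He Hw]].
  assert (He4 : (0 < e / 4)%R) by lra.
  exists (mkposreal _ He4); intros w Hww; apply Hw; simpl in Hww; lra. }
set (delta := fun t => proj1_sig (constructive_indefinite_description _ (Hd t))).
assert (Hdelta : forall t w, (Cmod (w - eit t) < 4 * delta t)%R -> N w).
{ intros t; exact (proj2_sig (constructive_indefinite_description _ (Hd t))). }
destruct (compactness_value_1d 0 (2 * PI) delta) as [d Hdd].
exists (Rmin d (1/2)).
assert (H1 := Rmin_l d (1/2)); assert (H2 := Rmin_r d (1/2)).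
assert (H3 : (0 < Rmin d (1/2))%R) by (apply Rmin_pos; [apply cond_pos|lra]).
split; [lra|]; intros z [Hz1 Hz2].
destruct (polar z) as [b [Hb Ez]].
destruct (circle_eit b Hb) as [x [Hx Eb]].
destruct (NNPP _ (Hdd x Hx)) as [t [_ [Ht1 Ht2]]].
apply (Hdelta t).
apply Rle_lt_trans with (Cmod (z - eit x) + Cmod (eit x - eit t))%R; [apply Cmod_sub_le|].
assert (L1 := eit_lipschitz x t).
assert (L2 : (Cmod (z - eit x) < d)%R).
{ rewrite Ez, Eb; replace (RtoC (Cmod z) * eit x - eit x) with (RtoC (Cmod z - 1) * eit x)
    by (rewrite RtoC_minus; ring).
  rewrite Cmod_mult, Cmod_eit, Cmod_R, Rmult_1_r; apply Rabs_def1; lra. }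
assert (0 < delta t)%R by apply cond_pos.
lra.
Qed.

Lemma circle_int_radius (f : C -> C) (s0 s1 : R) (k : Z) : (0 < s0)%R -> (s0 < s1)%R ->
  holo_on (annulus s0 s1) f -> cont_on (cannulus s0 s1) f ->
  circle_int (fun b => zpow (RtoC s0 * b) k * f (RtoC s0 * b)) =
  circle_int (fun b => zpow (RtoC s1 * b) k * f (RtoC s1 * b)).
Proof.
intros H0 H1 Hf Hc.
assert (Hn : forall w, (s0 <= Cmod w)%R -> w <> 0) by (intros w Hw ->; rewrite Cmod_0 in Hw; lra).
apply (circle_mean_const (fun w => zpow w k * f w) s0 s1); try lra.
- apply holo_on_mult; [|exact Hf]. apply holo_on_zpow; intros z [Hz _]; apply Hn; lra.
- apply cont_on_mult; [|exact Hc].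
  apply (cont_on_of_holo_on (fun w => w <> 0)); [now apply holo_on_zpow|].
  intros w [Hw _]; now apply Hn.
Qed.

Lemma zpow_scal_bound (s : R) (b : C) (k : Z) : (0 < s)%R -> Cmod b = 1%R ->
  Cmod (zpow (RtoC s * b) k) = (if (0 <=? k)%Z then s ^ Z.abs_nat k else (/ s) ^ Z.abs_nat k)%R.
Proof.
intros Hs Hb.
assert (Hm : Cmod (RtoC s * b) = s) by (rewrite Cmod_mult, Cmod_R, Hb, Rabs_pos_eq; lra).
assert (Hn : RtoC s * b <> 0) by (intros E; rewrite E, Cmod_0 in Hm; lra).
destruct (Z.leb_spec 0 k) as [Hk|Hk].
- destruct (Z_of_nat_complete k Hk) as [m ->].
  now rewrite zpow_of_nat, Cmod_pow, Hm, Zabs2Nat.id.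
- assert (Hm' : (0 <= - k)%Z) by lia.
  destruct (Z_of_nat_complete _ Hm') as [m Em].
  replace k with (- Z.of_nat m)%Z by lia.
  rewrite zpow_opp, zpow_of_nat, Cmod_inv, Cmod_pow, Hm by (assumption || now apply Cpow_nz).
  replace (Z.abs_nat (- Z.of_nat m)) with m by lia. now rewrite pow_inv.
Qed.

(** The coefficient [k] is the circular mean of [w^(-k) f(w)], which may be taken at radius [s1 > 1]
    for [k >= 0] and at [s0 < 1] for [k < 0]. Boundedness of [f] on these circles gives the decay
    rates [1 / s1] and [s0]. *)
Lemma wien_of_holo (f : C -> C) (e : R) : (0 < e < 1)%R ->
  holo_on (annulus (1 - e) (1 + e)) f -> wien f.
Proof.
intros He Hf.
set (s0 := (1 - e / 2)%R); set (s1 := (1 + e / 2)%R).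
assert (Hc : cont_on (cannulus s0 s1) f).
{ apply (cont_on_of_holo_on _ _ _ Hf); unfold cannulus, annulus, s0, s1; intros w Hw; lra. }
assert (Hcc : ccirc f).
{ apply (cont_on_ccirc _ _ Hc); unfold cannulus, s0, s1; intros w Hw; lra. }
assert (Hh : forall a b, (s0 <= a)%R -> (b <= s1)%R -> holo_on (annulus a b) f).
{ intros a b Ha Hb; apply (holo_on_subset _ _ _ Hf); unfold annulus, s0, s1 in *; intros z Hz; lra. }
assert (Hc' : forall a b, (s0 <= a)%R -> (b <= s1)%R -> cont_on (cannulus a b) f).
{ intros a b Ha Hb; apply (cont_on_subset _ _ _ Hc); unfold cannulus, s0, s1 in *; intros z Hz; lra. }
assert (E1 : forall k, fourier f k = circle_int (fun b => zpow (RtoC 1 * b) (- k) * f (RtoC 1 * b))).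
{ intros k; apply circle_int_ext; intros z _; now rewrite Cmult_1_l. }
assert (Hsc : forall s, (s0 <= s <= s1)%R -> ccirc (fun b => f (RtoC s * b))).
{ intros s Hs; apply (ccirc_scaled f s0 s1); unfold s0 in *; auto; lra. }
destruct (ccirc_bounded _ (Hsc s0 ltac:(unfold s0, s1; lra))) as [M0 [HM0 HM0']].
destruct (ccirc_bounded _ (Hsc s1 ltac:(unfold s0, s1; lra))) as [M1 [HM1 HM1']].
assert (Hz : forall s k, (s0 <= s <= s1)%R ->
  ccirc (fun b => zpow (RtoC s * b) k * f (RtoC s * b))).
{ intros s k Hs; apply ccirc_mult; [|now apply Hsc].
  apply (ccirc_scaled (fun w => zpow w k) s0 s1); unfold s0 in *; try lra.
  apply (cont_on_of_holo_on (fun w => w <> 0)); [now apply holo_on_zpow|].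
  intros w [Hw _] ->; rewrite Cmod_0 in Hw; lra. }
split; [exact Hcc|].
set (r := Rmax s0 (/ s1)).
assert (Hs1 : (/ s1 < 1)%R).
{ rewrite <- Rinv_1; apply Rinv_lt_contravar; unfold s1; lra. }
assert (Hs1p : (0 < / s1)%R) by (apply Rinv_0_lt_compat; unfold s1; lra).
assert (Hr1 := Rmax_l s0 (/ s1)); assert (Hr2 := Rmax_r s0 (/ s1)); fold r in Hr1, Hr2.
exists (Rmax M0 M1), r; split.
{ split; [unfold s0 in *; lra|]. apply Rmax_lub_lt; unfold s0 in *; lra. }
intros k.
assert (HMl := Rmax_l M0 M1); assert (HMr := Rmax_r M0 M1).
rewrite E1; destruct (Z.leb_spec 0 k) as [Hk|Hk].
- rewrite (circle_int_radius f 1 s1) by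
    (try (unfold s1; lra); try apply Hh; try apply Hc'; unfold s0, s1; lra).
  apply circle_int_bound; [apply Hz; unfold s0, s1; lra|].
  intros z Hz1; rewrite Cmod_mult, zpow_scal_bound by (unfold s1; lra || exact Hz1).
  replace (Z.abs_nat (- k)) with (Z.abs_nat k) by lia.
  rewrite Rmult_comm; apply Rmult_le_compat; auto using Cmod_ge_0.
  + destruct (Z.leb_spec 0 (- k)); apply pow_le; unfold s1 in *; lra.
  + eapply Rle_trans; [apply HM1', Hz1|exact HMr].
  + destruct (Z.leb_spec 0 (- k)) as [Hk'|Hk'].
    * replace k with 0%Z by lia; simpl; lra.
    * apply pow_incr; lra.
- rewrite <- (circle_int_radius f s0 1) by
    (try (unfold s0; lra); try apply Hh; try apply Hc'; unfold s0, s1; lra).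
  apply circle_int_bound; [apply Hz; unfold s0, s1; lra|].
  intros z Hz1; rewrite Cmod_mult, zpow_scal_bound by (unfold s0; lra || exact Hz1).
  replace (Z.abs_nat (- k)) with (Z.abs_nat k) by lia.
  rewrite Rmult_comm; apply Rmult_le_compat; auto using Cmod_ge_0.
  + destruct (Z.leb_spec 0 (- k)); [|lia]; apply pow_le; unfold s0 in *; lra.
  + eapply Rle_trans; [apply HM0', Hz1|exact HMl].
  + destruct (Z.leb_spec 0 (- k)) as [Hk'|Hk']; [|lia].
    apply pow_incr; unfold s0 in *; lra.
Qed.

(** For [k < 0] the coefficient is the mean of a positive power of [b] times [F], and that product
    vanishes at the center. *)
Lemma disk_fourier (F : C -> C) : holo_on udisk F -> cont_on cdisk F ->
  freq_ge 0 F /\ fourier F 0 = F 0.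
Proof.
intros Hh Hc.
assert (H := fun k => disk_mean F k Hh Hc).
split.
- intros k Hk.
  transitivity (circle_int (fun b => b ^ S (Z.to_nat (- k - 1)) * F b)).
  + apply circle_int_ext; intros z _; rewrite <- zpow_of_nat; f_equal; f_equal; lia.
  + rewrite H, Cpow_S; ring.
- rewrite fourier_0, (circle_int_ext _ (fun b => b ^ 0 * F b)) by (intros; simpl; ring).
  rewrite H; simpl; ring.
Qed.

Lemma fourier_reflect (u : C -> C) (k : Z) : ccirc u ->
  fourier (fun z => u (/ z)) k = fourier u (- k).
Proof.
intros Hu; unfold fourier.
rewrite <- (circle_int_reflect (fun z => zpow z (- - k) * u z))
  by (apply ccirc_mult; auto using ccirc_zpow).
apply circle_int_ext; intros z Hz.
rewrite zpow_inv by now apply circle_neq_0.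
now rewrite !Z.opp_involutive.
Qed.

(** * The Szego function *)

(** Near the circle [phi] has positive real part, so [Clog (phi z)] extends the real logarithm
    holomorphically to an annulus. *)
Lemma wien_log_circle (phi : C -> C) : positive_on_circle phi -> analytic_near_circle phi ->
  wien (log_circle phi).
Proof.
intros Hpos [U [HU [HU1 HU2]]].
assert (Hh : holo_on U phi) by now apply analytic_holo_on.
destruct (annulus_of_locally (fun z => U z /\ (0 < Re (phi z))%R)) as [e [He HN]].
{ intros z Hz; apply filter_and; [apply HU; now apply HU1|].
  destruct (Hpos z Hz) as [r [Hr E]].
  assert (Hc := filterlim_Re _ _ (holo_on_continuous U phi z Hh (HU1 z Hz))).
  apply (Hc (fun r => (0 < r)%R)), open_gt; rewrite E; exact Hr. }
apply (wien_ext (fun z => Clog (phi z))).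
- intros z Hz; destruct (Hpos z Hz) as [r [Hr E]]; unfold log_circle; rewrite E.
  now apply Clog_pos.
- apply (wien_of_holo _ e He).
  apply (holo_on_comp _ (fun z => (0 < Re z)%R)); [apply holo_on_Clog| |].
  + apply (holo_on_subset _ _ _ Hh); intros z Hz; now apply HN.
  + intros z Hz; now apply HN.
Qed.

Definition szego (phi : C -> C) (z : C) : C := Cexp (Csum (log_terms_pos phi z)).

Section Szego.
Variable phi : C -> C.
Hypotheses (Hpos : positive_on_circle phi) (Han : analytic_near_circle phi).

Let L (k : Z) : C := fourier (log_circle phi) k.

Lemma log_fourier_conj (k : Z) : Cconj (L k) = L (- k).
Proof.
destruct (wien_log_circle phi Hpos Han) as [Hc _].
unfold L; rewrite <- (Z.opp_involutive k) at 1; rewrite <- fourier_conj by exact Hc.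
apply fourier_ext; intros z _; unfold log_circle, Cconj; apply injective_projections; simpl; ring.
Qed.

Lemma log_fourier_decay : exists K r, (0 < r < 1)%R /\ forall k, (Cmod (L k) <= K * r ^ Z.abs_nat k)%R.
Proof. exact (proj2 (wien_log_circle phi Hpos Han)). Qed.

Lemma log_terms_pos_dominated : exists r, (0 < r < 1)%R /\ forall z, (r * Cmod z < 1)%R ->
  exists M, dominated (log_terms_pos phi z) M.
Proof.
destruct log_fourier_decay as [K [r [Hr HK]]].
exists r; split; [exact Hr|]; intros z Hz.
exists (fun k => K * (r * Cmod z) * (r * Cmod z) ^ k)%R; split.
- apply ex_series_geom_scal; split; [|exact Hz].
  apply Rmult_le_pos; [lra|apply Cmod_ge_0].
- intros k; unfold log_terms_pos; fold (L (Z.of_nat (S k))).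
  rewrite Cmod_mult, Cmod_pow.
  replace (K * (r * Cmod z) * (r * Cmod z) ^ k)%R with ((K * r ^ S k) * Cmod z ^ S k)%R
    by (rewrite Rpow_mult_distr; simpl; ring).
  apply Rmult_le_compat_r; [apply pow_le, Cmod_ge_0|].
  assert (H := HK (Z.of_nat (S k))); rewrite Zabs2Nat.id in H; exact H.
Qed.

(** The second series has conjugated coefficients. Its exponential is holomorphic in the disk and
    takes the value [Cconj (szego phi z)] at [/ z] for [z] on the circle, which is how the conjugate
    of the Szego function is continued to the exterior in [wiener_hopf_unique]. *)
Lemma szego_holo : exists e, (0 < e < 1)%R /\
  holo_on (fun z => (Cmod z < 1 + e)%R) (fun z => Csum (log_terms_pos phi z)) /\
  holo_on (fun z => (Cmod z < 1 + e)%R) (fun z => Csum (fun k => Cconj (log_terms_pos phi (Cconj z) k))).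
Proof.
destruct log_fourier_decay as [K [r [Hr HK]]].
(* The bound [/ r - 1] keeps the disk of radius [1 + e] inside the disk of convergence of radius
   [/ r]; the bound [1/2] ensures [e < 1]. *)
set (e := Rmin (1/2) (/ r - 1)).
assert (Hr1 : (1 < / r)%R) by (rewrite <- Rinv_1; apply Rinv_lt_contravar; lra).
assert (He : (0 < e)%R) by (apply Rmin_pos; lra).
assert (He1 : (e <= 1/2)%R) by apply Rmin_l.
assert (He2 : (e <= / r - 1)%R) by apply Rmin_r.
assert (Hin : forall z, (Cmod z < 1 + e)%R -> (r * Cmod z < 1)%R).
{ intros z Hz; apply Rmult_lt_reg_l with (/ r)%R; [lra|].
  rewrite <- Rmult_assoc, Rinv_l; lra. }
assert (Hgen : forall a : nat -> C, (forall k, (Cmod (a k) <= K * r ^ S k)%R) ->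
  holo_on (fun z => (Cmod z < 1 + e)%R) (fun z => Csum (fun k => a k * z ^ S k))).
{ intros a Ha.
  assert (Ha' : forall k, (Cmod (a k) <= (K * r) * r ^ k)%R).
  { intros k; eapply Rle_trans; [apply Ha|]. simpl; lra. }
  destruct (holo_on_mult (fun z => (Cmod z < 1 + e)%R) (fun z => z) (pseries_val a)) as [d Hd].
  - apply holo_on_id.
  - apply (holo_on_subset _ (fun z => (r * Cmod z < 1)%R)); [|exact Hin].
    apply (holo_on_pseries a (K * r)); [lra|exact Ha'].
  - exists d; intros z Hz; destruct (Hd z Hz) as [H1 H2]; split; [|exact H2].
    revert H1; apply cderiv_ext_loc.
    assert (Hloc : locally z (fun w => (Cmod w < 1 + e)%R)).
    { assert (Hcm := filterlim_Cmod_comp _ _ (filterlim_C_id z)).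
      exact (Hcm _ (open_lt (1 + e) _ Hz)). }
    revert Hloc; apply filter_imp; intros w Hw; unfold pseries_val.
    rewrite <- (Csum_scal w _ _ (pseries_dominated a (K * r) r ltac:(lra) Ha' w (Hin w Hw))).
    apply Csum_ext; intros k; simpl; ring. }
exists e; split; [lra|split].
- apply Hgen; intros k; assert (H := HK (Z.of_nat (S k))); rewrite Zabs2Nat.id in H; exact H.
- destruct (Hgen (fun k => Cconj (L (Z.of_nat (S k))))) as [d Hd].
  + intros k; rewrite Cmod_conj; assert (H := HK (Z.of_nat (S k))); rewrite Zabs2Nat.id in H; exact H.
  + exists d; intros z Hz; destruct (Hd z Hz) as [H1 H2]; split; [|exact H2].
    revert H1; apply cderiv_ext_loc, filter_forall; intros w; apply Csum_ext; intros k.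
    unfold log_terms_pos; fold (L (Z.of_nat (S k))).
    now rewrite Cmult_conj, Cpow_conj, Cconj_conj.
Qed.

Lemma szego_neq_0 (z : C) : szego phi z <> 0.
Proof. apply Cexp_neq_0. Qed.

Lemma szego_radius : exists e, (0 < e < 1)%R /\
  holo_on (fun z => (Cmod z < 1 + e)%R) (szego phi) /\
  holo_on (fun z => (Cmod z < 1 + e)%R) (fun z => / szego phi z).
Proof.
destruct szego_holo as [e [He [H1 _]]]; exists e; split; [exact He|].
assert (Hs : holo_on (fun z => (Cmod z < 1 + e)%R) (szego phi)).
{ apply (holo_on_comp _ (fun _ => True) Cexp); [apply holo_on_Cexp|exact H1|auto]. }
split; [exact Hs|]; apply holo_on_inv; [exact Hs|]; intros z _; apply szego_neq_0.
Qed.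

Lemma wien_freq_of_radius (f : C -> C) (e : R) : (0 < e < 1)%R ->
  holo_on (fun z => (Cmod z < 1 + e)%R) f -> wien f /\ freq_ge 0 f /\ fourier f 0 = f 0.
Proof.
intros He Hf; split.
- apply (wien_of_holo f e He), (holo_on_subset _ _ _ Hf); now intros z [_ Hz].
- apply disk_fourier.
  + apply (holo_on_subset _ _ _ Hf); unfold udisk; intros z Hz; lra.
  + apply (cont_on_of_holo_on _ _ _ Hf); unfold cdisk; intros z Hz; lra.
Qed.

Lemma szego_0 : szego phi 0 = 1.
Proof.
unfold szego; rewrite (Csum_ext _ (fun _ => 0)).
- rewrite Csum_0; apply Cexp_0.
- intros k; unfold log_terms_pos; simpl; ring.
Qed.

Lemma szego_wien : wien (szego phi) /\ freq_ge 0 (szego phi) /\ fourier (szego phi) 0 = 1.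
Proof.
destruct szego_radius as [e [He [H1 _]]].
rewrite <- szego_0; exact (wien_freq_of_radius _ e He H1).
Qed.

Lemma szego_inv_wien : wien (fun z => / szego phi z) /\ freq_ge 0 (fun z => / szego phi z).
Proof.
destruct szego_radius as [e [He [_ H1]]].
destruct (wien_freq_of_radius _ e He H1) as [H2 [H3 _]]; now split.
Qed.

Definition geom_mean : R := exp (Re (fourier (log_circle phi) 0)).

Lemma geom_mean_pos : (0 < geom_mean)%R.
Proof. apply exp_pos. Qed.

(** Exponentiate the Fourier series of the real function log phi: frequency 0 gives [geom_mean], the
    positive frequencies give [szego phi z], and the negative ones are conjugate to these. *)
Lemma szego_factor (z : C) : Cmod z = 1%R ->
  phi z = RtoC geom_mean * szego phi z * Cconj (szego phi z).
Proof.
intros Hz.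
destruct (Hpos z Hz) as [r [Hr E]].
assert (El : phi z = Cexp (log_circle phi z)).
{ unfold log_circle; rewrite E, Cexp_RtoC; f_equal; simpl; now rewrite exp_ln. }
rewrite El, (wien_inversion _ z (wien_log_circle phi Hpos Han) Hz).
destruct log_fourier_decay as [K [q [Hq HK]]].
destruct log_terms_pos_dominated as [q' [Hq' Hdom]].
destruct (Hdom z) as [M HM]; [rewrite Hz; lra|].
assert (E0 : fourier (log_circle phi) 0 = RtoC (Re (fourier (log_circle phi) 0))).
{ assert (H := log_fourier_conj 0); unfold L in H; simpl in H.
  destruct (fourier (log_circle phi) 0) as [a b].
  apply (f_equal snd) in H; simpl in H; apply injective_projections; simpl; lra. }
unfold synth, zsum; fold L.
assert (HMc : dominated (fun k => Cconj (log_terms_pos phi z k)) M).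
{ split; [apply HM|]; intros k; rewrite Cmod_conj; apply HM. }
assert (HL : dominated (fun k => L (Z.of_nat k) * zpow z (Z.of_nat k)) (fun k => K * q ^ k)%R).
{ split; [apply ex_series_geom_scal; lra|]; intros k.
  rewrite Cmod_mult, Cmod_zpow_circle, Rmult_1_r by exact Hz.
  assert (H := HK (Z.of_nat k)); rewrite Zabs2Nat.id in H; exact H. }
assert (Ec : forall k, L (- Z.of_nat k - 1) * zpow z (- Z.of_nat k - 1) = Cconj (log_terms_pos phi z k)).
{ intros k; unfold log_terms_pos; fold (L (Z.of_nat (S k))).
  rewrite Cmult_conj, log_fourier_conj, <- zpow_of_nat, zpow_conj by exact Hz.
  replace (- Z.of_nat (S k))%Z with (- Z.of_nat k - 1)%Z by lia; reflexivity. }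
rewrite (Csum_ext _ (fun k => L (Z.of_nat k) * zpow z (Z.of_nat k) + Cconj (log_terms_pos phi z k)))
  by (intros k; now rewrite Ec).
rewrite (Csum_plus _ _ _ _ HL HMc), Csum_conj, (Csum_incr_1 _ _ HL).
rewrite (Csum_ext (fun k => L (Z.of_nat (S k)) * zpow z (Z.of_nat (S k))) (log_terms_pos phi z))
  by (intros k; now rewrite zpow_of_nat).
rewrite !Cexp_plus, Cexp_conj; fold (szego phi z).
replace (Cexp (L (Z.of_nat 0) * zpow z (Z.of_nat 0))) with (RtoC geom_mean); [reflexivity|].
unfold geom_mean; rewrite <- Cexp_RtoC, <- E0; f_equal; simpl; unfold L; ring.
Qed.

(* [phip / szego phi] extends to the disk and equals
   [geom_mean * conj (szego phi) / phim], which extends to the exterior. *)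
Lemma wiener_hopf_unique (phip phim : C -> C) : wiener_hopf phi phip phim ->
  exists c : C, c <> 0 /\ forall z, Cmod z = 1%R ->
    phip z = c * szego phi z /\ phim z = RtoC geom_mean / c * Cconj (szego phi z).
Proof.
intros [Hf [[P [HP1 [HP2 HP3]]] [M [HM1 [HM2 HM3]]]]].
assert (HG := geom_mean_pos).
assert (HG0 : RtoC geom_mean <> 0) by (apply RtoC_neq_0; lra).
assert (Hne : forall z, Cmod z = 1%R -> phip z <> 0 /\ phim z <> 0).
{ intros z Hz; destruct (Hpos z Hz) as [r [Hr E]]; rewrite (Hf z Hz) in E.
  assert (Hr0 : RtoC r <> 0) by (apply RtoC_neq_0; lra).
  split; intros E'; rewrite E' in E; apply Hr0; rewrite <- E; ring. }
assert (Hinv : forall z, Cmod z = 1%R -> Cmod (/ z) = 1%R).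
{ intros z Hz; rewrite Cmod_inv, Hz by now apply circle_neq_0. apply Rinv_1. }
destruct szego_radius as [e [He [_ HDi]]].
destruct szego_holo as [e' [He' [_ HDc]]].
set (E1 := fun w => P w * / szego phi w).
set (Dc := fun w => Cexp (Csum (fun k => Cconj (log_terms_pos phi (Cconj w) k)))).
assert (HDcE : forall w, Dc w = Cconj (szego phi (Cconj w))).
{ intros w; unfold Dc, szego; now rewrite Csum_conj, Cexp_conj. }
set (E2 := fun w => RtoC geom_mean * Dc w * / M w).
(* Inside the disk this belongs to the factorization; on the circle it follows from [phi] being
   positive there. *)
assert (HMne : forall w, cdisk w -> M w <> 0).
{ intros w Hw; destruct (Rle_lt_or_eq_dec _ _ Hw) as [Hlt|Heq]; [now apply HM2|].
  rewrite HM1 by exact Heq; apply Hne, Hinv, Heq. }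
assert (HDch : holo_on (fun z => (Cmod z < 1 + e')%R) Dc).
{ apply (holo_on_comp _ (fun _ => True) Cexp); [apply holo_on_Cexp|exact HDc|auto]. }
assert (D1 : freq_ge 0 E1 /\ fourier E1 0 = E1 0).
{ apply disk_fourier.
  - apply holo_on_mult; [apply analytic_holo_on; intros z Hz; now apply HP2|].
    apply (holo_on_subset _ _ _ HDi); unfold udisk; intros z Hz; lra.
  - apply cont_on_mult; [exact HP3|].
    apply (cont_on_of_holo_on _ _ _ HDi); unfold cdisk; intros z Hz; lra. }
assert (C2 : cont_on cdisk E2).
{ apply cont_on_mult; [apply cont_on_mult|].
  - intros w _; apply filterlim_const.
  - apply (cont_on_of_holo_on _ _ _ HDch); unfold cdisk; intros z Hz; lra.
  - apply cont_on_inv; [exact HM3|exact HMne]. }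
assert (D2 : freq_ge 0 E2 /\ fourier E2 0 = E2 0).
{ apply disk_fourier; [|exact C2].
  apply holo_on_mult; [apply holo_on_mult|].
  - apply holo_on_const.
  - apply (holo_on_subset _ _ _ HDch); unfold udisk; intros z Hz; lra.
  - apply holo_on_inv; [apply analytic_holo_on; intros z Hz; now apply HM2|].
    intros z Hz; apply HMne; unfold udisk, cdisk in *; lra. }
assert (CC1 : ccirc E1).
{ apply ccirc_mult; [|apply szego_inv_wien].
  apply (cont_on_ccirc cdisk); [exact HP3|unfold cdisk; intros; lra]. }
assert (CC2 : ccirc E2) by (apply (cont_on_ccirc cdisk); [exact C2|unfold cdisk; intros; lra]).
assert (E12 : forall z, Cmod z = 1%R -> E1 z = E2 (/ z)).
{ intros z Hz; destruct (Hne z Hz) as [Hn1 Hn2]; unfold E1, E2.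
  rewrite HDcE, HP1, HM1, <- (circle_conj z Hz), Cconj_conj by auto.
  replace (/ Cconj z) with z.
  2:{ rewrite circle_conj by exact Hz; field; now apply circle_neq_0. }
  assert (Hs := szego_neq_0 z).
  transitivity (phi z / (szego phi z * phim z)).
  - rewrite Hf by exact Hz; field; repeat split; assumption.
  - rewrite szego_factor by exact Hz; field; repeat split; assumption. }
set (c := fourier E1 0).
(* [E1] has frequencies [>= 0] from its extension to the disk and, through [E2] at [/ z],
   frequencies [<= 0]; only the constant remains. *)
assert (Hc : forall z, Cmod z = 1%R -> E1 z = c).
{ apply (fourier_inj E1 (fun _ => c)); [exact CC1|apply ccirc_const|].
  intros k; rewrite (fourier_ext (fun _ => c) (fun z => c * zpow z 0)) by (intros; simpl; ring).
  rewrite fourier_scal, fourier_zpow by apply ccirc_zpow.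
  destruct (Z.eq_dec k 0) as [->|Hk]; [unfold c; ring|].
  rewrite Cmult_0_r.
  destruct (Z_lt_ge_dec k 0) as [Hk'|Hk']; [now apply D1|].
  rewrite (fourier_ext E1 (fun z => E2 (/ z)) k E12), fourier_reflect by exact CC2.
  apply D2; lia. }
assert (Hc0 : c <> 0).
{ intros E; assert (H1 := Hc 1 Cmod_1); rewrite E in H1; unfold E1 in H1.
  rewrite HP1 in H1 by apply Cmod_1.
  revert H1; apply (Cmult_neq_0 (phip 1) (/ szego phi 1)); [apply Hne, Cmod_1|].
  apply Cinv_neq_0, szego_neq_0. }
exists c; split; [exact Hc0|]; intros z Hz.
assert (Hs := szego_neq_0 z).
assert (Ep : phip z = c * szego phi z).
{ rewrite <- (Hc z Hz); unfold E1; rewrite HP1 by exact Hz; field; exact Hs. }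
split; [exact Ep|].
assert (E := szego_factor z Hz); rewrite Hf, Ep in E by exact Hz.
transitivity (c * szego phi z * phim z / (c * szego phi z)); [field; repeat split; assumption|].
rewrite E; field; repeat split; assumption.
Qed.

End Szego.

(** * Operators with exponentially decaying kernels *)

Definition nsq (f : nat -> C) : R := Series (fun j => Cmod (f j) ^ 2)%R.

Lemma Series_nonneg (a : nat -> R) : (forall k, (0 <= a k)%R) -> ex_series a -> (0 <= Series a)%R.
Proof.
intros H Ha.
replace 0%R with (Series (fun _ : nat => 0 * 0)%R) by (rewrite Series_scal_l; ring).
apply Series_le; [|exact Ha]; intros k; rewrite Rmult_0_l; split; [lra|apply H].
Qed.

Lemma Series_term_le (a : nat -> R) (m : nat) : (forall k, (0 <= a k)%R) -> ex_series a ->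
  (a m <= Series a)%R.
Proof.
intros H Ha; revert a H Ha; induction m as [|m IH]; intros a H Ha.
- rewrite Series_incr_1 by exact Ha.
  assert (0 <= Series (fun k => a (S k)))%R; [|lra].
  apply Series_nonneg; [intros; apply H|now apply ex_series_incr_1 in Ha].
- rewrite Series_incr_1 by exact Ha.
  assert (H1 := IH (fun k => a (S k)) (fun k => H (S k)) (proj1 (ex_series_incr_1 a) Ha)).
  generalize (H 0%nat); lra.
Qed.

Lemma nsq_nonneg (f : nat -> C) : ell2 f -> (0 <= nsq f)%R.
Proof. intros H; apply Series_nonneg; [intros; apply pow2_ge_0|exact H]. Qed.

Lemma ell2_norm_nonneg (f : nat -> C) : (0 <= ell2_norm f)%R.
Proof. apply sqrt_pos. Qed.

Lemma ell2_norm_sq (f : nat -> C) : ell2 f -> (ell2_norm f ^ 2 = nsq f)%R.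
Proof. intros H; unfold ell2_norm; rewrite pow2_sqrt; [reflexivity|now apply nsq_nonneg]. Qed.

Lemma ell2_norm_le (f : nat -> C) (M : R) : ell2 f -> (0 <= M)%R -> (nsq f <= M ^ 2)%R ->
  (ell2_norm f <= M)%R.
Proof.
intros H HM Hn.
apply Rnot_lt_le; intros Hlt.
assert (H1 := ell2_norm_sq f H).
assert (M * M < ell2_norm f * ell2_norm f)%R by (apply Rmult_le_0_lt_compat; lra).
simpl in H1, Hn; lra.
Qed.

Lemma ell2_term_le (f : nat -> C) (m : nat) : ell2 f -> (Cmod (f m) <= ell2_norm f)%R.
Proof.
intros H; assert (H1 := Series_term_le (fun j => Cmod (f j) ^ 2)%R m (fun k => pow2_ge_0 _) H).
fold (nsq f) in H1; simpl in H1; rewrite <- ell2_norm_sq in H1 by exact H.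
apply Rnot_lt_le; intros Hlt.
assert (Hp := ell2_norm_nonneg f).
assert (ell2_norm f * ell2_norm f < Cmod (f m) * Cmod (f m))%R
  by (apply Rmult_le_0_lt_compat; lra).
simpl in H1; lra.
Qed.

Lemma ell2_le (f g : nat -> C) : ell2 g -> (forall j, (Cmod (f j) <= Cmod (g j))%R) ->
  ell2 f /\ (nsq f <= nsq g)%R.
Proof.
intros Hg H.
assert (Hs : forall j, (Cmod (f j) ^ 2 <= Cmod (g j) ^ 2)%R).
{ intros j; apply pow_incr; split; [apply Cmod_ge_0|apply H]. }
split.
- apply (ex_series_le (V := R_CompleteNormedModule) _ (fun j => Cmod (g j) ^ 2)%R); [|exact Hg].
  intros j; change (Rabs (Cmod (f j) ^ 2) <= Cmod (g j) ^ 2)%R.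
  rewrite Rabs_pos_eq by apply pow2_ge_0; apply Hs.
- apply Series_le; [|exact Hg]; intros j; split; [apply pow2_ge_0|apply Hs].
Qed.

Lemma ell2_lin (c : C) (f g : nat -> C) : ell2 f -> ell2 g ->
  ell2 (fun j => c * f j + g j) /\
  (nsq (fun j => c * f j + g j)%C <= 2 * Cmod c ^ 2 * nsq f + 2 * nsq g)%R.
Proof.
intros Hf Hg.
assert (Hs : forall j, (Cmod (c * f j + g j) ^ 2 <= 2 * Cmod c ^ 2 * Cmod (f j) ^ 2 + 2 * Cmod (g j) ^ 2)%R).
{ intros j; assert (H := Cmod_triangle (c * f j) (g j)); rewrite Cmod_mult in H.
  assert (0 <= Cmod (c * f j + g j))%R by apply Cmod_ge_0.
  set (a := (Cmod c * Cmod (f j))%R) in *; set (b := Cmod (g j)) in *.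
  replace (2 * Cmod c ^ 2 * Cmod (f j) ^ 2 + 2 * b ^ 2)%R with (2 * a ^ 2 + 2 * b ^ 2)%R
    by (unfold a; ring).
  assert (0 <= (a - b) ^ 2)%R by apply pow2_ge_0. simpl in *; nra. }
assert (Hex : ex_series (fun j => 2 * Cmod c ^ 2 * Cmod (f j) ^ 2 + 2 * Cmod (g j) ^ 2)%R).
{ apply (ex_series_plus (V := R_NormedModule) (fun j => 2 * Cmod c ^ 2 * Cmod (f j) ^ 2)%R);
    apply (ex_series_scal (V := R_NormedModule)); assumption. }
split.
- apply (ex_series_le (V := R_CompleteNormedModule) _ _) with (2 := Hex).
  intros j; change (Rabs (Cmod (c * f j + g j) ^ 2) <= 2 * Cmod c ^ 2 * Cmod (f j) ^ 2 + 2 * Cmod (g j) ^ 2)%R.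
  rewrite Rabs_pos_eq by apply pow2_ge_0; apply Hs.
- unfold nsq; rewrite <- Series_lin by assumption.
  apply Series_le; [|exact Hex]; intros j; split; [apply pow2_ge_0|apply Hs].
Qed.

(** The majorant has norm [K / sqrt (1 - r^2)]; the weaker bound [K / (1 - r)] keeps the later
    constants free of roots. *)
Lemma ell2_geom (f : nat -> C) (K r : R) : (0 < r < 1)%R -> (0 <= K)%R ->
  (forall j, (Cmod (f j) <= K * r ^ j)%R) -> ell2 f /\ (ell2_norm f <= K / (1 - r))%R.
Proof.
intros Hr HK H.
assert (Hr2 : (0 <= r * r < 1)%R) by nra.
assert (Hs : forall j, (Cmod (f j) ^ 2 <= K ^ 2 * (r * r) ^ j)%R).
{ intros j; apply Rle_trans with ((K * r ^ j) ^ 2)%R.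
  - apply pow_incr; split; [apply Cmod_ge_0|apply H].
  - rewrite Rpow_mult_distr, (Rpow_mult_distr r r j); simpl; lra. }
assert (Hex := ex_series_geom_scal (K ^ 2) _ Hr2).
assert (Hf : ell2 f).
{ apply (ex_series_le (V := R_CompleteNormedModule) _ _) with (2 := Hex).
  intros j; change (Rabs (Cmod (f j) ^ 2) <= K ^ 2 * (r * r) ^ j)%R.
  rewrite Rabs_pos_eq by apply pow2_ge_0; apply Hs. }
split; [exact Hf|].
apply ell2_norm_le; [exact Hf|apply Rdiv_le_0_compat; lra|].
apply Rle_trans with (Series (fun j => K ^ 2 * (r * r) ^ j)%R).
- apply Series_le; [|exact Hex]; intros j; split; [apply pow2_ge_0|apply Hs].
- rewrite Series_scal_l, Series_geom by (rewrite Rabs_pos_eq; lra).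
  unfold Rdiv; rewrite Rpow_mult_distr; apply Rmult_le_compat_l; [apply pow2_ge_0|].
  rewrite pow_inv; apply Rinv_le_contravar; [apply pow_lt; lra|]. nra.
Qed.

Lemma proj_le (n : nat) (f : nat -> C) (j : nat) : (Cmod (proj n f j) <= Cmod (f j))%R.
Proof. unfold proj; destruct (n <=? j)%nat; [lra|rewrite Cmod_0; apply Cmod_ge_0]. Qed.

Lemma ell2_proj (n : nat) (f : nat -> C) : ell2 f -> ell2 (proj n f) /\ (nsq (proj n f) <= nsq f)%R.
Proof. intros H; apply (ell2_le _ f); [exact H|apply proj_le]. Qed.

Lemma proj_lin (n : nat) (c : C) (f g : nat -> C) :
  proj n (fun i => c * f i + g i) = (fun i => c * proj n f i + proj n g i).
Proof. extensionality i; unfold proj; destruct (n <=? i)%nat; ring. Qed.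

Lemma nsq_le_norm (f g : nat -> C) : (nsq f <= nsq g)%R -> (ell2_norm f <= ell2_norm g)%R.
Proof. apply sqrt_le_1_alt. Qed.

(** A bound in product form, available for Hankel kernels because [r^(j+m+1) <= r^j r^m]. It makes
    an exponentially decaying output out of any square-summable input. *)
Definition kernel_le (A : nat -> nat -> C) (K r : R) : Prop :=
  (0 < r < 1)%R /\ (0 <= K)%R /\ forall j m, (Cmod (A j m) <= K * r ^ j * r ^ m)%R.

Section Kernel.
Variables (A : nat -> nat -> C) (K r : R).
Hypothesis HA : kernel_le A K r.

Lemma kernel_dominated (f : nat -> C) (j : nat) : ell2 f ->
  dominated (fun m => A j m * f m) (fun m => K * r ^ j * ell2_norm f * r ^ m)%R.
Proof.
destruct HA as [Hr [HK H]]; intros Hf; split; [apply ex_series_geom_scal; lra|].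
intros m; rewrite Cmod_mult.
replace (K * r ^ j * ell2_norm f * r ^ m)%R with (K * r ^ j * r ^ m * ell2_norm f)%R by ring.
apply Rmult_le_compat; try apply Cmod_ge_0; [apply H|now apply ell2_term_le].
Qed.

Lemma kernel_op_bound (f : nat -> C) (j : nat) : ell2 f ->
  (Cmod (kernel_op A f j) <= K / (1 - r) * ell2_norm f * r ^ j)%R.
Proof.
intros Hf; assert (H := Csum_bound _ _ (kernel_dominated f j Hf)).
destruct HA as [Hr [HK _]].
rewrite (Series_scal_l (K * r ^ j * ell2_norm f) (fun m => r ^ m)%R), Series_geom in H
  by (rewrite Rabs_pos_eq; lra).
unfold kernel_op; eapply Rle_trans; [exact H|]; apply Req_le; field; lra.
Qed.

Lemma kernel_op_lin (c : C) (f g : nat -> C) (j : nat) : ell2 f -> ell2 g ->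
  kernel_op A (fun i => c * f i + g i) j = c * kernel_op A f j + kernel_op A g j.
Proof.
intros Hf Hg; unfold kernel_op.
assert (Df := kernel_dominated f j Hf); assert (Dg := kernel_dominated g j Hg).
rewrite <- (Csum_scal c _ _ Df), <- (Csum_plus _ _ _ _ (dominated_scal c _ _ Df) Dg).
apply Csum_ext; intros k; ring.
Qed.

Lemma kernel_op_ell2 (f : nat -> C) : ell2 f ->
  ell2 (kernel_op A f) /\ (ell2_norm (kernel_op A f) <= K / (1 - r) / (1 - r) * ell2_norm f)%R.
Proof.
intros Hf; destruct HA as [Hr [HK _]].
assert (HK' : (0 <= K / (1 - r))%R) by (apply Rdiv_le_0_compat; lra).
destruct (ell2_geom (kernel_op A f) (K / (1 - r) * ell2_norm f) r Hr) as [H1 H2].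
- apply Rmult_le_pos; [exact HK'|apply ell2_norm_nonneg].
- intros j; now apply kernel_op_bound.
- split; [exact H1|]; eapply Rle_trans; [exact H2|]; apply Req_le; field; lra.
Qed.

Lemma ell2_kernel_of_le : ell2_kernel A.
Proof.
split; [|split].
- intros f Hf j; exact (dominated_ex_series _ _ (kernel_dominated f j Hf)).
- intros c f g Hf Hg j; now apply kernel_op_lin.
- exists (K / (1 - r) / (1 - r))%R; intros f Hf; now apply kernel_op_ell2.
Qed.

End Kernel.

(** The sequences whose generating functions [ser_pos] and [ser_neg] lie in [wien], so that the
    kernels act on them by multiplication. *)
Definition decays (f : nat -> C) : Prop :=
  exists K r, (0 < r < 1)%R /\ (0 <= K)%R /\ forall j, (Cmod (f j) <= K * r ^ j)%R.

Lemma decays_ell2 (f : nat -> C) : decays f -> ell2 f.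
Proof. intros [K [r [Hr [HK H]]]]; now apply (ell2_geom f K r). Qed.

Lemma decays_proj (n : nat) (f : nat -> C) : decays f -> decays (proj n f).
Proof.
intros [K [r [Hr [HK H]]]]; exists K, r; repeat split; try lra.
intros j; eapply Rle_trans; [apply proj_le|apply H].
Qed.

Lemma decays_kernel_op (A : nat -> nat -> C) (K r : R) (f : nat -> C) : kernel_le A K r -> ell2 f ->
  decays (kernel_op A f).
Proof.
intros HA Hf; exists (K / (1 - r) * ell2_norm f)%R, r.
destruct HA as [Hr [HK H]]; split; [exact Hr|split].
- apply Rmult_le_pos; [apply Rdiv_le_0_compat; lra|apply ell2_norm_nonneg].
- intros j; apply kernel_op_bound; [now split|exact Hf].
Qed.

(** * Neumann series for the compressed operator *)

Section Neumann.
Variables (A B : nat -> nat -> C) (K r theta : R) (n : nat).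
Hypotheses (HA : kernel_le A K r) (HB : kernel_le B K r) (Hth : (0 < theta < 1)%R).
(** Contraction is assumed on decaying sequences only. One application of [T] makes every
    square-summable sequence decay, so the factor is gained from the second application on. *)
Hypothesis Hcontr : forall f, decays f ->
  (nsq (kernel_op A (kernel_op B f)) <= theta * nsq f)%R.

Let T (f : nat -> C) : nat -> C := proj n (kernel_op A (kernel_op B (proj n f))).
(** The pointwise bound for [A] from [kernel_op_bound], times the norm bound for [B] from
    [kernel_op_ell2]. *)
Let K0 := (K / (1 - r) * (K / (1 - r) / (1 - r)))%R.

Let K0_nonneg : (0 <= K0)%R.
Proof.
destruct HA as [Hr [HK _]].
assert (0 <= K / (1 - r))%R by (apply Rdiv_le_0_compat; lra).
apply Rmult_le_pos; [assumption|apply Rdiv_le_0_compat; lra].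
Qed.

Lemma PABP_bound (f : nat -> C) (j : nat) : ell2 f -> (Cmod (T f j) <= K0 * ell2_norm f * r ^ j)%R.
Proof.
intros Hf; destruct (ell2_proj n f Hf) as [Hp Hpn].
destruct (kernel_op_ell2 B K r HB _ Hp) as [HBf HBn].
eapply Rle_trans; [apply proj_le|].
eapply Rle_trans; [apply (kernel_op_bound A K r HA _ _ HBf)|].
destruct HA as [Hr [HK _]].
assert (HK' : (0 <= K / (1 - r))%R) by (apply Rdiv_le_0_compat; lra).
apply Rmult_le_compat_r; [apply pow_le; lra|].
unfold K0; rewrite Rmult_assoc; apply Rmult_le_compat_l; [exact HK'|].
eapply Rle_trans; [exact HBn|].
apply Rmult_le_compat_l; [apply Rdiv_le_0_compat; lra|].
now apply nsq_le_norm.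
Qed.

Lemma PABP_lin (c : C) (f g : nat -> C) : ell2 f -> ell2 g ->
  T (fun i => c * f i + g i) = (fun j => c * T f j + T g j).
Proof.
intros Hf Hg; unfold T; rewrite proj_lin.
destruct (ell2_proj n f Hf) as [Hf' _]; destruct (ell2_proj n g Hg) as [Hg' _].
assert (EB : kernel_op B (fun i => c * proj n f i + proj n g i) =
  (fun i => c * kernel_op B (proj n f) i + kernel_op B (proj n g) i)).
{ extensionality i; now apply (kernel_op_lin B K r). }
assert (EA : kernel_op A (fun i => c * kernel_op B (proj n f) i + kernel_op B (proj n g) i) =
  (fun i => c * kernel_op A (kernel_op B (proj n f)) i + kernel_op A (kernel_op B (proj n g)) i)).
{ extensionality i; apply (kernel_op_lin A K r HA); now apply (kernel_op_ell2 B K r). }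
now rewrite EB, EA, proj_lin.
Qed.

Lemma PABP_decays (f : nat -> C) : ell2 f -> decays (T f).
Proof.
intros Hf; exists (K0 * ell2_norm f)%R, r; split; [apply HA|split].
- apply Rmult_le_pos; [exact K0_nonneg|apply ell2_norm_nonneg].
- intros j; now apply PABP_bound.
Qed.

Lemma PABP_contract (f : nat -> C) : decays f -> (nsq (T f) <= theta * nsq f)%R.
Proof.
intros Hf; assert (Hp := decays_proj n f Hf).
assert (Hk : ell2 (kernel_op A (kernel_op B (proj n f)))).
{ apply (kernel_op_ell2 A K r HA), (kernel_op_ell2 B K r HB), decays_ell2, Hp. }
eapply Rle_trans; [apply ell2_proj, Hk|].
eapply Rle_trans; [apply Hcontr, Hp|].
apply Rmult_le_compat_l; [lra|]; apply ell2_proj, decays_ell2, Hf.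
Qed.

Definition PABP_iter (k : nat) (f : nat -> C) : nat -> C := Nat.iter k T f.

Lemma PABP_iter_ell2 (k : nat) (f : nat -> C) : ell2 f -> ell2 (PABP_iter k f).
Proof.
intros Hf; destruct k as [|k]; [exact Hf|].
induction k as [|k IH]; apply decays_ell2, PABP_decays; [exact Hf|exact IH].
Qed.

(** [theta] contracts squared norms, hence its root contracts norms. *)
Let q := sqrt theta.
Let q_bounds : (0 < q < 1)%R.
Proof.
assert (Hq2 : (q * q = theta)%R) by (apply sqrt_sqrt; lra).
assert (Hq0 : (0 < q)%R) by (apply sqrt_lt_R0; lra).
nra.
Qed.

Lemma PABP_iter_norm (k : nat) (f : nat -> C) : ell2 f ->
  (ell2_norm (PABP_iter (S k) f) <= K0 / (1 - r) * ell2_norm f * q ^ k)%R.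
Proof.
intros Hf; assert (Hr := proj1 HA); induction k as [|k IH].
- rewrite Rmult_1_r.
  destruct (ell2_geom (T f) (K0 * ell2_norm f) r Hr) as [_ H].
  + apply Rmult_le_pos; [exact K0_nonneg|apply ell2_norm_nonneg].
  + intros j; now apply PABP_bound.
  + eapply Rle_trans; [exact H|]; apply Req_le; field; lra.
- apply Rle_trans with (q * ell2_norm (PABP_iter (S k) f))%R.
  + change (PABP_iter (S (S k)) f) with (T (PABP_iter (S k) f)).
    assert (Hd : decays (PABP_iter (S k) f)) by (apply PABP_decays, PABP_iter_ell2, Hf).
    unfold ell2_norm, q; rewrite <- sqrt_mult_alt by lra.
    apply sqrt_le_1_alt; exact (PABP_contract _ Hd).
  + replace (K0 / (1 - r) * ell2_norm f * q ^ S k)%R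
      with (q * (K0 / (1 - r) * ell2_norm f * q ^ k))%R by (simpl; ring).
    apply Rmult_le_compat_l; [lra|exact IH].
Qed.

(** The summand 1 accounts for [k = 0], where the last [T] acts on [f] itself; the division by [q]
    makes up for [PABP_iter_norm], which gains only [q ^ k] at the iterate [S k]. *)
Let K1 := (K0 * (1 + K0 / (1 - r) / q))%R.

Let K1_nonneg : (0 <= K1)%R.
Proof.
destruct HA as [Hr _].
apply Rmult_le_pos; [exact K0_nonneg|].
assert (0 <= K0 / (1 - r) / q)%R; [|lra].
repeat apply Rdiv_le_0_compat; lra || exact K0_nonneg.
Qed.

Lemma PABP_iter_bound (k : nat) (f : nat -> C) (j : nat) : ell2 f ->
  (Cmod (PABP_iter (S k) f j) <= K1 * ell2_norm f * r ^ j * q ^ k)%R.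
Proof.
intros Hf; assert (Hr := proj1 HA).
assert (Hn : (ell2_norm (PABP_iter k f) <= (1 + K0 / (1 - r) / q) * ell2_norm f * q ^ k)%R).
{ assert (H0 := ell2_norm_nonneg f).
  assert (H1 : (0 <= K0 / (1 - r) / q)%R) by (repeat apply Rdiv_le_0_compat; lra || exact K0_nonneg).
  destruct k as [|k].
  - simpl; rewrite Rmult_1_r.
    assert (0 <= K0 / (1 - r) / q * ell2_norm f)%R by (now apply Rmult_le_pos).
    unfold PABP_iter; simpl; lra.
  - eapply Rle_trans; [now apply PABP_iter_norm|].
    apply Rle_trans with (K0 / (1 - r) / q * ell2_norm f * q ^ S k)%R.
    + apply Req_le; simpl; field; lra.
    + apply Rmult_le_compat_r; [apply pow_le; lra|].
      apply Rmult_le_compat_r; [exact H0|lra]. }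
change (PABP_iter (S k) f) with (T (PABP_iter k f)).
eapply Rle_trans; [apply PABP_bound, PABP_iter_ell2, Hf|].
replace (K1 * ell2_norm f * r ^ j * q ^ k)%R
  with (K0 * ((1 + K0 / (1 - r) / q) * ell2_norm f * q ^ k) * r ^ j)%R by (unfold K1; ring).
apply Rmult_le_compat_r; [apply pow_le; lra|].
apply Rmult_le_compat_l; [exact K0_nonneg|exact Hn].
Qed.

Lemma PABP_iter_dominated (f : nat -> C) (j : nat) : ell2 f ->
  dominated (fun k => PABP_iter (S k) f j) (fun k => K1 * ell2_norm f * r ^ j * q ^ k)%R.
Proof.
intros Hf; split; [apply ex_series_geom_scal; lra|].
intros k; now apply PABP_iter_bound.
Qed.

Lemma PABP_iter_lin (k : nat) (c : C) (f g : nat -> C) : ell2 f -> ell2 g ->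
  PABP_iter k (fun i => c * f i + g i) = (fun j => c * PABP_iter k f j + PABP_iter k g j).
Proof.
intros Hf Hg; induction k as [|k IH]; [reflexivity|].
change (T (PABP_iter k (fun i => c * f i + g i)) = (fun j => c * T (PABP_iter k f) j + T (PABP_iter k g) j)).
rewrite IH; apply PABP_lin; now apply PABP_iter_ell2.
Qed.

(** The term [f] stands apart because it is merely square summable, whereas all later iterates decay
    exponentially in [j]. *)
Definition neumann (f : nat -> C) (j : nat) : C := f j + Csum (fun k => PABP_iter (S k) f j).

Lemma neumann_sub_bound (f : nat -> C) (j : nat) : ell2 f ->
  (Cmod (neumann f j - f j) <= K1 / (1 - q) * ell2_norm f * r ^ j)%R.
Proof.
intros Hf; unfold neumann.
replace (f j + Csum (fun k => PABP_iter (S k) f j) - f j)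
  with (Csum (fun k => PABP_iter (S k) f j)) by ring.
eapply Rle_trans; [apply Csum_bound, PABP_iter_dominated, Hf|].
rewrite (Series_scal_l (K1 * ell2_norm f * r ^ j) (fun k => q ^ k)%R), Series_geom
  by (rewrite Rabs_pos_eq; lra).
apply Req_le; field; lra.
Qed.

Lemma neumann_bounded : bounded_op neumann.
Proof.
assert (Hr := proj1 HA).
split.
- intros c f g Hf Hg j; unfold neumann.
  assert (Df := PABP_iter_dominated f j Hf); assert (Dg := PABP_iter_dominated g j Hg).
  rewrite (Csum_ext _ (fun k => c * PABP_iter (S k) f j + PABP_iter (S k) g j))
    by (intros k; now rewrite PABP_iter_lin).
  rewrite (Csum_plus _ _ _ _ (dominated_scal c _ _ Df) Dg), (Csum_scal c _ _ Df); ring.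
- set (M := (K1 / (1 - q) / (1 - r))%R).
  assert (HK1q : (0 <= K1 / (1 - q))%R) by (apply Rdiv_le_0_compat; [exact K1_nonneg|lra]).
  assert (HM : (0 <= M)%R) by (apply Rdiv_le_0_compat; [exact HK1q|lra]).
  (* By [ell2_lin] the squared norm grows by a factor of at most [2 + 2 M^2], which is below
     [(2 M + 2)^2]. *)
  exists (2 * M + 2)%R; intros f Hf.
  assert (H0 := ell2_norm_nonneg f).
  destruct (ell2_geom (fun j => neumann f j - f j) (K1 / (1 - q) * ell2_norm f) r Hr) as [H1 H2].
  + now apply Rmult_le_pos.
  + intros j; now apply neumann_sub_bound.
  + assert (E : neumann f = (fun j => 1 * f j + (neumann f j - f j))) by (extensionality j; ring).
    destruct (ell2_lin 1 f _ Hf H1) as [H3 H4]; rewrite <- E in H3, H4.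
    split; [exact H3|].
    apply ell2_norm_le; [exact H3|nra|].
    eapply Rle_trans; [exact H4|].
    rewrite Cmod_1, <- !ell2_norm_sq by assumption.
    assert (H5 : (ell2_norm (fun j => (neumann f j - f j)%C) <= M * ell2_norm f)%R).
    { eapply Rle_trans; [exact H2|]; apply Req_le; unfold M; field; lra. }
    assert (H6 : (ell2_norm (fun j => (neumann f j - f j)%C) ^ 2 <= (M * ell2_norm f) ^ 2)%R).
    { apply pow_incr; split; [apply ell2_norm_nonneg|exact H5]. }
    assert (H7 : (0 <= ell2_norm f * ell2_norm f)%R) by now apply Rmult_le_pos.
    assert (H8 : (0 <= M * (ell2_norm f * ell2_norm f))%R) by now apply Rmult_le_pos.
    assert (H9 : (0 <= M * (M * (ell2_norm f * ell2_norm f)))%R) by now apply Rmult_le_pos.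
    simpl in *; nra.
Qed.

(** On partial sums [T] acts as a shift, and the bound on [T] carries the geometric remainder of
    [neumann f] along. The two sides therefore differ by at most [K3 * q ^ S N] for every [N]. *)
Lemma neumann_right (f : nat -> C) (j : nat) : ell2 f -> neumann f j - T (neumann f) j = f j.
Proof.
intros Hf; assert (Hr := proj1 HA).
set (part := fun N j => f j + sum_n (fun k => PABP_iter (S k) f j) N).
assert (HpartE : forall N, ell2 (part N) /\ forall j, T (part N) j = part (S N) j - f j).
{ induction N as [|N [IH1 IH2]].
  - assert (E : part 0%nat = (fun j => 1 * f j + PABP_iter 1 f j)).
    { extensionality i; unfold part; rewrite sum_n_0; ring. }
    assert (H1 := PABP_iter_ell2 1 f Hf).
    split; [rewrite E; now apply ell2_lin|].
    intros i; rewrite E, PABP_lin by assumption; unfold part; rewrite sum_n_S, sum_n_0.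
    unfold PABP_iter; simpl; ring.
  - assert (E : part (S N) = (fun j => 1 * part N j + PABP_iter (S (S N)) f j)).
    { extensionality i; unfold part; rewrite sum_n_S; ring. }
    assert (H1 := PABP_iter_ell2 (S (S N)) f Hf).
    split; [rewrite E; now apply ell2_lin|].
    intros i; rewrite E, PABP_lin, IH2 by assumption.
    change (T (PABP_iter (S (S N)) f)) with (PABP_iter (S (S (S N))) f).
    unfold part; rewrite (sum_n_S _ (S N)), Cmult_1_l; ring. }
assert (Hdiff : forall N j, (Cmod (neumann f j - part N j)
   <= K1 / (1 - q) * ell2_norm f * q ^ S N * r ^ j)%R).
{ intros N i; unfold neumann, part.
  replace (f i + Csum (fun k => PABP_iter (S k) f i) - (f i + sum_n (fun k => PABP_iter (S k) f i) N))
    with (Csum (fun k => PABP_iter (S k) f i) - sum_n (fun k => PABP_iter (S k) f i) N) by ring.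
  assert (D := PABP_iter_dominated f i Hf).
  eapply Rle_trans; [apply (Csum_tail _ _ N D)|].
  rewrite <- Series_sum_n by apply D.
  rewrite (Series_ext _ (fun k => K1 * ell2_norm f * r ^ i * q ^ S N * q ^ k)%R)
    by (intros k; rewrite pow_add; ring).
  rewrite (Series_scal_l _ (fun k => q ^ k)%R), Series_geom by (rewrite Rabs_pos_eq; lra).
  apply Req_le; field; lra. }
set (K2 := (K1 / (1 - q) * ell2_norm f)%R).
assert (HK2 : (0 <= K2)%R).
{ apply Rmult_le_pos; [apply Rdiv_le_0_compat; [exact K1_nonneg|lra]|apply ell2_norm_nonneg]. }
assert (HT : forall N, (Cmod (T (neumann f) j - (part (S N) j - f j)) <= K0 * (K2 * q ^ S N / (1 - r)) * r ^ j)%R).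
{ intros N; destruct (HpartE N) as [P1 P2]; rewrite <- P2.
  assert (HqN : (0 <= q ^ S N)%R) by (apply pow_le; lra).
  destruct (ell2_geom (fun j => neumann f j - part N j) (K2 * q ^ S N) r Hr) as [D1 D2].
  - now apply Rmult_le_pos.
  - intros i; apply Hdiff.
  - assert (E : T (neumann f) = (fun j => 1 * T (part N) j + T (fun i => neumann f i - part N i) j)).
    { rewrite <- PABP_lin by assumption. f_equal; extensionality i; ring. }
    rewrite E; replace (1 * T (part N) j + T (fun i => neumann f i - part N i) j - T (part N) j)
      with (T (fun i => neumann f i - part N i) j) by ring.
    eapply Rle_trans; [apply PABP_bound, D1|].
    apply Rmult_le_compat_r; [apply pow_le; lra|].
    apply Rmult_le_compat_l; [exact K0_nonneg|exact D2]. }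
destruct (classic (neumann f j - T (neumann f) j = f j)) as [|Hne]; [assumption|exfalso].
assert (Hpos := proj1 (Cmod_gt_0 _) (Csub_neq_0 _ _ Hne)).
set (d := Cmod (neumann f j - T (neumann f) j - f j)) in *.
set (K3 := (K2 * r ^ j + K0 * (K2 / (1 - r)) * r ^ j)%R).
assert (Hd : forall N, (d <= K3 * q ^ S N)%R).
{ intros N; unfold d.
  replace (neumann f j - T (neumann f) j - f j) with
    ((neumann f j - part (S N) j) - (T (neumann f) j - (part (S N) j - f j))) by ring.
  eapply Rle_trans; [apply Cmod_triangle|]; rewrite Cmod_opp.
  assert (H1 := Hdiff (S N) j); assert (H2 := HT N).
  assert (H3 : (K2 * q ^ S (S N) * r ^ j <= K2 * q ^ S N * r ^ j)%R).
  { apply Rmult_le_compat_r; [apply pow_le; lra|].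
    apply Rmult_le_compat_l; [exact HK2|apply pow_le_pow_lt1; lra || lia]. }
  replace (K3 * q ^ S N)%R with (K2 * q ^ S N * r ^ j + K0 * (K2 * q ^ S N / (1 - r)) * r ^ j)%R
    by (unfold K3; field; lra).
  fold K2 in H1; lra. }
assert (HK3 : (0 < K3)%R).
{ apply Rnot_le_lt; intros Hle; specialize (Hd 0%nat).
  assert (0 < q ^ 1)%R by (apply pow_lt; lra). nra. }
destruct (pow_lt_1_zero q ltac:(rewrite Rabs_pos_eq; lra) (d / K3)) as [N HN].
{ now apply Rdiv_lt_0_compat. }
specialize (HN (S N) ltac:(lia)); rewrite Rabs_pos_eq in HN by (apply pow_le; lra).
specialize (Hd N).
assert (K3 * q ^ S N < K3 * (d / K3))%R by now apply Rmult_lt_compat_l.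
replace (K3 * (d / K3))%R with d in H by (field; lra); lra.
Qed.

(** The series for [T f] is the one for [f] without its first terms, so the difference
    telescopes. *)
Lemma neumann_left (f : nat -> C) (j : nat) : ell2 f -> neumann (fun i => f i - T f i) j = f j.
Proof.
intros Hf.
assert (HT : ell2 (T f)) by apply (PABP_iter_ell2 1 f Hf).
assert (E : (fun i => f i - T f i) = (fun i => - (1) * T f i + f i)) by (extensionality i; ring).
rewrite E, (proj1 neumann_bounded) by assumption.
unfold neumann.
rewrite (Csum_incr_1 _ _ (PABP_iter_dominated f j Hf)).
rewrite (Csum_ext (fun k => PABP_iter (S k) (T f) j) (fun k => PABP_iter (S (S k)) f j)).
- change (PABP_iter 1 f j) with (T f j); ring.
- intros k; unfold PABP_iter; now rewrite <- Nat.iter_succ_r.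
Qed.

Lemma neumann_inverse :
  is_inverse_op (fun f j => f j - T f j) neumann.
Proof.
split; [exact neumann_bounded|split]; intros f Hf j.
- now apply neumann_right.
- now apply neumann_left.
Qed.

End Neumann.

(** * One-sided sums of Fourier coefficients *)

Lemma geom_le_dominated_pos (a : Z -> C) (K r : R) : geom_le a K r ->
  dominated (fun m => a (Z.of_nat m)) (fun m => K * r ^ m)%R.
Proof.
intros [Hr H]; split; [apply ex_series_geom_scal; lra|].
intros m; assert (E := H (Z.of_nat m)); rewrite Zabs2Nat.id in E; exact E.
Qed.

Lemma zsum_neg (a : Z -> C) : expdec a -> (forall k, (0 < k)%Z -> a k = 0) ->
  zsum a = Csum (fun m => a (- Z.of_nat m)%Z).
Proof.
intros [K [r H]] H0.
assert (Hr := proj1 H); assert (HK := geom_le_nonneg _ _ _ H).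
assert (D : dominated (fun m => a (- Z.of_nat m)%Z) (fun m => K * r ^ m)%R).
{ split; [apply ex_series_geom_scal; lra|].
  intros m; assert (E := proj2 H (- Z.of_nat m)%Z).
  replace (Z.abs_nat (- Z.of_nat m)) with m in E by lia; exact E. }
rewrite (Csum_incr_1 _ _ D); unfold zsum.
rewrite (Csum_plus (fun k => a (Z.of_nat k)) (fun k => a (- Z.of_nat k - 1)%Z)
  (fun m => K * r ^ m)%R (fun m => K * r ^ m)%R).
- rewrite (Csum_single _ 0); [|intros k Hk; apply H0; lia].
  simpl (- Z.of_nat 0)%Z; f_equal; apply Csum_ext; intros k; f_equal; lia.
- now apply geom_le_dominated_pos.
- assert (D' := dominated_tail _ _ 0 D); simpl in D'.
  split; [apply D|]. intros k.
  replace (- Z.of_nat k - 1)%Z with (- Z.of_nat (S k))%Z by lia.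
  eapply Rle_trans; [apply (proj2 D (S k))|].
  apply Rmult_le_compat_l; [exact HK|apply pow_le_pow_lt1; lra || lia].
Qed.

Lemma zsum_pos (a : Z -> C) : expdec a -> (forall k, (k <= 0)%Z -> a k = 0) ->
  zsum a = Csum (fun m => a (Z.of_nat m + 1)%Z).
Proof.
intros [K [r H]] H0; unfold zsum.
assert (D := geom_le_dominated_pos _ _ _ H).
rewrite (Csum_ext _ (fun m => a (Z.of_nat m))).
- rewrite (Csum_incr_1 _ _ D), H0, Cplus_0_l by (simpl; lia).
  apply Csum_ext; intros m; f_equal; lia.
- intros m; rewrite (H0 (- Z.of_nat m - 1)%Z) by lia; ring.
Qed.

Lemma expdec_mult (a b : Z -> C) : expdec a -> (exists M, forall k, (Cmod (b k) <= M)%R) ->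
  expdec (fun k => a k * b k).
Proof.
intros [K [r [Hr H]]] [M HM]; exists (K * M)%R, r; split; [exact Hr|]; intros k.
rewrite Cmod_mult; replace (K * M * r ^ Z.abs_nat k)%R with (K * r ^ Z.abs_nat k * M)%R by ring.
apply Rmult_le_compat; auto using Cmod_ge_0.
Qed.

Lemma fourier_bounded (u : C -> C) : ccirc u -> exists M, forall k, (Cmod (fourier u k) <= M)%R.
Proof.
intros Hu; destruct (ccirc_bounded u Hu) as [M [_ HM]]; exists M; intros k.
apply circle_int_bound; [apply ccirc_mult; auto using ccirc_zpow|].
intros z Hz; rewrite Cmod_mult, Cmod_zpow_circle, Rmult_1_l by exact Hz; auto.
Qed.

Lemma expdec_conv (u v : C -> C) (l : Z -> Z) : wien u -> ccirc v ->
  expdec (fun k => fourier u k * fourier v (l k)).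
Proof.
intros Hu Hv; apply (expdec_mult (fourier u) (fun k => fourier v (l k))); [apply Hu|].
destruct (fourier_bounded v Hv) as [M HM]; now exists M.
Qed.

(** * Hankel kernels as multiplication operators *)

(* [sum f_k b^(k+1)] and [sum f_k b^(-k)]: [B] and [A] act on these as
   multiplication by [psi] and [1 / psi]. *)
Definition ser_pos (f : nat -> C) : C -> C :=
  synth (fun k => if (0 <? k)%Z then f (Z.to_nat (k - 1)) else 0).
Definition ser_neg (f : nat -> C) : C -> C :=
  synth (fun k => if (k <=? 0)%Z then f (Z.to_nat (- k)) else 0).

Lemma ser_pos_expdec (f : nat -> C) : decays f ->
  expdec (fun k => if (0 <? k)%Z then f (Z.to_nat (k - 1)) else 0).
Proof.
(* [K / r] absorbs the shift between the index [k - 1] and the frequency [k]. *)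
intros [K [r [Hr [HK H]]]]; exists (K / r)%R, r; split; [exact Hr|]; intros k.
destruct (Z.ltb_spec 0 k) as [Hk|Hk].
- eapply Rle_trans; [apply H|].
  replace (Z.abs_nat k) with (S (Z.to_nat (k - 1))) by lia.
  apply Req_le; simpl; field; lra.
- rewrite Cmod_0; apply Rmult_le_pos; [apply Rdiv_le_0_compat; lra|apply pow_le; lra].
Qed.

Lemma ser_neg_expdec (f : nat -> C) : decays f ->
  expdec (fun k => if (k <=? 0)%Z then f (Z.to_nat (- k)) else 0).
Proof.
intros [K [r [Hr [HK H]]]]; exists K, r; split; [exact Hr|]; intros k.
destruct (Z.leb_spec k 0) as [Hk|Hk].
- eapply Rle_trans; [apply H|].
  replace (Z.abs_nat k) with (Z.to_nat (- k)) by lia; lra.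
- rewrite Cmod_0; apply Rmult_le_pos; [exact HK|apply pow_le; lra].
Qed.

Lemma wien_ser_pos (f : nat -> C) : decays f -> wien (ser_pos f).
Proof. intros Hf; now apply wien_synth, ser_pos_expdec. Qed.
Lemma wien_ser_neg (f : nat -> C) : decays f -> wien (ser_neg f).
Proof. intros Hf; now apply wien_synth, ser_neg_expdec. Qed.

Lemma fourier_ser_pos (f : nat -> C) (k : nat) : decays f -> fourier (ser_pos f) (Z.of_nat k + 1) = f k.
Proof.
intros Hf; unfold ser_pos; rewrite fourier_synth by now apply ser_pos_expdec.
destruct (Z.ltb_spec 0 (Z.of_nat k + 1)); [f_equal; lia|lia].
Qed.
Lemma fourier_ser_neg (f : nat -> C) (k : nat) : decays f -> fourier (ser_neg f) (- Z.of_nat k) = f k.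
Proof.
intros Hf; unfold ser_neg; rewrite fourier_synth by now apply ser_neg_expdec.
destruct (Z.leb_spec (- Z.of_nat k) 0); [f_equal; lia|lia].
Qed.
Lemma freq_ge_ser_pos (f : nat -> C) : decays f -> freq_ge 1 (ser_pos f).
Proof.
intros Hf k Hk; unfold ser_pos; rewrite fourier_synth by now apply ser_pos_expdec.
destruct (Z.ltb_spec 0 k); [lia|reflexivity].
Qed.
Lemma freq_le_ser_neg (f : nat -> C) : decays f -> freq_le 0 (ser_neg f).
Proof.
intros Hf k Hk; unfold ser_neg; rewrite fourier_synth by now apply ser_neg_expdec.
destruct (Z.leb_spec k 0); [lia|reflexivity].
Qed.

(** The sum is a convolution, hence a coefficient of a product; the extra [- 1] is the exponent
    [k + 1] attached to [f k] in [ser_pos]. *)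
Lemma Csum_ser_pos (f : nat -> C) (v : C -> C) (j : Z) : decays f -> ccirc v ->
  Csum (fun k => fourier v (j - Z.of_nat k - 1) * f k) = fourier (fun z => ser_pos f z * v z) j.
Proof.
intros Hf Hv; assert (Hw := wien_ser_pos f Hf).
rewrite fourier_mult by assumption; rewrite zsum_pos.
- apply Csum_ext; intros k; rewrite fourier_ser_pos by exact Hf.
  replace (j - (Z.of_nat k + 1))%Z with (j - Z.of_nat k - 1)%Z by lia; ring.
- now apply (expdec_conv _ _ (fun k => j - k)%Z).
- intros k Hk; rewrite freq_ge_ser_pos by (exact Hf || lia); ring.
Qed.

Lemma Csum_ser_neg (f : nat -> C) (v : C -> C) (j : Z) : decays f -> ccirc v ->
  Csum (fun k => fourier v (j + Z.of_nat k) * f k) = fourier (fun z => ser_neg f z * v z) j.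
Proof.
intros Hf Hv; assert (Hw := wien_ser_neg f Hf).
rewrite fourier_mult by assumption; rewrite zsum_neg.
- apply Csum_ext; intros k; rewrite fourier_ser_neg by exact Hf.
  replace (j - - Z.of_nat k)%Z with (j + Z.of_nat k)%Z by lia; ring.
- now apply (expdec_conv _ _ (fun k => j - k)%Z).
- intros k Hk; rewrite freq_le_ser_neg by (exact Hf || lia); ring.
Qed.

Lemma kernel_op_kerB (psi : C -> C) (f : nat -> C) (m : nat) : decays f -> ccirc psi ->
  kernel_op (kerB psi) f m = fourier (fun z => ser_pos f z * psi z) (- Z.of_nat m).
Proof.
intros Hf Hp; rewrite <- Csum_ser_pos by assumption; apply Csum_ext; intros k; reflexivity.
Qed.

Lemma kernel_op_kerA (psi : C -> C) (f : nat -> C) (j : nat) : decays f ->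
  ccirc (fun z => / psi z) ->
  kernel_op (kerA psi) f j = fourier (fun z => ser_neg f z * / psi z) (Z.of_nat j + 1).
Proof.
intros Hf Hp.
rewrite <- (Csum_ser_neg f (fun z => / psi z)) by assumption.
apply Csum_ext; intros k; unfold kerA; do 2 f_equal; lia.
Qed.

(** * Mean squares *)

(** The squared L^2 norm on the circle. Through Parseval's identity [mean_sq_zsum], pointwise bounds
    on functions become bounds on coefficient sequences. *)
Definition mean_sq (u : C -> C) : R := Re (circle_int (fun z => u z * Cconj (u z))).

Lemma mean_sq_RInt (u : C -> C) : ccirc u ->
  mean_sq u = (/ (2 * PI) * RInt (fun t => Cmod (u (eit t)) ^ 2) 0 (2 * PI))%R /\
  ex_RInt (fun t => Cmod (u (eit t)) ^ 2)%R 0 (2 * PI).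
Proof.
intros Hu.
assert (Hc : ccirc (fun z => u z * Cconj (u z))) by (apply ccirc_mult; [|apply ccirc_conj]; exact Hu).
assert (E : forall t, Re (u (eit t) * Cconj (u (eit t))) = (Cmod (u (eit t)) ^ 2)%R)
  by (intros t; now rewrite <- Cmod2_conj).
split.
- unfold mean_sq; rewrite circle_int_pair by exact Hc; simpl fst; unfold Re at 1; simpl fst.
  f_equal; apply RInt_eq; intros t; apply E.
- eapply ex_RInt_ext; [|apply (ccirc_RInt_Re _ 0 (2 * PI) Hc)].
  intros t _; apply E.
Qed.

Lemma mean_sq_le (u v : C -> C) (M : R) : ccirc u -> ccirc v -> (0 <= M)%R ->
  (forall z, Cmod z = 1%R -> (Cmod (u z) <= M * Cmod (v z))%R) ->
  (mean_sq u <= M ^ 2 * mean_sq v)%R.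
Proof.
intros Hu Hv HM H; assert (HP := PI_RGT_0).
destruct (mean_sq_RInt u Hu) as [-> Eu]; destruct (mean_sq_RInt v Hv) as [-> Ev].
(* The null second summand brings the integral into the shape of [RInt_lin]. *)
replace (M ^ 2 * (/ (2 * PI) * RInt (fun t => Cmod (v (eit t)) ^ 2) 0 (2 * PI)))%R
  with (/ (2 * PI) * (M ^ 2 * RInt (fun t => Cmod (v (eit t)) ^ 2) 0 (2 * PI)
     + 0 * RInt (fun t => Cmod (v (eit t)) ^ 2) 0 (2 * PI)))%R by ring.
apply Rmult_le_compat_l; [apply Rlt_le, Rinv_0_lt_compat; lra|].
rewrite <- RInt_lin by assumption.
apply RInt_le; [lra|exact Eu| |].
- apply (ex_RInt_plus (V := R_NormedModule) (fun t => M ^ 2 * Cmod (v (eit t)) ^ 2)%R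
    (fun t => 0 * Cmod (v (eit t)) ^ 2)%R); now apply (ex_RInt_scal (V := R_NormedModule)).
- intros t _; assert (H1 := H _ (Cmod_eit t)).
  apply Rle_trans with ((M * Cmod (v (eit t))) ^ 2)%R.
  + apply pow_incr; split; [apply Cmod_ge_0|exact H1].
  + rewrite Rpow_mult_distr; lra.
Qed.

Lemma mean_sq_zsum (u : C -> C) : wien u ->
  mean_sq u = Re (zsum (fun k => fourier u k * Cconj (fourier u k))).
Proof.
intros Hu; unfold mean_sq; rewrite circle_int_mult by (exact Hu || apply ccirc_conj, Hu).
apply (f_equal Re), zsum_ext; intros k; rewrite fourier_conj by apply Hu.
now rewrite Z.opp_involutive.
Qed.

Lemma expdec_sq (u : C -> C) : wien u -> expdec (fun k => fourier u k * Cconj (fourier u k)).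
Proof.
intros Hu; apply (expdec_mult (fourier u) (fun k => Cconj (fourier u k))); [apply Hu|].
destruct (fourier_bounded u (proj1 Hu)) as [M HM]; exists M; intros k; now rewrite Cmod_conj.
Qed.

Lemma Re_Csum (u : nat -> C) : Re (Csum u) = Series (fun k => Re (u k)).
Proof. reflexivity. Qed.

Lemma mean_sq_ser_neg (f : nat -> C) : decays f -> mean_sq (ser_neg f) = nsq f.
Proof.
intros Hf; rewrite mean_sq_zsum by now apply wien_ser_neg.
rewrite zsum_neg.
- rewrite Re_Csum; apply Series_ext; intros k.
  rewrite fourier_ser_neg, <- Cmod2_conj by exact Hf; reflexivity.
- now apply expdec_sq, wien_ser_neg.
- intros k Hk; rewrite freq_le_ser_neg by (exact Hf || lia); ring.
Qed.

Lemma mean_sq_part_pos (u : C -> C) : wien u ->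
  mean_sq (freq_part (fun k => 0 <? k)%Z u) = nsq (fun j => fourier u (Z.of_nat j + 1)).
Proof.
intros Hu; assert (Hp := wien_part (fun k => 0 <? k)%Z u Hu).
rewrite mean_sq_zsum by exact Hp.
rewrite zsum_pos.
- rewrite Re_Csum; apply Series_ext; intros k.
  rewrite fourier_part by exact Hu.
  replace (0 <? Z.of_nat k + 1)%Z with true by (symmetry; apply Z.ltb_lt; lia).
  rewrite <- Cmod2_conj; reflexivity.
- now apply expdec_sq.
- intros k Hk; rewrite fourier_part by exact Hu.
  replace (0 <? k)%Z with false by (symmetry; apply Z.ltb_ge; lia); ring.
Qed.

Lemma mean_sq_nonneg (u : C -> C) : ccirc u -> (0 <= mean_sq u)%R.
Proof.
intros Hu.
destruct (mean_sq_RInt u Hu) as [-> Eu]; assert (HP := PI_RGT_0).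
apply Rmult_le_pos; [apply Rlt_le, Rinv_0_lt_compat; lra|].
apply RInt_ge_0; [lra|exact Eu|]; intros t _; apply pow2_ge_0.
Qed.

Lemma mean_sq_split (P : Z -> bool) (u : C -> C) : wien u ->
  mean_sq u = (mean_sq (freq_part P u) + mean_sq (freq_part (fun k => negb (P k)) u))%R.
Proof.
intros Hu; assert (H1 := wien_part P u Hu); assert (H2 := wien_part (fun k => negb (P k)) u Hu).
rewrite (mean_sq_zsum u Hu), (mean_sq_zsum _ H1), (mean_sq_zsum _ H2).
set (a := fun k => fourier u k * Cconj (fourier u k)).
assert (Ha : expdec a) by exact (expdec_sq u Hu).
set (b := fun P : Z -> bool => fun k => if P k then a k else 0).
assert (Hb : forall P, expdec (b P)).
{ intros Q; destruct Ha as [K [r H]]; exists K, r; split; [apply H|]; intros k.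
  unfold b; destruct (Q k); [apply H|]. rewrite Cmod_0.
  apply Rmult_le_pos; [now apply geom_le_nonneg in H|apply pow_le; destruct H; lra]. }
assert (Eb : forall P, zsum (fun k => fourier (freq_part P u) k * Cconj (fourier (freq_part P u) k)) = zsum (b P)).
{ intros Q; apply zsum_ext; intros k; rewrite fourier_part by exact Hu; unfold b, a.
  destruct (Q k); [reflexivity|ring]. }
rewrite !Eb.
destruct (Hb P) as [K [r H]]; destruct (Hb (fun k => negb (P k))) as [K' [r' H']].
transitivity (Re (zsum (b P) + zsum (b (fun k => negb (P k))))); [|reflexivity].
f_equal; unfold zsum.
rewrite <- (Csum_plus _ _ _ _ (geom_le_pair_dominated _ _ _ H) (geom_le_pair_dominated _ _ _ H')).
apply Csum_ext; intros k; unfold b.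
destruct (P (Z.of_nat k)), (P (- Z.of_nat k - 1)%Z); simpl; ring.
Qed.

Lemma mean_sq_part_le (P : Z -> bool) (u : C -> C) : wien u -> (mean_sq (freq_part P u) <= mean_sq u)%R.
Proof.
intros Hu; rewrite (mean_sq_split P u Hu).
assert (0 <= mean_sq (freq_part (fun k => negb (P k)) u))%R; [|lra].
now apply mean_sq_nonneg, wien_part.
Qed.

Lemma part_split (P : Z -> bool) (u : C -> C) (z : C) : wien u -> Cmod z = 1%R ->
  u z = freq_part P u z + freq_part (fun k => negb (P k)) u z.
Proof.
intros Hu; revert z; apply fourier_inj; [apply Hu|apply ccirc_plus; now apply wien_part|].
intros k; rewrite fourier_plus, !fourier_part by (assumption || now apply wien_part).
destruct (P k); simpl; ring.
Qed.

(** * Cauchy's formula in the disk *)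

Lemma freq_ge_synth (u : C -> C) (b : C) : wien u -> freq_ge 0 u -> Cmod b = 1%R ->
  u b = fourier u 0 + Csum (fun m => fourier u (Z.of_nat m + 1) * b ^ S m).
Proof.
intros Hu Hf Hb; rewrite (wien_inversion u b Hu Hb) at 1; unfold synth.
destruct (proj2 Hu) as [K [r H]].
assert (D := geom_le_dominated_pos _ _ _ (geom_le_synth _ _ _ b H Hb)); simpl in D.
unfold zsum; rewrite (Csum_ext _ (fun m => fourier u (Z.of_nat m) * zpow b (Z.of_nat m))).
- rewrite (Csum_incr_1 _ _ D); f_equal; [simpl; ring|].
  apply Csum_ext; intros m; rewrite <- zpow_of_nat; do 2 f_equal; lia.
- intros m; rewrite (Hf (- Z.of_nat m - 1)%Z) by lia; ring.
Qed.

Lemma circle_int_cauchy (u : C -> C) (z : C) : (Cmod z < 1)%R -> ccirc u ->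
  circle_int (fun b => z / (b - z) * u b) = Csum (fun m => fourier u (Z.of_nat m + 1) * z ^ S m).
Proof.
intros Hz Hu.
rewrite (circle_int_ext _ (fun b => synth (cauchy_coeff z) b * u b))
  by (intros b Hb; now rewrite synth_cauchy).
rewrite circle_int_synth_mult by (exact Hu || now apply expdec_cauchy).
apply Csum_ext; intros m; unfold cauchy_coeff.
replace (Z.of_nat m <? 0)%Z with false by (symmetry; apply Z.ltb_ge; lia).
replace (- Z.of_nat m - 1 <? 0)%Z with true by (symmetry; apply Z.ltb_lt; lia).
replace (Z.abs_nat (- Z.of_nat m - 1)) with (S m) by lia.
replace (- (- Z.of_nat m - 1))%Z with (Z.of_nat m + 1)%Z by lia; ring.
Qed.

(** Fourier inversion recovers values on the circle only. It is therefore applied to the dilation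
    [g w = f (|z| w)] at the point [z / |z|]; the coefficients of [g] are [|z|^k] times those of
    [f], by independence of the radius. At [z = 0] the dilation degenerates, so this case comes
    first. *)
Lemma cauchy_formula (f : C -> C) (e : R) (z : C) : (0 < e < 1)%R ->
  holo_on (fun w => (Cmod w < 1 + e)%R) f -> (Cmod z < 1)%R ->
  circle_int (fun b => z / (b - z) * f b) = f z - f 0.
Proof.
intros He Hf Hz.
destruct (wien_freq_of_radius f e He Hf) as [Hw [Hge H0]].
rewrite circle_int_cauchy by (exact Hz || apply Hw).
destruct (Req_dec (Cmod z) 0) as [Hz0|Hz0].
{ apply Cmod_eq_0 in Hz0; subst z.
  rewrite (Csum_ext _ (fun _ => 0)) by (intros; rewrite Cpow_S; ring).
  rewrite Csum_0; ring. }
set (s := Cmod z) in *.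
assert (Hs : (0 < s)%R) by (generalize (Cmod_ge_0 z); fold s; lra).
destruct (polar z) as [b [Hb Ez]]; fold s in Ez.
set (g := fun w => f (RtoC s * w)).
assert (Hg : holo_on (fun w => (Cmod w < 1 + e)%R) g).
{ apply (holo_on_comp _ _ f (fun w => RtoC s * w) Hf).
  - apply holo_on_mult; [apply holo_on_const|apply holo_on_id].
  - intros w Hww; rewrite Cmod_mult, Cmod_R, Rabs_pos_eq by lra.
    assert (0 <= Cmod w)%R by apply Cmod_ge_0; nra. }
destruct (wien_freq_of_radius g e He Hg) as [Hgw [Hgge Hg0]].
assert (Eg : forall k, fourier g k = zpow (RtoC s) k * fourier f k).
{ intros k.
  assert (Hsc : RtoC s <> 0) by (apply RtoC_neq_0; lra).
  assert (E1 : fourier f k = circle_int (fun b => zpow (RtoC 1 * b) (- k) * f (RtoC 1 * b))).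
  { apply circle_int_ext; intros w _; now rewrite Cmult_1_l. }
  rewrite E1, <- (circle_int_radius f s 1); try lra.
  - rewrite <- circle_int_scal.
    + apply circle_int_ext; intros w Hww; unfold g.
      rewrite (zpow_mult _ _ _ Hsc (circle_neq_0 w Hww)), (zpow_opp _ k Hsc).
      field; now apply zpow_neq_0.
    + apply (ccirc_ext (fun w => zpow (RtoC s) (- k) * (zpow w (- k) * g w))).
      * intros w Hww; unfold g; rewrite zpow_mult by (assumption || now apply circle_neq_0); ring.
      * apply ccirc_mult; [apply ccirc_const|].
        apply ccirc_mult; [apply ccirc_zpow|apply Hgw].
  - apply (holo_on_subset _ _ _ Hf); unfold annulus; intros w Hww; lra.
  - apply (cont_on_of_holo_on _ _ _ Hf); unfold cannulus; intros w Hww; lra. }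
assert (E := freq_ge_synth g b Hgw Hgge Hb); unfold g at 1 in E; rewrite <- Ez in E.
rewrite E, Hg0; unfold g at 1; rewrite Cmult_0_r.
rewrite (Csum_ext (fun m => fourier g (Z.of_nat m + 1) * b ^ S m)
  (fun m => fourier f (Z.of_nat m + 1) * z ^ S m)); [ring|].
intros m; rewrite Eg; replace (Z.of_nat m + 1)%Z with (Z.of_nat (S m)) by lia.
rewrite zpow_of_nat, Ez, Cpow_mult_l; ring.
Qed.

(** * Hankel operators with symbol [kappa * D / Cconj D] *)

Section Hankel.
Variables (D psi : C -> C) (kappa : C).
Hypotheses (HD : wien D) (HDi : wien (fun z => / D z))
  (FD : freq_ge 0 D) (FDi : freq_ge 0 (fun z => / D z))
  (D_neq_0 : forall z, D z <> 0) (kappa_neq_0 : kappa <> 0)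
  (Hpsi : forall z, Cmod z = 1%R -> psi z = kappa * D z / Cconj (D z)).

Let Dc (z : C) : C := Cconj (D z).

Lemma Dc_neq_0 (z : C) : Dc z <> 0.
Proof.
exact (Cconj_neq_0 _ (D_neq_0 z)).
Qed.

Lemma wien_Dc : wien Dc.
Proof. exact (wien_conj D HD). Qed.

Lemma wien_Dc_inv : wien (fun z => / Dc z).
Proof.
apply (wien_ext (fun z => Cconj (/ D z))); [|exact (wien_conj _ HDi)].
intros z _; apply Cinv_conj, D_neq_0.
Qed.

Lemma freq_le_Dc : freq_le 0 Dc.
Proof. exact (freq_le_conj D 0 (proj1 HD) FD). Qed.

Lemma freq_le_Dc_inv : freq_le 0 (fun z => / Dc z).
Proof.
apply (freq_le_ext (fun z => Cconj (/ D z))).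
- intros z _; apply Cinv_conj, D_neq_0.
- exact (freq_le_conj _ 0 (proj1 HDi) FDi).
Qed.

Lemma wien_psi : wien psi.
Proof.
apply (wien_ext (fun z => kappa * (D z * / Dc z))).
- intros z Hz; rewrite Hpsi by exact Hz; unfold Dc, Cdiv; ring.
- exact (wien_scal _ _ (wien_mult _ _ HD wien_Dc_inv)).
Qed.

Lemma psi_inv (z : C) : Cmod z = 1%R -> / psi z = / kappa * (Dc z * / D z).
Proof.
intros Hz; rewrite Hpsi by exact Hz; assert (H1 := D_neq_0 z); assert (H2 := Dc_neq_0 z).
unfold Dc in *; field; repeat split; assumption.
Qed.

Lemma wien_psi_inv : wien (fun z => / psi z).
Proof.
apply (wien_ext (fun z => / kappa * (Dc z * / D z))).
- intros z Hz; symmetry; now apply psi_inv.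
- exact (wien_scal _ _ (wien_mult _ _ wien_Dc HDi)).
Qed.

Lemma psi_neq_0 (z : C) : Cmod z = 1%R -> psi z <> 0.
Proof.
intros Hz; rewrite Hpsi by exact Hz; assert (H1 := D_neq_0 z); assert (H2 := Dc_neq_0 z).
unfold Cdiv; repeat apply Cmult_neq_0; try assumption.
now apply Cinv_neq_0.
Qed.

(* [psi] has constant modulus on the circle. *)
Lemma psi_conj (z : C) : Cmod z = 1%R -> Cconj (/ psi z) = RtoC (/ Cmod kappa ^ 2) * psi z.
Proof.
intros Hz; assert (Hp := psi_neq_0 z Hz).
assert (Hk : (Cmod kappa <> 0)%R) by (apply Rgt_not_eq; now apply Cmod_gt_0).
assert (Hk2 : RtoC (Cmod kappa ^ 2) <> 0) by now apply RtoC_neq_0, pow_nonzero.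
rewrite RtoC_inv by now apply pow_nonzero.
assert (Hkc := Cconj_neq_0 _ kappa_neq_0).
rewrite psi_inv, Hpsi by exact Hz; fold (Dc z).
assert (H1 := D_neq_0 z); assert (H2 := Dc_neq_0 z).
rewrite Cmult_conj, Cmult_conj, !Cinv_conj by assumption.
unfold Dc at 1; rewrite Cconj_conj; fold (Dc z).
rewrite Cmod2_conj; field; repeat split; assumption.
Qed.

Lemma kerB_conj (m k : nat) : kerB psi m k = RtoC (Cmod kappa ^ 2) * Cconj (kerA psi m k).
Proof.
assert (Hk : (Cmod kappa <> 0)%R) by (apply Rgt_not_eq; now apply Cmod_gt_0).
assert (Hk2 : (Cmod kappa ^ 2 <> 0)%R) by now apply pow_nonzero.
unfold kerA, kerB.
rewrite <- (Z.opp_involutive (Z.of_nat (m + k + 1))), <- fourier_conj by apply wien_psi_inv.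
rewrite (fourier_ext (fun z => Cconj (/ psi z)) _ _ psi_conj), fourier_scal by apply wien_psi.
rewrite Cmult_assoc, <- RtoC_mult, Rinv_r, Cmult_1_l by exact Hk2.
f_equal; lia.
Qed.

(** One pair of constants serves both kernels, as the Neumann series requires; the maximum absorbs
    the factor [|kappa|^2] of [kerB_conj]. *)
Lemma kernels_le : exists K r, kernel_le (kerA psi) K r /\ kernel_le (kerB psi) K r.
Proof.
destruct (proj2 wien_psi_inv) as [K [r H]].
assert (HK := geom_le_nonneg _ _ _ H); destruct H as [Hr H].
assert (Hb : forall j m, (Cmod (kerA psi j m) <= K * r ^ j * r ^ m)%R).
{ intros j m; eapply Rle_trans; [apply H|].
  rewrite Zabs2Nat.id, Rmult_assoc, <- pow_add; apply Rmult_le_compat_l; [exact HK|].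
  apply pow_le_pow_lt1; lra || lia. }
set (K' := Rmax K (Cmod kappa ^ 2 * K)).
assert (H1 := Rmax_l K (Cmod kappa ^ 2 * K)); assert (H2 := Rmax_r K (Cmod kappa ^ 2 * K)).
assert (Hp : forall j, (0 <= r ^ j)%R) by (intros; apply pow_le; lra).
exists K', r; split; (split; [exact Hr|split; [unfold K'; lra|]]); intros j m.
- eapply Rle_trans; [apply Hb|]; repeat apply Rmult_le_compat_r; auto.
- rewrite kerB_conj, Cmod_mult, Cmod_conj, Cmod_R, Rabs_pos_eq by apply pow2_ge_0.
  apply Rle_trans with (Cmod kappa ^ 2 * (K * r ^ j * r ^ m))%R.
  + apply Rmult_le_compat_l; [apply pow2_ge_0|apply Hb].
  + rewrite <- !Rmult_assoc; repeat apply Rmult_le_compat_r; auto.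
Qed.

(* With [v = (conj D / D) u] and [v_-] its part of frequency [<= 0],
   [conj D * u] is the part of [D v_-] of frequency [<= 0]; so [|u| <= M |v_-|]
   while [|u|^2 = |v|^2 = |v_+|^2 + |v_-|^2]. *)
Lemma kerA_contract : exists theta, (0 < theta < 1)%R /\ forall g, decays g ->
  (Cmod kappa ^ 2 * nsq (kernel_op (kerA psi) g) <= theta * nsq g)%R.
Proof.
destruct (ccirc_bounded D (proj1 HD)) as [M1 [HM1 HB1]].
destruct (ccirc_bounded (fun z => / D z) (proj1 HDi)) as [M2 [HM2 HB2]].
(* [M1] and [M2] bound [D] and its inverse on the circle; the added 1 makes [W > 1], so that
   [1 - / W] lies strictly between 0 and 1. *)
set (W := (M2 ^ 2 * M1 ^ 2 + 1)%R).
assert (HW : (1 < W)%R).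
{ assert (0 < M2 ^ 2 * M1 ^ 2)%R by (apply Rmult_lt_0_compat; now apply pow_lt). unfold W; lra. }
exists (1 - / W)%R; split.
{ assert (0 < / W)%R by (apply Rinv_0_lt_compat; lra).
  assert (/ W < 1)%R by (rewrite <- Rinv_1; apply Rinv_lt_contravar; lra). lra. }
intros g Hg.
set (u := ser_neg g); assert (Hu : wien u) by exact (wien_ser_neg g Hg).
set (v := fun z => Dc z * / D z * u z).
assert (Hv : wien v) by exact (wien_mult _ _ (wien_mult _ _ wien_Dc HDi) Hu).
set (neg := fun k : Z => negb (0 <? k)%Z).
set (vp := freq_part (fun k => 0 <? k)%Z v); set (vm := freq_part neg v).
assert (Hvp : wien vp) by exact (wien_part _ v Hv).
assert (Hvm : wien vm) by exact (wien_part _ v Hv).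
assert (E1 : (Cmod kappa ^ 2 * nsq (kernel_op (kerA psi) g) = mean_sq vp)%R).
{ unfold vp; rewrite (mean_sq_part_pos v Hv); unfold nsq; rewrite <- Series_scal_l.
  apply Series_ext; intros j; rewrite kernel_op_kerA by (exact Hg || apply wien_psi_inv).
  rewrite <- Rpow_mult_distr, <- Cmod_mult, <- fourier_scal
    by (apply ccirc_mult; [apply Hu|apply wien_psi_inv]).
  f_equal; f_equal; apply fourier_ext; intros z Hz; rewrite psi_inv by exact Hz.
  unfold v, u; field; split; [apply D_neq_0|exact kappa_neq_0]. }
assert (Hmod : forall z, Cmod (v z) = Cmod (u z)).
{ intros z; unfold v, Dc.
  assert (H0 : (Cmod (D z) <> 0)%R) by (apply Rgt_not_eq, Cmod_gt_0, D_neq_0).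
  rewrite !Cmod_mult, Cmod_conj, Cmod_inv by apply D_neq_0; field; exact H0. }
assert (E2 : mean_sq v = nsq g).
{ rewrite <- (mean_sq_ser_neg g Hg); fold u.
  assert (Hle : forall a b, ccirc a -> ccirc b -> (forall z, Cmod (a z) = Cmod (b z)) ->
    (mean_sq a <= mean_sq b)%R).
  { intros a b Ha Hb Hab; replace (mean_sq b) with (1 ^ 2 * mean_sq b)%R by ring.
    apply mean_sq_le; [exact Ha|exact Hb|lra|]; intros z _; rewrite Hab; lra. }
  apply Rle_antisym; apply Hle; (apply Hv || apply Hu || intros z; now rewrite Hmod). }
assert (E3 : mean_sq v = (mean_sq vp + mean_sq vm)%R) by exact (mean_sq_split _ v Hv).
set (Dvm := fun z => D z * vm z); assert (HDvm : wien Dvm) by exact (wien_mult _ _ HD Hvm).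
(* [Dc * u = D * v], and the left side has frequencies [<= 0] while [D * vp] has only positive ones:
   truncating [D * v] removes [D * vp] and changes nothing else on the left. *)
assert (Ew : forall z, Cmod z = 1%R -> Dc z * u z = freq_part neg Dvm z).
{ apply fourier_inj.
  - exact (ccirc_mult _ _ (proj1 wien_Dc) (proj1 Hu)).
  - exact (proj1 (wien_part neg Dvm HDvm)).
  - intros k; rewrite (fourier_part neg Dvm k HDvm); unfold neg.
    destruct (Z.ltb_spec 0 k) as [Hk|Hk]; simpl.
    + apply (freq_le_mult Dc u 0 0 wien_Dc (proj1 Hu) freq_le_Dc (freq_le_ser_neg g Hg)); lia.
    + assert (Es : forall z, Cmod z = 1%R -> Dc z * u z = D z * vp z + Dvm z).
      { intros z Hz; unfold Dvm.
        transitivity (D z * v z); [unfold v; field; apply D_neq_0|].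
        rewrite (part_split (fun k => 0 <? k)%Z v z Hv Hz); fold vp; fold neg; fold vm; ring. }
      rewrite (fourier_ext _ _ k Es), fourier_plus by
        (apply HDvm || exact (ccirc_mult _ _ (proj1 HD) (proj1 Hvp))).
      rewrite (freq_ge_mult D vp 0 1 HD (proj1 Hvp) FD); [ring| |lia].
      intros i Hi; unfold vp; rewrite (fourier_part _ v i Hv).
      destruct (Z.ltb_spec 0 i); [lia|reflexivity]. }
assert (L1 : (mean_sq u <= M2 ^ 2 * mean_sq (freq_part neg Dvm))%R).
{ apply mean_sq_le; [apply Hu|apply (wien_part neg Dvm HDvm)|lra|].
  intros z Hz; rewrite <- (Ew z Hz), Cmod_mult.
  unfold Dc; rewrite Cmod_conj.
  assert (H0 : (0 < Cmod (D z))%R) by apply Cmod_gt_0, D_neq_0.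
  specialize (HB2 z Hz); rewrite Cmod_inv in HB2 by apply D_neq_0.
  rewrite <- Rmult_assoc; rewrite <- (Rmult_1_l (Cmod (u z))) at 1.
  apply Rmult_le_compat_r; [apply Cmod_ge_0|].
  apply Rmult_le_reg_l with (/ Cmod (D z))%R; [now apply Rinv_0_lt_compat|].
  replace (/ Cmod (D z) * (M2 * Cmod (D z)))%R with M2 by (field; lra); lra. }
assert (L2 : (mean_sq (freq_part neg Dvm) <= mean_sq Dvm)%R) by exact (mean_sq_part_le neg Dvm HDvm).
assert (L3 : (mean_sq Dvm <= M1 ^ 2 * mean_sq vm)%R).
{ apply mean_sq_le; [apply HDvm|apply Hvm|lra|]; intros z Hz; unfold Dvm; rewrite Cmod_mult.
  apply Rmult_le_compat_r; [apply Cmod_ge_0|now apply HB1]. }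
assert (Eu : mean_sq u = nsq g) by exact (mean_sq_ser_neg g Hg).
assert (Hvm0 := mean_sq_nonneg vm (proj1 Hvm)).
assert (L4 : (nsq g <= W * mean_sq vm)%R).
{ rewrite <- Eu; eapply Rle_trans; [exact L1|].
  apply Rle_trans with (M2 ^ 2 * (M1 ^ 2 * mean_sq vm))%R.
  - apply Rmult_le_compat_l; [apply pow2_ge_0|lra].
  - unfold W; lra. }
rewrite E1.
assert (L5 : (/ W * nsq g <= mean_sq vm)%R).
{ apply Rmult_le_reg_l with W; [lra|]. rewrite <- Rmult_assoc, Rinv_r by lra; lra. }
lra.
Qed.

Lemma decays_conj (f : nat -> C) : decays f -> decays (fun i => Cconj (f i)).
Proof.
intros [K [r [Hr [HK H]]]]; exists K, r; repeat split; try lra.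
intros j; rewrite Cmod_conj; apply H.
Qed.

Lemma kernel_op_kerB_conj (f : nat -> C) (m : nat) : ell2 f ->
  kernel_op (kerB psi) f m =
  RtoC (Cmod kappa ^ 2) * Cconj (kernel_op (kerA psi) (fun i => Cconj (f i)) m).
Proof.
intros Hf; destruct kernels_le as [K [r [HA _]]].
assert (Hfc : ell2 (fun i => Cconj (f i))).
{ apply (ell2_le _ f Hf); intros j; rewrite Cmod_conj; lra. }
unfold kernel_op.
assert (Dm := kernel_dominated _ K r HA _ m Hfc).
assert (Dm' : dominated (fun k => Cconj (kerA psi m k * Cconj (f k)))
   (fun m0 => K * r ^ m * ell2_norm (fun i => Cconj (f i)) * r ^ m0)%R).
{ split; [apply Dm|]; intros k; rewrite Cmod_conj; apply Dm. }
rewrite <- Csum_conj, <- (Csum_scal _ _ _ Dm').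
apply Csum_ext; intros k; rewrite kerB_conj, Cmult_conj, Cconj_conj; ring.
Qed.

(** By [kernel_op_kerB_conj], [B] is [|kappa|^2] times the conjugate of [A], so [kerA_contract]
    controls both factors; the powers of [|kappa|] cancel, and [theta^2 <= theta]. *)
Lemma hankel_contract : exists theta, (0 < theta < 1)%R /\ forall f, decays f ->
  (nsq (kernel_op (kerA psi) (kernel_op (kerB psi) f)) <= theta * nsq f)%R.
Proof.
destruct kerA_contract as [theta [Hth H]].
exists theta; split; [exact Hth|]; intros f Hf.
destruct kernels_le as [K [r [HA HB]]].
assert (Hk : (0 < Cmod kappa ^ 2)%R) by (apply pow_lt; now apply Cmod_gt_0).
assert (Hfc := decays_conj f Hf).
set (g := kernel_op (kerA psi) (fun i => Cconj (f i))).
assert (HBf : decays (kernel_op (kerB psi) f))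
  by exact (decays_kernel_op _ K r f HB (decays_ell2 f Hf)).
assert (H1 := H _ HBf); assert (H2 := H _ Hfc); fold g in H2.
assert (E1 : nsq (fun i => Cconj (f i)) = nsq f).
{ apply Series_ext; intros k; now rewrite Cmod_conj. }
assert (E2 : nsq (kernel_op (kerB psi) f) = ((Cmod kappa ^ 2) ^ 2 * nsq g)%R).
{ unfold nsq; rewrite <- Series_scal_l; apply Series_ext; intros k.
  rewrite kernel_op_kerB_conj by now apply decays_ell2.
  fold g; rewrite Cmod_mult, Cmod_conj, Cmod_R, Rabs_pos_eq, Rpow_mult_distr by lra; reflexivity. }
rewrite E1 in H2; rewrite E2 in H1.
set (k := (Cmod kappa ^ 2)%R) in *.
assert (H3 : (theta * (k ^ 2 * nsq g) <= theta * (k * (theta * nsq f)))%R).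
{ apply Rmult_le_compat_l; [lra|]. replace (k ^ 2 * nsq g)%R with (k * (k * nsq g))%R by ring.
  apply Rmult_le_compat_l; lra. }
assert (Hn := nsq_nonneg f (decays_ell2 f Hf)).
apply Rmult_le_reg_l with k; [exact Hk|].
eapply Rle_trans; [exact H1|]; eapply Rle_trans; [exact H3|].
replace (theta * (k * (theta * nsq f)))%R with (k * (theta * (theta * nsq f)))%R by ring.
apply Rmult_le_compat_l; [lra|].
apply Rmult_le_compat_l; [lra|]. nra.
Qed.

Lemma one_minus_PABP_invertible (n : nat) : exists S, is_inverse_op (one_minus_PABP psi n) S.
Proof.
destruct kernels_le as [K [r [HA HB]]]; destruct hankel_contract as [theta [Hth Hc]].
exists (neumann (kerA psi) (kerB psi) n).
exact (neumann_inverse _ _ K r theta n HA HB Hth Hc).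
Qed.

Lemma decays_mult (f g : nat -> C) : decays f -> decays g ->
  exists M, dominated (fun j => f j * g j) M.
Proof.
intros [K [r [Hr [HK H]]]] [K' [r' [Hr' [HK' H']]]].
exists (fun j => K * K' * (r * r') ^ j)%R; split; [apply ex_series_geom_scal; nra|].
intros j; rewrite Cmod_mult, Rpow_mult_distr.
replace (K * K' * (r ^ j * r' ^ j))%R with (K * r ^ j * (K' * r' ^ j))%R by ring.
apply Rmult_le_compat; auto using Cmod_ge_0.
Qed.

Lemma decays_fourier (u : C -> C) (f : nat -> C) (l : nat -> Z) : wien u ->
  (forall j, f j = fourier u (l j)) -> (forall j, (j <= Z.abs_nat (l j))%nat) -> decays f.
Proof.
intros [_ [K [r H]]] Hf Hl; assert (HK := geom_le_nonneg _ _ _ H); destruct H as [Hr H].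
exists K, r; repeat split; try lra; intros j; rewrite Hf.
eapply Rle_trans; [apply H|]; apply Rmult_le_compat_l; [exact HK|].
apply pow_le_pow_lt1; [lra|apply Hl].
Qed.

Lemma decays_kerA (f : nat -> C) : decays f -> decays (kernel_op (kerA psi) f).
Proof.
intros Hf; destruct kernels_le as [K [r [HA _]]].
exact (decays_kernel_op _ K r f HA (decays_ell2 f Hf)).
Qed.

Lemma decays_kerB (f : nat -> C) : decays f -> decays (kernel_op (kerB psi) f).
Proof.
intros Hf; destruct kernels_le as [K [r [_ HB]]].
exact (decays_kernel_op _ K r f HB (decays_ell2 f Hf)).
Qed.

(** Both sides are the coefficient of frequency 1 of [ser_neg f * ser_neg g / psi], which is
    symmetric in [f] and [g]; this replaces the exchange of a double sum. *)
Lemma kerA_symmetric (f g : nat -> C) : decays f -> decays g ->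
  Csum (fun j => kernel_op (kerA psi) g j * f j) = Csum (fun j => kernel_op (kerA psi) f j * g j).
Proof.
assert (H : forall f g, decays f -> decays g ->
  Csum (fun j => kernel_op (kerA psi) g j * f j) =
  fourier (fun z => ser_neg f z * (ser_neg g z * / psi z)) 1).
{ clear f g; intros f g Hf Hg.
  rewrite <- (Csum_ser_neg f (fun z => ser_neg g z * / psi z)) by
    (exact Hf || exact (ccirc_mult _ _ (proj1 (wien_ser_neg g Hg)) (proj1 wien_psi_inv))).
  apply Csum_ext; intros k; rewrite kernel_op_kerA by (exact Hg || apply wien_psi_inv).
  now rewrite Z.add_comm. }
intros Hf Hg; rewrite !H by assumption.
apply fourier_ext; intros; ring.
Qed.

Lemma kerB_symmetric (f g : nat -> C) : decays f -> decays g ->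
  Csum (fun j => kernel_op (kerB psi) g j * f j) = Csum (fun j => kernel_op (kerB psi) f j * g j).
Proof.
assert (H : forall f g, decays f -> decays g ->
  Csum (fun j => kernel_op (kerB psi) g j * f j) =
  fourier (fun z => ser_pos f z * (ser_pos g z * psi z)) 1).
{ clear f g; intros f g Hf Hg.
  rewrite <- (Csum_ser_pos f (fun z => ser_pos g z * psi z)) by
    (exact Hf || exact (ccirc_mult _ _ (proj1 (wien_ser_pos g Hg)) (proj1 wien_psi))).
  apply Csum_ext; intros k; rewrite kernel_op_kerB by (exact Hg || apply wien_psi).
  replace (1 - Z.of_nat k - 1)%Z with (- Z.of_nat k)%Z by lia; reflexivity. }
intros Hf Hg; rewrite !H by assumption.
apply fourier_ext; intros; ring.
Qed.

Lemma decays_seqQ : decays (seqQ psi).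
Proof.
apply (decays_fourier _ _ (fun j => Z.of_nat (j + 1)) wien_psi_inv); [reflexivity|intros; lia].
Qed.

Lemma decays_seqV : decays (seqV psi).
Proof.
apply (decays_fourier _ _ (fun j => - Z.of_nat j - 1)%Z wien_psi); [reflexivity|intros; lia].
Qed.

Lemma wien_cauchy (z : C) : (Cmod z < 1)%R -> wien (fun b => z / (b - z)).
Proof.
intros Hz; apply (wien_ext (synth (cauchy_coeff z))).
- intros b Hb; now apply synth_cauchy.
- now apply wien_synth, expdec_cauchy.
Qed.

(** The frequency is written [0 - k - 1] to match [Csum_ser_pos] at [j = 0]. *)
Lemma seqR_fourier (z : C) (k : nat) : (Cmod z < 1)%R ->
  seqR psi z k = fourier (fun b => z / (b - z) * psi b) (0 - Z.of_nat k - 1).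
Proof.
intros Hz; apply circle_int_ext; intros b Hb.
replace (- (0 - Z.of_nat k - 1))%Z with (Z.of_nat (k + 1)) by lia.
rewrite zpow_of_nat; ring.
Qed.

Lemma decays_seqR (z : C) : (Cmod z < 1)%R -> decays (seqR psi z).
Proof.
intros Hz; apply (decays_fourier _ _ (fun j => 0 - Z.of_nat j - 1)%Z
  (wien_mult _ _ (wien_cauchy z Hz) wien_psi)); [intros; now apply seqR_fourier|intros; lia].
Qed.

(** On the circle conjugation replaces [b] by [1 / b] and [psi] by [|kappa|^2 / psi], which carries
    the integrand of [R] at [1 / conj z] into a multiple of that of [U] at [z]. *)
Lemma seqU_conj (z : C) (j : nat) : (1 < Cmod z)%R ->
  RtoC (Cmod kappa ^ 2) * seqU psi z j = Cconj (seqR psi (/ Cconj z) j).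
Proof.
intros Hz.
destruct (Cmod_inv_conj_lt z Hz) as [Hz0 Hw]; assert (Hzc := Cconj_neq_0 z Hz0).
assert (Hk : (Cmod kappa <> 0)%R) by (apply Rgt_not_eq; now apply Cmod_gt_0).
assert (Hcc : ccirc (fun b => b ^ (j + 1) * (/ Cconj z / (b - / Cconj z)) * psi b)).
{ apply ccirc_mult; [apply ccirc_mult; [apply ccirc_pow|apply (wien_cauchy _ Hw)]|apply wien_psi]. }
assert (Hkr : RtoC (Cmod kappa ^ 2) <> 0) by now apply RtoC_neq_0, pow_nonzero.
assert (E : forall b, Cmod b = 1%R ->
  Cconj (b ^ (j + 1) * (/ Cconj z / (b - / Cconj z)) * psi b) =
  RtoC (Cmod kappa ^ 2) * (zpow b (- Z.of_nat j - 1) * (b / (z - b)) * / psi b)).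
{ intros b Hb; assert (Hb0 := circle_neq_0 b Hb).
  assert (Hzb : z - b <> 0).
  { apply Csub_neq_0; intros ->; lra. }
  assert (Hbw : b - / Cconj z <> 0).
  { apply Csub_neq_0; intros E; rewrite <- E, Hb in Hw; lra. }
  assert (Hp : Cconj (psi b) = RtoC (Cmod kappa ^ 2) * / psi b).
  { assert (E := psi_conj b Hb); rewrite Cinv_conj in E by now apply psi_neq_0.
    assert (Hpb := psi_neq_0 b Hb).
    assert (Hpc := Cconj_neq_0 _ Hpb).
    rewrite RtoC_inv in E by now apply pow_nonzero.
    transitivity (/ (/ Cconj (psi b))); [field; exact Hpc|].
    rewrite E; field; split; assumption. }
  rewrite !Cmult_conj, Hp, Cdiv_conj, Cminus_conj, Cinv_conj, Cconj_conj by assumption.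
  rewrite <- zpow_of_nat, zpow_conj by exact Hb.
  replace (- Z.of_nat (j + 1))%Z with (- Z.of_nat j - 1)%Z by lia.
  rewrite (circle_conj b Hb).
  assert (Hi : / b - / z <> 0).
  { replace (/ b - / z) with ((z - b) * / (b * z)) by (field; split; assumption).
    apply Cmult_neq_0; [exact Hzb|]; now apply Cinv_neq_0, Cmult_neq_0. }
  replace (/ z / (/ b - / z)) with (b / (z - b)); [ring|].
  field; repeat split; try assumption. }
unfold seqR; rewrite <- circle_int_conj by exact Hcc.
rewrite (circle_int_ext _ _ E); unfold seqU; rewrite circle_int_scal; [reflexivity|].
(* Continuity of the integrand of [U] is read off from that of [R] through [E]. *)
apply (ccirc_ext (fun b => / RtoC (Cmod kappa ^ 2) *
  Cconj (b ^ (j + 1) * (/ Cconj z / (b - / Cconj z)) * psi b))).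
- intros b Hb; rewrite (E b Hb); field; split; [now apply psi_neq_0|split; [|exact Hkr]].
  apply Csub_neq_0; intros ->; lra.
- apply ccirc_mult; [apply ccirc_const|exact (ccirc_conj _ Hcc)].
Qed.

Lemma decays_seqU (z : C) : (1 < Cmod z)%R -> decays (seqU psi z).
Proof.
intros Hz.
destruct (Cmod_inv_conj_lt z Hz) as [_ Hw].
destruct (decays_conj _ (decays_seqR _ Hw)) as [K [r [Hr [HK H]]]].
assert (Hk : (0 < Cmod kappa ^ 2)%R) by (apply pow_lt; now apply Cmod_gt_0).
exists (/ Cmod kappa ^ 2 * K)%R, r; split; [exact Hr|split].
- apply Rmult_le_pos; [apply Rlt_le, Rinv_0_lt_compat, Hk|exact HK].
- intros j; specialize (H j); rewrite <- seqU_conj, Cmod_mult, Cmod_R, Rabs_pos_eq in H by lra.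
  apply Rmult_le_reg_l with (Cmod kappa ^ 2)%R; [exact Hk|].
  rewrite !Rmult_assoc, <- (Rmult_assoc (Cmod kappa ^ 2)), Rinv_r, Rmult_1_l by lra; exact H.
Qed.

(** * The reversed polynomial and the solution of the operator equation *)

Variables (e G : R) (phi : C -> C) (p : nat -> C) (n : nat).
Hypotheses (He : (0 < e < 1)%R) (HDh : holo_on (fun z => (Cmod z < 1 + e)%R) D) (HD0 : D 0 = 1)
  (HG : (0 < G)%R) (Hphi : forall z, Cmod z = 1%R -> phi z = RtoC G * D z * Cconj (D z))
  (Hp : monic_OP phi n p).

Local Notation ps := (reversed_poly p n).

Lemma cpoly_conj (q : nat -> C) (m : nat) (z : C) :
  Cconj (cpoly q m z) = cpoly (fun k => Cconj (q k)) m (Cconj z).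
Proof.
unfold cpoly; induction m as [|m IH].
- rewrite !sum_n_0, Cmult_conj, Cpow_conj; reflexivity.
- rewrite !sum_n_S, Cplus_conj, IH, Cmult_conj, Cpow_conj; reflexivity.
Qed.

Lemma reversed_poly_circle (z : C) : Cmod z = 1%R -> ps z = zpow z (Z.of_nat n) * Cconj (cpoly p n z).
Proof.
intros Hz; rewrite reversed_polyE by now apply circle_neq_0.
now rewrite cpoly_conj, circle_conj, zpow_of_nat.
Qed.

Lemma wien_cpoly (q : nat -> C) (m : nat) : wien (cpoly q m).
Proof.
apply (wien_sum_n (fun k z => q k * z ^ k) m); intros k.
apply (wien_ext (fun z => q k * zpow z (Z.of_nat k))); [intros; now rewrite zpow_of_nat|].
apply wien_scal, wien_zpow.
Qed.

Lemma freq_ge_cpoly (q : nat -> C) (m : nat) : freq_ge 0 (cpoly q m).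
Proof.
intros k Hk; unfold cpoly; induction m as [|m IH].
- rewrite (fourier_ext _ (fun z => q 0%nat * zpow z 0)) by (intros; now rewrite sum_n_0).
  rewrite fourier_scal, fourier_zpow by apply ccirc_zpow.
  destruct (Z.eq_dec k 0); [lia|ring].
- rewrite (fourier_ext _ (fun z => sum_n (fun i => q i * z ^ i) m
     + q (S m) * zpow z (Z.of_nat (S m)))) by (intros; now rewrite sum_n_S, zpow_of_nat).
  rewrite fourier_plus, IH, fourier_scal, fourier_zpow.
  + destruct (Z.eq_dec k (Z.of_nat (S m))); [lia|ring].
  + apply ccirc_zpow.
  + apply (wien_cpoly q m).
  + apply ccirc_mult; [apply ccirc_const|apply ccirc_zpow].
Qed.

Lemma wien_reversed : wien ps.
Proof.
apply (wien_ext (fun z => zpow z (Z.of_nat n) * Cconj (cpoly p n z))).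
- intros z Hz; symmetry; now apply reversed_poly_circle.
- exact (wien_mult _ _ (wien_zpow _) (wien_conj _ (wien_cpoly p n))).
Qed.

Lemma freq_le_reversed : freq_le (Z.of_nat n) ps.
Proof.
intros k Hk.
rewrite (fourier_ext _ _ k reversed_poly_circle), fourier_zpow_mult.
rewrite fourier_conj, freq_ge_cpoly by (lia || apply wien_cpoly).
apply Cconj_0.
Qed.

Lemma phi_conj (z : C) : Cmod z = 1%R -> Cconj (phi z) = phi z.
Proof.
intros Hz; rewrite Hphi, !Cmult_conj, Cconj_conj, Cconj_RtoC by exact Hz; ring.
Qed.

Lemma wien_phi_factor : wien phi.
Proof.
apply (wien_ext (fun z => RtoC G * (D z * Dc z))).
- intros z Hz; rewrite Hphi by exact Hz; unfold Dc; ring.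
- exact (wien_scal _ _ (wien_mult _ _ HD wien_Dc)).
Qed.

(** The conjugate of orthogonality to [z^j] with [j = n - k]: on the circle [ps] is [z^n] times the
    conjugate of the polynomial, and [k] from 1 to [n] means [j] from [n - 1] down to 0. *)
Lemma reversed_orthogonal (k : Z) : (1 <= k <= Z.of_nat n)%Z ->
  fourier (fun z => ps z * phi z) k = 0.
Proof.
intros Hk; destruct Hp as [_ Ho].
set (j := Z.to_nat (Z.of_nat n - k)).
specialize (Ho (fun i => if Nat.eqb i j then 1 else 0) j ltac:(unfold j; lia)).
assert (Eq : forall z, cpoly (fun i => if Nat.eqb i j then 1 else 0) j z = z ^ j).
{ intros z; unfold cpoly.
  assert (H0 : forall m, (m < j)%nat ->
    sum_n (fun k => (if Nat.eqb k j then 1 else 0) * z ^ k) m = RtoC 0 :> C).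
  { induction m as [|m IH]; intros Hm.
    - rewrite sum_n_0; replace (Nat.eqb 0 j) with false by (symmetry; apply Nat.eqb_neq; lia).
      change (0 * z ^ 0 = 0); ring.
    - rewrite sum_n_S, IH by lia.
      replace (Nat.eqb (S m) j) with false by (symmetry; apply Nat.eqb_neq; lia).
      change (0 + 0 * z ^ S m = 0); ring. }
  destruct j as [|j'].
  - rewrite sum_n_0; simpl; ring.
  - rewrite sum_n_S, H0, Nat.eqb_refl by lia; change (0 + 1 * z ^ S j' = z ^ S j'); ring. }
rewrite <- Cconj_0, <- Ho, <- circle_int_conj.
- apply circle_int_ext; intros z Hz; rewrite Eq, reversed_poly_circle by exact Hz.
  rewrite !Cmult_conj, Cconj_conj, phi_conj by exact Hz.
  rewrite <- zpow_of_nat.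
  replace (zpow z (Z.of_nat j)) with (zpow z (- k) * zpow z (Z.of_nat n)); [ring|].
  rewrite <- zpow_add by now apply circle_neq_0. f_equal; unfold j; lia.
- apply ccirc_mult; [apply ccirc_mult|apply wien_phi_factor].
  + apply wien_cpoly.
  + apply ccirc_conj, wien_cpoly.
Qed.

Let X (z : C) : C := ps z * D z.

Lemma wien_X : wien X.
Proof. exact (wien_mult _ _ wien_reversed HD). Qed.

Lemma holo_on_reversed (U : C -> Prop) : holo_on U ps.
Proof.
unfold reversed_poly.
assert (H : forall m, holo_on U (fun z => sum_n (fun k => Cconj (p k) * z ^ (n - k)) m)).
{ induction m as [|m [d Hd]].
  - destruct (holo_on_mult U (fun _ => Cconj (p 0%nat)) (fun z => z ^ (n - 0))
      (holo_on_const U _) (holo_on_pow U _)) as [d Hd].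
    exists d; intros z Hz; destruct (Hd z Hz) as [H1 H2]; split; [|exact H2].
    revert H1; apply cderiv_ext_loc, filter_forall; intros w; now rewrite sum_n_0.
  - destruct (holo_on_plus U _ _ (ex_intro _ d Hd)
      (holo_on_mult U (fun _ => Cconj (p (S m))) (fun z => z ^ (n - S m))
      (holo_on_const U _) (holo_on_pow U _))) as [d' Hd'].
    exists d'; intros z Hz; destruct (Hd' z Hz) as [H1 H2]; split; [|exact H2].
    revert H1; apply cderiv_ext_loc, filter_forall; intros w; now rewrite sum_n_S. }
apply H.
Qed.

Lemma holo_on_X : holo_on (fun z => (Cmod z < 1 + e)%R) X.
Proof. exact (holo_on_mult _ _ _ (holo_on_reversed _) HDh). Qed.

Let Y (z : C) : C := X z * Dc z.

Lemma wien_Y : wien Y.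
Proof. exact (wien_mult _ _ wien_X wien_Dc). Qed.

Lemma G_neq_0 : RtoC G <> 0.
Proof. apply RtoC_neq_0; lra. Qed.

Lemma fourier_Y_gap (k : Z) : (1 <= k <= Z.of_nat n)%Z -> fourier Y k = 0.
Proof.
intros Hk.
rewrite (fourier_ext Y (fun z => / RtoC G * (ps z * phi z))).
- rewrite fourier_scal, reversed_orthogonal by (exact Hk ||
    exact (ccirc_mult _ _ (proj1 wien_reversed) (proj1 wien_phi_factor))); ring.
- intros z Hz; rewrite Hphi by exact Hz; unfold Y, X, Dc; field; exact G_neq_0.
Qed.

Let Yp : C -> C := freq_part (fun k => Z.of_nat n <? k)%Z Y.
Let Ym : C -> C := freq_part (fun k => k <=? 0)%Z Y.

Lemma wien_Yp : wien Yp.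
Proof. exact (wien_part _ Y wien_Y). Qed.

Lemma wien_Ym : wien Ym.
Proof. exact (wien_part _ Y wien_Y). Qed.

Lemma Y_split (z : C) : Cmod z = 1%R -> Y z = Yp z + Ym z.
Proof.
revert z; apply fourier_inj.
- apply wien_Y.
- exact (ccirc_plus _ _ (proj1 wien_Yp) (proj1 wien_Ym)).
- intros k; rewrite fourier_plus by (apply wien_Yp || apply wien_Ym).
  unfold Yp, Ym; rewrite !(fourier_part _ Y k wien_Y).
  destruct (Z.ltb_spec (Z.of_nat n) k), (Z.leb_spec k 0); try lia; try ring.
  rewrite fourier_Y_gap by lia; ring.
Qed.

Let hF (z : C) : C := / kappa * (Yp z * / D z).

Lemma wien_hF : wien hF.
Proof. exact (wien_scal _ _ (wien_mult _ _ wien_Yp HDi)). Qed.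

Lemma freq_ge_hF : freq_ge (Z.of_nat n + 1) hF.
Proof.
intros k Hk; unfold hF; rewrite fourier_scal by
  exact (proj1 (wien_mult _ _ wien_Yp HDi)).
rewrite (freq_ge_mult Yp (fun z => / D z) (Z.of_nat n + 1) 0 wien_Yp (proj1 HDi)); [ring| |exact FDi|lia].
intros i Hi; unfold Yp; rewrite (fourier_part _ Y i wien_Y).
destruct (Z.ltb_spec (Z.of_nat n) i); [lia|reflexivity].
Qed.

(* [- (1 - P_n A B P_n)^-1 P_n Q] *)
Definition core_seq (k : nat) : C := fourier hF (Z.of_nat k + 1).
Local Notation h := core_seq.

Lemma decays_core : decays h.
Proof.
apply (decays_fourier _ _ (fun j => Z.of_nat j + 1)%Z wien_hF); [reflexivity|intros; lia].
Qed.

Lemma core_low (j : nat) : (j < n)%nat -> h j = 0.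
Proof. intros Hj; apply freq_ge_hF; lia. Qed.

Lemma ser_pos_core (z : C) : Cmod z = 1%R -> ser_pos h z = hF z.
Proof.
revert z; apply fourier_inj; [apply (wien_ser_pos h decays_core)|apply wien_hF|].
intros k; destruct (Z_lt_ge_dec 0 k) as [Hk|Hk].
- replace k with (Z.of_nat (Z.to_nat (k - 1)) + 1)%Z by lia.
  rewrite (fourier_ser_pos h _ decays_core); reflexivity.
- rewrite (freq_ge_ser_pos h decays_core), freq_ge_hF by lia; reflexivity.
Qed.

Let w (z : C) : C := Ym z * / Dc z.

Lemma wien_w : wien w.
Proof. exact (wien_mult _ _ wien_Ym wien_Dc_inv). Qed.

Lemma freq_le_w : freq_le 0 w.
Proof.
apply (freq_le_mult Ym (fun z => / Dc z) 0 0 wien_Ym (proj1 wien_Dc_inv)); [|apply freq_le_Dc_inv].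
intros k Hk; unfold Ym; rewrite (fourier_part _ Y k wien_Y).
destruct (Z.leb_spec k 0); [lia|reflexivity].
Qed.

Lemma hF_psi (z : C) : Cmod z = 1%R -> hF z * psi z = X z - w z.
Proof.
intros Hz; assert (E := Y_split z Hz).
assert (H1 := D_neq_0 z); assert (H2 := Dc_neq_0 z).
rewrite Hpsi by exact Hz; fold (Dc z); unfold hF, w.
assert (EX : X z = (Yp z + Ym z) * / Dc z) by (rewrite <- E; unfold Y; field; exact H2).
rewrite EX; field; repeat split; assumption.
Qed.

(** The mean is the value at 0: the conjugate of the leading coefficient of the monic polynomial,
    times [D 0 = 1]. *)
Lemma freq_ge_X : freq_ge 0 X /\ fourier X 0 = 1.
Proof.
destruct (wien_freq_of_radius X e He holo_on_X) as [_ [H1 H2]]; split; [exact H1|].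
rewrite H2; unfold X, reversed_poly; rewrite HD0, Cmult_1_r.
assert (Ht : forall m, (m < n)%nat -> Cconj (p m) * 0 ^ (n - m) = 0).
{ intros m Hm; replace (n - m)%nat with (S (n - m - 1)) by lia; rewrite Cpow_S; ring. }
assert (H : forall m, (m <= n)%nat -> sum_n (fun k => Cconj (p k) * 0 ^ (n - k)) m =
  (if Nat.eqb m n then Cconj (p n) else 0) :> C).
{ induction m as [|m IH]; intros Hm; [rewrite sum_n_0|rewrite sum_n_S, IH by lia].
  - destruct (Nat.eqb_spec 0 n) as [E|E]; [|apply Ht; lia].
    rewrite <- E; simpl; ring.
  - replace (Nat.eqb m n) with false by (symmetry; apply Nat.eqb_neq; lia).
    destruct (Nat.eqb_spec (S m) n) as [E|E].
    + rewrite <- E, Nat.sub_diag; simpl; ring.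
    + rewrite Ht by lia; ring. }
rewrite H, Nat.eqb_refl, (proj1 Hp) by lia.
apply Cconj_RtoC.
Qed.

(** [X] has no negative frequencies and mean 1, so among the frequencies [<= 0] it cannot be told
    from the constant 1. *)
Lemma kerB_core (m : nat) : kernel_op (kerB psi) h m = fourier (fun z => 1 - w z) (- Z.of_nat m).
Proof.
rewrite (kernel_op_kerB psi h m decays_core (proj1 wien_psi)).
rewrite (fourier_ext _ (fun z => X z - w z)).
2:{ intros z Hz; rewrite (ser_pos_core z Hz); now apply hF_psi. }
rewrite !fourier_minus by (apply wien_X || apply wien_w || apply ccirc_const).
f_equal; destruct freq_ge_X as [H1 H2].
rewrite (fourier_ext (fun _ => 1) (fun z => zpow z 0)), fourier_zpow by reflexivity.
destruct (Z.eq_dec (- Z.of_nat m) 0) as [->|Hm]; [exact H2|apply H1; lia].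
Qed.

Lemma ser_neg_kerB_core (z : C) : Cmod z = 1%R -> ser_neg (kernel_op (kerB psi) h) z = 1 - w z.
Proof.
assert (HB := decays_kerB h decays_core).
revert z; apply fourier_inj; [apply (wien_ser_neg _ HB)|
  exact (ccirc_minus _ _ (ccirc_const 1) (proj1 wien_w))|].
intros k; destruct (Z_le_gt_dec k 0) as [Hk|Hk].
- replace k with (- Z.of_nat (Z.to_nat (- k)))%Z by lia.
  now rewrite (fourier_ser_neg _ _ HB), kerB_core.
- rewrite (freq_le_ser_neg _ HB) by lia.
  rewrite fourier_minus, freq_le_w by (lia || apply wien_w || apply ccirc_const).
  rewrite (fourier_ext (fun _ => 1) (fun z => zpow z 0)), fourier_zpow by reflexivity.
  destruct (Z.eq_dec k 0); [lia|ring].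
Qed.

(** On the circle [(1 - w) / psi = 1 / psi - ps * Dc / kappa + hF]. The middle term has frequencies
    [<= n] and so misses the coefficient [j + 1] as soon as [j >= n]; this is where the projection
    enters. *)
Lemma kerAB_core (j : nat) : (n <= j)%nat ->
  kernel_op (kerA psi) (kernel_op (kerB psi) h) j = seqQ psi j + h j.
Proof.
intros Hj; assert (HB := decays_kerB h decays_core).
rewrite (kernel_op_kerA psi _ j HB (proj1 wien_psi_inv)).
assert (HR : wien (fun z => / kappa * (ps z * Dc z)))
  by exact (wien_scal _ _ (wien_mult _ _ wien_reversed wien_Dc)).
rewrite (fourier_ext _ (fun z => (/ psi z - / kappa * (ps z * Dc z)) + hF z)).
- rewrite fourier_plus by (apply wien_hF || exact (ccirc_minus _ _ (proj1 wien_psi_inv) (proj1 HR))).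
  rewrite (fourier_minus _ _ _ (proj1 wien_psi_inv) (proj1 HR)).
  rewrite fourier_scal by exact (proj1 (wien_mult _ _ wien_reversed wien_Dc)).
  rewrite (freq_le_mult ps Dc (Z.of_nat n) 0 wien_reversed (proj1 wien_Dc) freq_le_reversed freq_le_Dc)
    by lia.
  unfold seqQ, core_seq; rewrite Nat2Z.inj_add; simpl Z.of_nat; ring.
- intros z Hz; rewrite (ser_neg_kerB_core z Hz), psi_inv by exact Hz.
  assert (E := Y_split z Hz); assert (H1 := D_neq_0 z); assert (H2 := Dc_neq_0 z).
  unfold hF, w.
  assert (EY : Yp z = Y z - Ym z) by (rewrite E; ring).
  rewrite EY; unfold Y, X; field; repeat split; assumption.
Qed.

Lemma core_proj : proj n h = h.
Proof.
extensionality j; unfold proj; destruct (Nat.leb_spec n j) as [Hj|Hj]; [reflexivity|].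
symmetry; now apply core_low.
Qed.

Lemma core_equation : one_minus_PABP psi n h = (fun j => - proj n (seqQ psi) j).
Proof.
extensionality j; unfold one_minus_PABP; rewrite core_proj; unfold proj.
destruct (Nat.leb_spec n j) as [Hj|Hj].
- rewrite kerAB_core by exact Hj; ring.
- rewrite core_low by exact Hj; ring.
Qed.

(** The pairing is the mean of the Cauchy kernel against [X - w]. Cauchy's formula evaluates the
    first term; the second vanishes, since the kernel meets only the frequencies [>= 1] of [w]. *)
Lemma core_pairing (z : C) : (Cmod z < 1)%R ->
  Csum (fun j => seqR psi z j * h j) = ps z * D z - 1.
Proof.
intros Hz; assert (Hc := wien_cauchy z Hz).
rewrite (Csum_ext _ (fun k => fourier (fun b => z / (b - z) * psi b) (0 - Z.of_nat k - 1) * h k))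
  by (intros k; now rewrite seqR_fourier).
rewrite (Csum_ser_pos h _ 0 decays_core (ccirc_mult _ _ (proj1 Hc) (proj1 wien_psi))).
rewrite fourier_0.
rewrite (circle_int_ext _ (fun b => z / (b - z) * X b - z / (b - z) * w b)).
2:{ intros b Hb; rewrite (ser_pos_core b Hb).
    transitivity (z / (b - z) * (hF b * psi b)); [ring|rewrite hF_psi by exact Hb; ring]. }
rewrite circle_int_minus by (apply ccirc_mult; (apply Hc || apply wien_X || apply wien_w)).
rewrite (cauchy_formula X e z He holo_on_X Hz), (circle_int_cauchy w z Hz (proj1 wien_w)).
rewrite (Csum_ext _ (fun _ => 0)) by (intros m; rewrite freq_le_w by lia; ring).
rewrite Csum_0.
destruct (wien_freq_of_radius X e He holo_on_X) as [_ [_ H0]].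
rewrite <- H0, (proj2 freq_ge_X); unfold X; ring.
Qed.

(** Linearity comes in the combined form [c * f + g], so that [T] kills the zero sequence has to be
    extracted first, from [c = 1] and two zero sequences. *)
Lemma bounded_op_opp (T : (nat -> C) -> nat -> C) (f : nat -> C) : bounded_op T -> ell2 f ->
  T (fun i => - f i) = (fun j => - T f j).
Proof.
intros [Hl _] Hf.
set (o := fun _ : nat => RtoC 0).
assert (Ho : ell2 o).
{ apply (ell2_le o f Hf); intros j; unfold o; rewrite Cmod_0; apply Cmod_ge_0. }
assert (H0 : forall j, T o j = 0).
{ intros j; assert (E := Hl 1 o o Ho Ho j).
  replace (fun i => 1 * o i + o i) with o in E by (extensionality i; unfold o; ring).
  transitivity (1 * T o j + T o j - T o j); [ring|rewrite <- E; ring]. }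
extensionality j.
replace (fun i => - f i) with (fun i => - (1) * f i + o i) by (extensionality i; unfold o; ring).
rewrite Hl, H0 by assumption; ring.
Qed.

(** * The two formulas for an arbitrary bounded inverse *)

Section Inverse.
Variable T : (nat -> C) -> nat -> C.
Hypothesis HT : is_inverse_op (one_minus_PABP psi n) T.

Lemma inverse_projQ : T (proj n (seqQ psi)) = (fun j => - h j).
Proof.
destruct HT as [Hb [_ Hinv]].
assert (E : forall j, T (one_minus_PABP psi n h) j = h j)
  by (intros j; apply Hinv, decays_ell2, decays_core).
rewrite core_equation in E.
rewrite (bounded_op_opp T _ Hb (decays_ell2 _ (decays_proj n _ decays_seqQ))) in E.
extensionality j; rewrite <- E; ring.
Qed.

Lemma inner_formula (z : C) : (Cmod z < 1)%R ->
  1 - ell2_pairing (T (proj n (seqQ psi))) (proj n (seqR psi z)) = ps z * D z.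
Proof.
intros Hz; rewrite inverse_projQ; unfold ell2_pairing.
rewrite (Csum_ext _ (fun j => - (seqR psi z j * h j))).
- rewrite Csum_opp, core_pairing by exact Hz; ring.
- intros j; unfold proj; destruct (Nat.leb_spec n j) as [Hj|Hj]; [ring|].
  rewrite core_low by exact Hj; ring.
Qed.

Let hc (j : nat) : C := Cconj (h j).

(** The conjugate of [kerAB_core]: as [B] is [|kappa|^2] times the conjugate of [A], conjugation
    exchanges the two factors and turns [Q] into a multiple of [V]. *)
Lemma conj_core_equation (j : nat) : (n <= j)%nat ->
  kernel_op (kerB psi) (kernel_op (kerA psi) hc) j =
  RtoC (/ Cmod kappa ^ 2) * seqV psi j + hc j.
Proof.
intros Hj; assert (Hd := decays_core).
assert (Hk : (Cmod kappa ^ 2 <> 0)%R) by (apply pow_nonzero, Rgt_not_eq; now apply Cmod_gt_0).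
assert (EA : kernel_op (kerB psi) h = (fun i => RtoC (Cmod kappa ^ 2) * Cconj (kernel_op (kerA psi) hc i))).
{ extensionality i; now rewrite kernel_op_kerB_conj by now apply decays_ell2. }
assert (Hhc : decays hc) by now apply decays_conj.
assert (HAc := decays_kerA hc Hhc).
rewrite kernel_op_kerB_conj by now apply decays_ell2.
assert (E := kerAB_core j Hj); rewrite EA in E.
destruct kernels_le as [K [r [HA _]]].
assert (E2 : kernel_op (kerA psi) (fun i => RtoC (Cmod kappa ^ 2) * Cconj (kernel_op (kerA psi) hc i)) j
  = RtoC (Cmod kappa ^ 2) * kernel_op (kerA psi) (fun i => Cconj (kernel_op (kerA psi) hc i)) j).
{ unfold kernel_op at 1 3.
  rewrite <- (Csum_scal _ _ _ (kernel_dominated _ K r HA _ j (decays_ell2 _ (decays_conj _ HAc)))).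
  apply Csum_ext; intros; ring. }
rewrite E2 in E.
transitivity (Cconj (seqQ psi j + h j)).
- now rewrite <- E, Cmult_conj, Cconj_RtoC.
- rewrite Cplus_conj; f_equal.
  assert (EV : seqV psi j = RtoC (Cmod kappa ^ 2) * Cconj (seqQ psi j)).
  { assert (EK := kerB_conj j 0); unfold kerA, kerB in EK; unfold seqV, seqQ.
    rewrite Nat.add_0_r in EK; rewrite <- EK; f_equal; lia. }
  rewrite EV, Cmult_assoc, <- RtoC_mult, Rinv_l, Cmult_1_l by exact Hk; reflexivity.
Qed.

(** Pair the equation for [tau = T (P_n U)] with [hc], move [A B] across as [B A] by symmetry of the
    kernels, and insert [conj_core_equation]: the pairing of [hc] with [tau] occurs on both sides
    and cancels. *)
Lemma transposed_pairing (z : C) : (1 < Cmod z)%R ->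
  RtoC (Cmod kappa ^ 2) * Csum (fun j => seqU psi z j * hc j) =
  - ell2_pairing (T (proj n (seqU psi z))) (proj n (seqV psi)).
Proof.
intros Hz; assert (Hd := decays_core).
assert (Hhc : decays hc) by now apply decays_conj.
assert (HU := decays_seqU z Hz); assert (HPU := decays_proj n _ HU).
set (tau := T (proj n (seqU psi z))).
destruct HT as [[_ [M HM]] [Hinv _]].
assert (Htau2 : ell2 tau) by (apply HM, decays_ell2, HPU).
assert (Eq : forall j, tau j = proj n (seqU psi z) j +
  proj n (kernel_op (kerA psi) (kernel_op (kerB psi) (proj n tau))) j).
{ intros j; rewrite <- (Hinv _ (decays_ell2 _ HPU) j); fold tau; unfold one_minus_PABP; ring. }
assert (Hptau : proj n tau = tau).
{ extensionality j; rewrite (Eq j); unfold proj at 1; destruct (Nat.leb_spec n j) as [Hj|Hj].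
  - exact (Eq j).
  - unfold proj; replace (n <=? j)%nat with false by (symmetry; apply Nat.leb_gt; lia); ring. }
rewrite Hptau in Eq.
destruct kernels_le as [K [r [HA HB]]].
assert (HABt : decays (kernel_op (kerA psi) (kernel_op (kerB psi) tau))).
{ apply (decays_kernel_op _ K r _ HA), decays_ell2, (decays_kernel_op _ K r _ HB Htau2). }
(* Boundedness of [T] only makes [tau] square summable, while the symmetry lemmas need decay; [Eq]
   supplies it, since [P_n U] and the image under the kernels both decay. *)
assert (Htau : decays tau).
{ destruct HPU as [K1 [r1 [Hr1 [HK1 H1]]]].
  destruct (decays_proj n _ HABt) as [K2 [r2 [Hr2 [HK2 H2]]]].
  exists (K1 + K2)%R, (Rmax r1 r2).
  assert (M1 := Rmax_l r1 r2); assert (M2 := Rmax_r r1 r2).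
  assert (M3 : (Rmax r1 r2 < 1)%R) by (apply Rmax_lub_lt; lra).
  repeat split; try lra; intros j; rewrite (Eq j).
  eapply Rle_trans; [apply Cmod_triangle|].
  rewrite Rmult_plus_distr_r; apply Rplus_le_compat.
  - eapply Rle_trans; [apply H1|]; apply Rmult_le_compat_l; [exact HK1|apply pow_incr; lra].
  - eapply Rle_trans; [apply H2|]; apply Rmult_le_compat_l; [exact HK2|apply pow_incr; lra]. }
assert (Hhl : forall j, (j < n)%nat -> hc j = 0).
{ intros j Hj; unfold hc; rewrite core_low by exact Hj; apply Cconj_0. }
assert (HBt := decays_kerB tau Htau).
assert (HAh := decays_kerA hc Hhc).
assert (HBAh := decays_kerB _ HAh).
assert (S1 : Csum (fun j => kernel_op (kerA psi) (kernel_op (kerB psi) tau) j * hc j) =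
  Csum (fun j => kernel_op (kerB psi) (kernel_op (kerA psi) hc) j * tau j)).
{ rewrite (kerA_symmetric hc (kernel_op (kerB psi) tau) Hhc HBt).
  rewrite <- (kerB_symmetric (kernel_op (kerA psi) hc) tau HAh Htau).
  apply Csum_ext; intros; ring. }
destruct (decays_mult _ _ HU Hhc) as [N1 D1].
destruct (decays_mult _ _ HABt Hhc) as [N2 D2].
destruct (decays_mult _ _ decays_seqV Htau) as [N3 D3].
destruct (decays_mult _ _ Hhc Htau) as [N4 D4].
assert (S2 : Csum (fun j => seqU psi z j * hc j) +
  Csum (fun j => kernel_op (kerA psi) (kernel_op (kerB psi) tau) j * hc j) = Csum (fun j => hc j * tau j)).
{ rewrite <- (Csum_plus _ _ _ _ D1 D2); apply Csum_ext; intros j; rewrite (Eq j); unfold proj.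
  destruct (Nat.leb_spec n j) as [Hj|Hj]; [ring|rewrite Hhl by exact Hj; ring]. }
assert (S3 : Csum (fun j => kernel_op (kerB psi) (kernel_op (kerA psi) hc) j * tau j) =
  RtoC (/ Cmod kappa ^ 2) * Csum (fun j => seqV psi j * tau j) + Csum (fun j => hc j * tau j)).
{ rewrite <- (Csum_scal _ _ _ D3), <- (Csum_plus _ _ _ _ (dominated_scal _ _ _ D3) D4).
  apply Csum_ext; intros j; destruct (Nat.leb_spec n j) as [Hj|Hj].
  - rewrite conj_core_equation by exact Hj; ring.
  - assert (E0 : tau j = 0).
    { rewrite <- Hptau; unfold proj; now replace (n <=? j)%nat with false by (symmetry; apply Nat.leb_gt; lia). }
    rewrite E0; ring. }
assert (Hk : (Cmod kappa ^ 2 <> 0)%R) by (apply pow_nonzero, Rgt_not_eq; now apply Cmod_gt_0).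
assert (EP : ell2_pairing tau (proj n (seqV psi)) = Csum (fun j => seqV psi j * tau j)).
{ apply Csum_ext; intros j; rewrite <- Hptau; unfold proj.
  destruct (Nat.leb_spec n j); ring. }
rewrite EP.
rewrite S1, S3 in S2.
set (u := Csum (fun j => seqU psi z j * hc j)) in *.
set (q := Csum (fun j => hc j * tau j)) in *.
set (v := Csum (fun j => seqV psi j * tau j)) in *.
assert (Eu : u = - (RtoC (/ Cmod kappa ^ 2) * v)).
{ transitivity (u + (RtoC (/ Cmod kappa ^ 2) * v + q) - (RtoC (/ Cmod kappa ^ 2) * v + q)); [ring|].
  rewrite S2; ring. }
rewrite Eu.
transitivity (- (RtoC (Cmod kappa ^ 2) * RtoC (/ Cmod kappa ^ 2)) * v); [ring|].
rewrite <- RtoC_mult, Rinv_r by exact Hk; ring.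
Qed.

Lemma outer_formula (z : C) : (1 < Cmod z)%R ->
  1 - ell2_pairing (T (proj n (seqU psi z))) (proj n (seqV psi)) =
  Cconj (ps (/ Cconj z) * D (/ Cconj z)).
Proof.
intros Hz.
destruct (Cmod_inv_conj_lt z Hz) as [_ Hw].
assert (E := core_pairing _ Hw); apply (f_equal Cconj) in E.
rewrite <- Csum_conj in E.
destruct (decays_mult _ _ (decays_seqU z Hz) (decays_conj _ decays_core)) as [N D1].
rewrite (Csum_ext _ (fun j => RtoC (Cmod kappa ^ 2) * (seqU psi z j * hc j))) in E.
2:{ intros j; rewrite Cmult_conj, <- seqU_conj by exact Hz; unfold hc; ring. }
rewrite (Csum_scal _ _ _ D1) in E; fold hc in E.
rewrite transposed_pairing, Cminus_conj, Cconj_RtoC in E by exact Hz.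
transitivity (1 + - ell2_pairing (T (proj n (seqU psi z))) (proj n (seqV psi))); [ring|].
rewrite E; ring.
Qed.

End Inverse.

End Hankel.

(** * Reflection in the circle and conclusion *)

Lemma log_terms_neg_conj (phi : C -> C) (z : C) (k : nat) :
  positive_on_circle phi -> analytic_near_circle phi -> z <> 0 ->
  log_terms_neg phi z k = Cconj (log_terms_pos phi (/ Cconj z) k).
Proof.
intros Hpos Han Hz.
assert (Hzc := Cconj_neq_0 z Hz).
unfold log_terms_neg, log_terms_pos.
rewrite Cmult_conj, (log_fourier_conj phi Hpos Han), Cpow_conj, Cinv_conj, Cconj_conj by exact Hzc.
now rewrite zpow_opp, zpow_of_nat, Cpow_inv by exact Hz.
Qed.

(** Reversal is an involution; in this form it uses the reversed polynomial at the reflected point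
    [/ Cconj z], where [outer_formula] provides the value. *)
Lemma cpoly_reversed (p : nat -> C) (n : nat) (z : C) : z <> 0 ->
  cpoly p n z = z ^ n * Cconj (reversed_poly p n (/ Cconj z)).
Proof.
intros Hz.
assert (Hzc := Cconj_neq_0 z Hz).
rewrite reversed_polyE by now apply Cinv_neq_0.
replace (/ / Cconj z) with (Cconj z) by (field; exact Hzc).
rewrite Cmult_conj, cpoly_conj, Cconj_conj, Cpow_conj, Cinv_conj, Cconj_conj by exact Hzc.
rewrite Cpow_inv by exact Hz.
replace (cpoly (fun k => Cconj (Cconj (p k))) n z) with (cpoly p n z).
- field; now apply Cpow_nz.
- apply sum_n_ext; intros k; now rewrite Cconj_conj.
Qed.

Theorem proposition1p7 :
  forall (phi phip phim : C -> C) (n : nat) (p : nat -> C),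
    positive_on_circle phi ->
    analytic_near_circle phi ->
    wiener_hopf phi phip phim ->
    (1 <= n)%nat ->
    monic_OP phi n p ->
    let psi : C -> C := fun z => (phip z / phim z)%C in
    ell2_kernel (kerA psi) /\
    ell2_kernel (kerB psi) /\
    (exists T, is_inverse_op (one_minus_PABP psi n) T) /\
    (forall T, is_inverse_op (one_minus_PABP psi n) T ->
      (forall z : C, (Cmod z < 1)%R ->
         ell2 (seqQ psi) /\ ell2 (seqR psi z) /\
         ex_series (log_terms_pos phi z) /\
         reversed_poly p n z =
           (Cexp (- Csum (log_terms_pos phi z)) *
            (1 - ell2_pairing (T (proj n (seqQ psi)))
                              (proj n (seqR psi z))))%C) /\
      (forall z : C, (Cmod z > 1)%R ->
         ell2 (seqU psi z) /\ ell2 (seqV psi) /\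
         ex_series (log_terms_neg phi z) /\
         cpoly p n z =
           (z ^ n * Cexp (- Csum (log_terms_neg phi z)) *
            (1 - ell2_pairing (T (proj n (seqU psi z)))
                              (proj n (seqV psi))))%C)).
Proof.
intros phi phip phim n p Hpos Han Hwh _ Hp psi.
destruct (wiener_hopf_unique phi Hpos Han phip phim Hwh) as [c [Hc0 Hc]].
set (D := szego phi); set (G := geom_mean phi).
(* The quotient of [phip = c D] by [phim = (G / c) conj D]. *)
set (kappa := c * c / RtoC G).
assert (HG : (0 < G)%R) by apply geom_mean_pos.
assert (HG0 : RtoC G <> 0) by (apply RtoC_neq_0; lra).
assert (Hk : kappa <> 0).
{ intros E; apply (Cmult_neq_0 c c Hc0 Hc0).
  transitivity (kappa * RtoC G); [unfold kappa; field; exact HG0|rewrite E; ring]. }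
assert (Dn : forall z, D z <> 0) by apply szego_neq_0.
assert (Hpsi : forall z, Cmod z = 1%R -> psi z = kappa * D z / Cconj (D z)).
{ intros z Hz; destruct (Hc z Hz) as [E1 E2]; unfold psi; rewrite E1, E2; fold D; fold G.
  assert (Hcd := Cconj_neq_0 _ (Dn z)).
  unfold kappa; field; repeat split; assumption. }
destruct (szego_wien phi Hpos Han) as [W1 [W2 _]].
destruct (szego_inv_wien phi Hpos Han) as [W3 W4].
destruct (szego_radius phi Hpos Han) as [e [He [Hh _]]].
assert (Hf := szego_factor phi Hpos Han).
destruct (kernels_le D psi kappa W1 W3 Dn Hk Hpsi) as [K [r [HA HB]]].
split; [exact (ell2_kernel_of_le _ K r HA)|].
split; [exact (ell2_kernel_of_le _ K r HB)|].
split; [exact (one_minus_PABP_invertible D psi kappa W1 W3 W2 Dn Hk Hpsi n)|].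
intros T HT.
destruct (log_terms_pos_dominated phi Hpos Han) as [q [Hq Hdom]].
assert (Hdom' : forall z, (Cmod z < 1)%R -> exists M, dominated (log_terms_pos phi z) M).
{ intros z Hz; apply Hdom; assert (0 <= Cmod z)%R by apply Cmod_ge_0; nra. }
split; intros z Hz.
- split; [exact (decays_ell2 _ (decays_seqQ D psi kappa W1 W3 Dn Hk Hpsi))|].
  split; [exact (decays_ell2 _ (decays_seqR D psi kappa W1 W3 Dn Hpsi z Hz))|].
  destruct (Hdom' z Hz) as [M HM].
  split; [exact (dominated_ex_series _ _ HM)|].
  rewrite (inner_formula D psi kappa W1 W3 W2 W4 Dn Hk Hpsi e G phi p n He Hh (szego_0 phi) HG Hf Hp T HT z Hz).
  rewrite Cexp_opp; change (Cexp (Csum (log_terms_pos phi z))) with (D z).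
  field; apply Dn.
- destruct (Cmod_inv_conj_lt z Hz) as [Hz0 Hw].
  split; [exact (decays_ell2 _ (decays_seqU D psi kappa W1 W3 Dn Hk Hpsi z Hz))|].
  split; [exact (decays_ell2 _ (decays_seqV D psi kappa W1 W3 Dn Hpsi))|].
  destruct (Hdom' _ Hw) as [M HM].
  assert (El : forall k, log_terms_neg phi z k = Cconj (log_terms_pos phi (/ Cconj z) k))
    by (intros k; now apply log_terms_neg_conj).
  split.
  + apply (dominated_ex_series _ M); split; [apply HM|].
    intros k; rewrite El, Cmod_conj; apply HM.
  + rewrite (outer_formula D psi kappa W1 W3 W2 W4 Dn Hk Hpsi e G phi p n He Hh (szego_0 phi) HG Hf Hp T HT z Hz).
    rewrite (Csum_ext _ _ El), Csum_conj, <- Copp_conj, Cexp_conj, Cexp_opp.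
    change (Cexp (Csum (log_terms_pos phi (/ Cconj z)))) with (D (/ Cconj z)).
    rewrite (cpoly_reversed p n z Hz0), Cmult_conj, Cinv_conj by apply Dn.
    field; apply Cconj_neq_0, Dn.
Qed.
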